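(* Let $m\in\{3,5,7,11\}$, and put $k_m:=m+2$ if $m=3$ and $k_m:=m-2$ if $m>3$. Let $\ell$ be an odd prime and $\varepsilon_{m,\ell}\in\{\pm1\}$ be such that $$\ell^{k_m-2}\equiv-1+\varepsilon_{m,\ell}\,\ell^{(k_m-3)/2}\pmod m.$$ Let $n$ be a positive integer prime to $\ell$ such that $$\left(\frac{(-1)^{(k_m-1)/2}n}{\ell}\right)=\varepsilon_{m,\ell}\qquad\text{and}\qquad n\equiv7m\pmod8.$$ Then, for every integer $j\geq0$, $$\mathrm{OSOME}(m4^j\ell^2n)\equiv0\pmod m.$$
   Context: An overpartition of a nonnegative integer $n$ is a partition of $n$ (a non-increasing sequence of positive integers with sum $n$) in which the first occurrence of each number may be overlined (or not). $\mathrm{OSOME}_o(n)$ (resp. $\mathrm{OSOME}_e(n)$) denotes the sum of all odd (resp. even) overlined parts, taken over all overpartitions of $n$, and $\mathrm{OSOME}(n):=\mathrm{OSOME}_o(n)-\mathrm{OSOME}_e(n)$. The symbol $\left(\frac{\cdot}{\ell}\right)$ is the Legendre symbol. *)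

(* Defs.v *)
From mathcomp Require Import all_boot all_order all_algebra.

Set Implicit Arguments.
Unset Strict Implicit.
Unset Printing Implicit Defensive.

Import Order.TTheory GRing.Theory Num.Theory.

Local Open Scope ring_scope.

(* A part is a pair of its size and a boolean telling whether it is
   overlined. *)
Definition parts (s : seq (nat * bool)) : seq nat := unzip1 s.

Definition first_occurrence (s : seq (nat * bool)) (i : nat) : bool :=
  nth 0%N (parts s) i \notin take i (parts s).

Definition is_overpartition (n : nat) (s : seq (nat * bool)) : bool :=
  [&& sorted geq (parts s),
      all (fun p => 0 < p)%N (parts s),
      sumn (parts s) == n
    & all (fun i => (nth (0%N, false) s i).2 ==> first_occurrence s i)
          (iota 0 (size s))].

(* An overpartition of n has at most n parts, each of size at most n
   (overpartition_code below), so a finite type of codes enumerates them. *)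
Definition overpartition_codes (n : nat) := n.-bseq ('I_n.+1 * bool)%type.

Definition decode (n : nat) (c : overpartition_codes n) : seq (nat * bool) :=
  [seq (nat_of_ord p.1, p.2) | p <- c].

Lemma decode_inj n : injective (@decode n).
Proof.
move=> c d; rewrite /decode => /inj_map eq_cd; apply/val_inj/eq_cd.
by move=> [i a] [j b] [/val_inj-> ->].
Qed.

Lemma overpartition_code n s :
  is_overpartition n s -> exists c : overpartition_codes n, decode c = s.
Proof.
case/and4P=> _ pos_s /eqP sum_s _.
have size_s : (size s <= n)%N.
  rewrite -sum_s /parts; elim: s pos_s {sum_s} => //= x s IHs /andP[x_gt0 /IHs].
  by move=> le_s; rewrite -add1n leq_add.
have le_s p : p \in s -> (p.1 < n.+1)%N.
  rewrite ltnS -sum_s /parts; elim: s {pos_s sum_s size_s} => //= x s IHs.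
  rewrite inE => /predU1P[-> | /IHs le_p]; first exact: leq_addr.
  exact: leq_trans le_p (leq_addl _ _).
pose c := [seq ((inord p.1 : 'I_n.+1), p.2) | p <- s].
have size_c : (size c <= n)%N by rewrite size_map.
exists (Bseq size_c); rewrite /decode /= -map_comp.
rewrite -[RHS]map_id; apply/eq_in_map => -[i a] /le_s /= lt_i.
by rewrite inordK.
Qed.

Definition overlined_sum (Q : pred nat) (s : seq (nat * bool)) : nat :=
  (\sum_(p <- s | p.2 && Q p.1) p.1)%N.

Definition OSOME_o (n : nat) : nat :=
  (\sum_(c : overpartition_codes n | is_overpartition n (decode c))
      overlined_sum odd (decode c))%N.

Definition OSOME_e (n : nat) : nat :=
  (\sum_(c : overpartition_codes n | is_overpartition n (decode c))
      overlined_sum (fun p => ~~ odd p) (decode c))%N.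

Definition OSOME (n : nat) : int := (OSOME_o n)%:Z - (OSOME_e n)%:Z.

(* Legendre symbol (a / l), meaningful for l an odd prime. *)
Definition legendre (a : int) (l : nat) : int :=
  if (l%:Z %| a)%Z then 0
  else if [exists x : 'I_l, ((x : nat)%:Z ^+ 2 == a %[mod l%:Z])%Z] then 1
  else -1.

Definition k_ (m : nat) : nat := if m == 3%N then (m + 2)%N else (m - 2)%N.

(* Main.v *)
From HB Require Import structures.
From mathcomp Require Import all_boot all_order all_algebra.
From mathcomp Require Import finmap.
From mathcomp Require Import boolp classical_sets cardinality fsbigop.
From mathcomp Require Import ring lra zify.
Require Import Defs.

(** Write [theta] for the sum of [q ^ (x ^ 2)] over the integers [x], and
    [thetaF] for the sum of [sigma_1(n) q ^ n] over the odd [n].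

    Overpartitions have the generating series [1 / theta(- q)] by a product of
    Gauss ([gauss_eqm]), and weighting them by their overlined parts multiplies
    this series by a Lambert series which Jacobi's four-square theorem evaluates.
    So [8 * OSOME n] is, up to sign, the [n]-th coefficient of
    [1 / theta - theta ^ 3] ([OSOME_itheta]).  At the argument [m 4 ^ j l ^ 2 n]
    the term [theta ^ 3] vanishes, because [m l ^ 2 n] is [7] modulo [8] and
    such a number is not a sum of three squares; there remains the coefficient
    of [1 / theta], to be computed modulo [m].

    Modulo [m].  The square of [theta] is a hypergeometric series in
    [t = thetaF / theta ^ 4] with coefficients ['C(2n, n) ^ 2] ([theta2_hyper]);
    by the Lucas congruence and the Frobenius map, modulo [m] the power
    [theta ^ (- 2 (m - 1))] is a polynomial in [t] ([hyperp_ith]).  Since the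
    derivation [q d/dq] multiplies [t ^ i] by [i thetab], keeping every [m]-th
    coefficient of [1 / theta] keeps only every [m]-th power of [t], and the
    outcome is [theta ^ 5], [theta ^ 3], [theta ^ 5 + 3 theta thetaF] and
    [theta ^ 9 + theta ^ 5 thetaF] for [m = 3, 5, 7, 11] ([U_itheta3] to
    [U_itheta11]): a form of weight [k_m / 2].

    Hecke relation.  On the residue class of [n] modulo [8], the coefficients of
    these series at [4 ^ j n] are, for a constant depending on [j] alone,
    multiples of a single sequence [c(n)] ([theta5_4X], [theta9_4X]), with
      [c(l ^ 2 n) + chi(l) l ^ ((k_m - 3) / 2) c(n) = (1 + l ^ (k_m - 2)) c(n)].
    Under the hypotheses [chi(l)] is [eps], and the congruence imposed on [l]
    says that [m] divides [1 + l ^ (k_m - 2) - eps l ^ ((k_m - 3) / 2)], hence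
    [c(l ^ 2 n)].

    The sequences [c(n)] are combinations of sums over the binary quadratic forms
    [Q = [u, v, w]] with [u < 0 < w] of discriminant [n] or [4 n]; this is seen from
    the dissection of [theta] modulo [4] and from evaluations of theta series by
    divisor sums, which follow from an identity of Liouville ([liouville]).
    For such sums the Hecke relation is proved by an argument of Zagier: the sum
    over the forms with [u < 0 < Q(p, r)] of a power of [Q(p, r)], or of a genus
    character when [m = 5], changes in a controlled way under [p -> p + r] and
    [p <-> r], so that the Euclidean algorithm evaluates it for all coprime [p, r]
    ([zagier_w4], [zagier_w2], [zagier_w2_square], [zagier_w1]); and these sums at the [l + 1] points of the projective line
    modulo [l] count the forms of discriminant [l ^ 2 D] through the sublattices
    of index [l] ([hecke_simple]). *)

Set Implicit Arguments.
Unset Strict Implicit.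
Unset Printing Implicit Defensive.

Import Order.TTheory GRing.Theory Num.Theory.
Local Open Scope classical_set_scope.
Local Open Scope ring_scope.

(** * Formal power series *)

Record fps (R : Type) := Fps { fcoef :> nat -> R }.

Lemma fpsP (R : Type) (f g : fps R) : f =1 g -> f = g.
Proof. by case: f g => [f] [g] /= /funext ->. Qed.

HB.instance Definition _ (R : Type) := gen_eqMixin (fps R).
HB.instance Definition _ (R : Type) := gen_choiceMixin (fps R).

Section FpsRing.
Variable R : comNzRingType.
Implicit Types f g h : fps R.

Definition fps0 : fps R := Fps (fun=> 0).
Definition fps1 : fps R := Fps (fun n => (n == 0%N)%:R).
Definition fps_add f g : fps R := Fps (fun n => f n + g n).
Definition fps_opp f : fps R := Fps (fun n => - f n).
Definition fps_mul f g : fps R := Fps (fun n => \sum_(i < n.+1) f i * g (n - i)%N).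

Fact fps_addA : associative fps_add.
Proof. by move=> f g h; apply: fpsP => n /=; rewrite addrA. Qed.
Fact fps_addC : commutative fps_add.
Proof. by move=> f g; apply: fpsP => n /=; rewrite addrC. Qed.
Fact fps_add0 : left_id fps0 fps_add.
Proof. by move=> f; apply: fpsP => n /=; rewrite add0r. Qed.
Fact fps_addN : left_inverse fps0 fps_opp fps_add.
Proof. by move=> f; apply: fpsP => n /=; rewrite addNr. Qed.

HB.instance Definition _ :=
  GRing.isZmodule.Build (fps R) fps_addA fps_addC fps_add0 fps_addN.

(** Only the coefficients up to [n] matter for the [n]-th coefficient of a
    product, so ring identities are inherited from polynomials. *)
Definition trunc N f : {poly R} := \poly_(i < N) f i.

Lemma fps_mulE N f g n : (n < N)%N ->
  fps_mul f g n = (trunc N f * trunc N g)`_n.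
Proof.
move=> nN; rewrite coefM; apply: eq_bigr => -[i /= il] _.
by rewrite !coef_poly !ifT //; lia.
Qed.

Lemma fps_mul_eqm N f f' g g' n : (n < N)%N ->
  (forall i, (i < N)%N -> f i = f' i) -> (forall i, (i < N)%N -> g i = g' i) ->
  fps_mul f g n = fps_mul f' g' n.
Proof.
by move=> nN ff' gg'; apply: eq_bigr => -[i /= il] _; rewrite ff' ?gg' //; lia.
Qed.

Lemma fps_mul_poly (p r : {poly R}) :
  fps_mul (Fps (fun n => p`_n)) (Fps (fun n => r`_n)) =1 (fun n => (p * r)`_n).
Proof. by move=> n; rewrite coefM. Qed.

Lemma trunc_fps N f i : (i < N)%N -> f i = Fps (fun n => (trunc N f)`_n) i.
Proof. by move=> iN /=; rewrite coef_poly iN. Qed.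

Fact fps_mulC : commutative fps_mul.
Proof.
by move=> f g; apply: fpsP => n; rewrite !(@fps_mulE n.+1) // mulrC.
Qed.

Fact fps_mulA : associative fps_mul.
Proof.
move=> f g h; apply: fpsP => n.
have T k := @trunc_fps n.+1 k.
rewrite (@fps_mul_eqm n.+1 f _ (fps_mul g h)
          (Fps (fun m => (trunc n.+1 g * trunc n.+1 h)`_m)) n _ (T f)) //; last first.
  by move=> i ilt; rewrite (@fps_mulE n.+1).
rewrite [RHS](@fps_mul_eqm n.+1 (fps_mul f g)
          (Fps (fun m => (trunc n.+1 f * trunc n.+1 g)`_m)) h _ n _ _ (T h)) //; last first.
  by move=> i ilt; rewrite (@fps_mulE n.+1).
by rewrite !fps_mul_poly mulrA.
Qed.

Fact fps_mul1 : left_id fps1 fps_mul.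
Proof.
move=> f; apply: fpsP => n /=; rewrite big_ord_recl /= mul1r subn0 big1 ?addr0 //.
by move=> i _; rewrite mul0r.
Qed.

Fact fps_mulDl : left_distributive fps_mul fps_add.
Proof.
move=> f g h; apply: fpsP => n /=; rewrite -big_split /=.
by apply: eq_bigr => i _; rewrite mulrDl.
Qed.

Fact fps1_neq0 : fps1 != 0.
Proof.
by apply/eqP => /(congr1 (fun f : fps R => f 0%N)) /= /eqP; rewrite oner_eq0.
Qed.

HB.instance Definition _ :=
  GRing.Zmodule_isComNzRing.Build (fps R) fps_mulA fps_mulC fps_mul1 fps_mulDl fps1_neq0.

Lemma fcoefD f g n : (f + g) n = f n + g n. Proof. by []. Qed.
Lemma fcoefN f n : (- f) n = - f n. Proof. by []. Qed.
Lemma fcoefB f g n : (f - g) n = f n - g n. Proof. by []. Qed.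
Lemma fcoef0 n : (0 : fps R) n = 0. Proof. by []. Qed.
Lemma fcoef1 n : (1 : fps R) n = (n == 0%N)%:R. Proof. by []. Qed.
Lemma fcoefM f g n : (f * g) n = \sum_(i < n.+1) f i * g (n - i)%N. Proof. by []. Qed.

Lemma fcoef_sum I (r : seq I) (P : pred I) (F : I -> fps R) n :
  (\sum_(i <- r | P i) F i) n = \sum_(i <- r | P i) F i n.
Proof. exact: (big_morph (fun f : fps R => f n) (fun f g => fcoefD f g n) (fcoef0 n)). Qed.

Lemma fcoefMn f k n : (f *+ k) n = f n *+ k.
Proof. by elim: k => // k IHk; rewrite !mulrS fcoefD IHk. Qed.

Lemma fcoef_nat k n : (k%:R : fps R) n = (n == 0%N)%:R * k%:R.
Proof. by rewrite fcoefMn fcoef1 mulr_natr. Qed.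

Lemma fcoefZn k f n : (k%:R * f) n = k%:R * f n.
Proof. by rewrite mulr_natl fcoefMn mulr_natl. Qed.

Lemma fcoef0M f g : (f * g) 0%N = f 0%N * g 0%N.
Proof. by rewrite fcoefM big_ord1. Qed.

Lemma fcoef0X f k : (f ^+ k) 0%N = f 0%N ^+ k.
Proof. by elim: k => // k IHk; rewrite !exprS fcoef0M IHk. Qed.

Definition fpsC (c : R) : fps R := Fps (fun n => (n == 0%N)%:R * c).

Lemma fcoefC c n : fpsC c n = (n == 0%N)%:R * c. Proof. by []. Qed.

Lemma fcoefCM c f n : (fpsC c * f) n = c * f n.
Proof.
rewrite fcoefM big_ord_recl /= mul1r subn0 big1 ?addr0 // => i _.
by rewrite !mul0r.
Qed.

Fact fpsC_is_zmod_morphism : zmod_morphism fpsC.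
Proof. by move=> c d; apply: fpsP => n /=; rewrite mulrBr. Qed.
Fact fpsC_is_monoid_morphism : monoid_morphism fpsC.
Proof.
split=> [|c d]; first by apply: fpsP => n /=; rewrite mulr1.
by apply: fpsP => n; rewrite fcoefCM !fcoefC mulrCA.
Qed.
HB.instance Definition _ := GRing.isZmodMorphism.Build R (fps R) fpsC fpsC_is_zmod_morphism.
HB.instance Definition _ := GRing.isMonoidMorphism.Build R (fps R) fpsC fpsC_is_monoid_morphism.

Definition q : fps R := Fps (fun n => (n == 1%N)%:R).

Lemma fcoef_q n : q n = (n == 1%N)%:R. Proof. by []. Qed.

Lemma fcoefqM f n : (q * f) n = if n is m.+1 then f m else 0.
Proof.
rewrite fcoefM big_ord_recl /= mul0r add0r; case: n => [|n]; first by rewrite big_ord0.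
rewrite big_ord_recl /= mul1r subSS subn0 big1 ?addr0 // => i _.
by rewrite /bump /= mul0r.
Qed.

Lemma fcoefqXM k f n : (q ^+ k * f) n = if (k <= n)%N then f (n - k)%N else 0.
Proof.
elim: k f n => [|k IHk] f n; first by rewrite expr0 mul1r leq0n subn0.
by rewrite exprS -mulrA fcoefqM; case: n => [|n] //; rewrite IHk.
Qed.

Lemma fcoef_qX k n : (q ^+ k) n = (n == k)%:R.
Proof.
rewrite -[q ^+ k]mulr1 fcoefqXM fcoef1 subn_eq0 eqn_leq.
by have [kn|nk] := leqP k n; rewrite ?andbT ?andbF.
Qed.

(** Congruence modulo [q ^ N]. *)
Definition eqm N f g := forall i, (i < N)%N -> f i = g i.

Lemma eqm_refl N f : eqm N f f. Proof. by []. Qed.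
Lemma eqm_sym N f g : eqm N f g -> eqm N g f.
Proof. by move=> fg i iN; rewrite fg. Qed.
Lemma eqm_trans N g f h : eqm N f g -> eqm N g h -> eqm N f h.
Proof. by move=> fg gh i iN; rewrite fg ?gh. Qed.
Lemma eqmD N f f' g g' : eqm N f f' -> eqm N g g' -> eqm N (f + g) (f' + g').
Proof. by move=> ff gg i iN; rewrite !fcoefD ff ?gg. Qed.
Lemma eqmN N f f' : eqm N f f' -> eqm N (- f) (- f').
Proof. by move=> ff i iN; rewrite !fcoefN ff. Qed.
Lemma eqmB N f f' g g' : eqm N f f' -> eqm N g g' -> eqm N (f - g) (f' - g').
Proof. by move=> ff gg; apply: eqmD => //; apply: eqmN. Qed.
Lemma eqmM N f f' g g' : eqm N f f' -> eqm N g g' -> eqm N (f * g) (f' * g').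
Proof. by move=> ff gg i iN; apply: (fps_mul_eqm iN). Qed.
Lemma eqmX N f f' k : eqm N f f' -> eqm N (f ^+ k) (f' ^+ k).
Proof.
move=> ff; elim: k => [|k IHk]; first by rewrite !expr0; apply: eqm_refl.
by rewrite !exprS; apply: eqmM.
Qed.
Lemma eqm_sum N I (r : seq I) (P : pred I) (F G : I -> fps R) :
  (forall i, P i -> eqm N (F i) (G i)) ->
  eqm N (\sum_(i <- r | P i) F i) (\sum_(i <- r | P i) G i).
Proof.
move=> FG; apply: (big_ind2 (eqm N)) => // *; exact: eqmD.
Qed.
Lemma eqm_eq f g : (forall N, eqm N f g) -> f = g.
Proof. by move=> fg; apply: fpsP => n; apply: (fg n.+1). Qed.
Lemma eqm_leq M N f g : (M <= N)%N -> eqm N f g -> eqm M f g.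
Proof. by move=> MN fg i iM; apply: fg; apply: leq_trans MN. Qed.
Lemma eqm_eq_leq f g : (forall N, exists2 M, (N <= M)%N & eqm M f g) -> f = g.
Proof. by move=> fg; apply: eqm_eq => N; have [M NM] := fg N; apply: eqm_leq. Qed.

Lemma eqm0_qX k f : eqm k (q ^+ k * f) 0.
Proof. by move=> i ik; rewrite fcoefqXM leqNgt ik. Qed.

Lemma eqm0P k f : eqm k f 0 -> exists g, f = q ^+ k * g.
Proof.
move=> f0; exists (Fps (fun n => f (n + k)%N)); apply: fpsP => n.
by rewrite fcoefqXM; case: leqP => [kn | /f0 //] /=; rewrite subnK.
Qed.

Lemma eqm0X f k : f 0%N = 0 -> eqm k (f ^+ k) 0.
Proof.
move=> f0; have /eqm0P[g ->] : eqm 1 f 0 by move=> [|i] //.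
by rewrite expr1 exprMn; apply: eqm0_qX.
Qed.

(** Inverses, by the geometric series. *)
Lemma fps_inv f : f 0%N = 1 -> exists g, f * g = 1 /\ g 0%N = 1.
Proof.
move=> f0; pose S N : fps R := \sum_(k < N) (1 - f) ^+ k.
pose g := Fps (fun n => S n.+1 n).
have u0 : (1 - f) 0%N = 0 by rewrite fcoefB fcoef1 f0 subrr.
have gS N : eqm N g (S N).
  move=> i iN; rewrite -[LHS]/(S i.+1 i).
  rewrite -(subnKC iN); move: (N - i.+1)%N => d.
  have -> : S (i.+1 + d)%N = S i.+1 + \sum_(k < d) (1 - f) ^+ (i.+1 + k).
    by rewrite /S big_split_ord.
  rewrite fcoefD [X in _ + X]fcoef_sum [X in _ + X]big1 ?addr0 // => k _.
  by rewrite (eqm0X (k := i.+1 + k) u0) //= ltn_addr.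
exists g; split; last by rewrite /= /S big_ord1 expr0 fcoef1.
apply: eqm_eq => N; apply: (eqm_trans (eqmM (eqm_refl f) (gS N))).
have -> : f * S N = 1 - (1 - f) ^+ N.
  by rewrite -[RHS]opprB subrX1 -/(S N); ring.
rewrite -[X in eqm N _ X]subr0; apply: eqmB; first exact: eqm_refl.
exact: eqm0X.
Qed.

(** The substitution [q -> q ^ r]. *)
Definition V r f : fps R := Fps (fun n => if (r %| n)%N then f (n %/ r)%N else 0).

Lemma fcoefV r f n : V r f n = if (r %| n)%N then f (n %/ r)%N else 0.
Proof. by []. Qed.

Lemma fcoefVM r f n : (0 < r)%N -> V r f (r * n)%N = f n.
Proof. by move=> r0 /=; rewrite dvdn_mulr // mulKn. Qed.

Fact V_is_zmod_morphism r : zmod_morphism (V r).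
Proof. by move=> f g; apply: fpsP => n /=; case: ifP; rewrite ?subr0. Qed.

Fact V_is_monoid_morphism r : monoid_morphism (V r.+1).
Proof.
split=> [|f g].
  apply: fpsP => n /=; case: ifP => [/dvdnP[m ->]|]; first by rewrite mulnK // muln_eq0 orbF.
  by case: n => //; rewrite dvdn0.
apply: fpsP => n.
have VE h i : (i < n.+1)%N -> V r.+1 h i = (trunc n.+1 h \Po 'X^(r.+1))`_i.
  move=> il; rewrite coef_comp_poly_Xn //= coef_poly; case: ifP => // _.
  by rewrite (leq_ltn_trans (leq_div _ _) il).
rewrite -[RHS]/(fps_mul (V r.+1 f) (V r.+1 g) n) (@fps_mul_eqm n.+1 _ (Fps (fun m => (trunc n.+1 f \Po 'X^(r.+1))`_m)) _
  (Fps (fun m => (trunc n.+1 g \Po 'X^(r.+1))`_m)) n) //; try exact: VE.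
rewrite fps_mul_poly -comp_polyM coef_comp_poly_Xn // fcoefV; case: ifP => // _.
by rewrite -(@fps_mulE n.+1) ?ltnS ?leq_div.
Qed.

HB.instance Definition _ r :=
  GRing.isZmodMorphism.Build (fps R) (fps R) (V r) (V_is_zmod_morphism r).
HB.instance Definition _ r :=
  GRing.isMonoidMorphism.Build (fps R) (fps R) (V r.+1) (V_is_monoid_morphism r).

Lemma V_comp r s f : (0 < r)%N -> (0 < s)%N -> V r (V s f) = V (r * s) f.
Proof.
move=> r0 s0; apply: fpsP => n /=.
case: (boolP (r %| n)%N) => [rn | rn]; last first.
  by case: ifP => // /(dvdn_trans (dvdn_mulr s (dvdnn r))) => H; rewrite H in rn.
by rewrite dvdn_divRL // [(s * r)%N]mulnC divnMA.
Qed.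

Lemma V_q r : (0 < r)%N -> V r q = q ^+ r.
Proof.
move=> r0; apply: fpsP => n; rewrite fcoef_qX /=.
case: ifP => [/dvdnP[m ->]|].
  by rewrite mulnK // -{2}[r]mul1n eqn_mul2r (gtn_eqF r0).
by case: eqP => // ->; rewrite dvdnn.
Qed.

Lemma V0 r f : (V r f) 0%N = f 0%N. Proof. by rewrite /= dvdn0 div0n. Qed.

(** The substitution [q -> - q]. *)
Definition neg f : fps R := Fps (fun n => (-1) ^+ n * f n).

Lemma fcoef_neg f n : neg f n = (-1) ^+ n * f n. Proof. by []. Qed.

Lemma neg0 f : neg f 0%N = f 0%N. Proof. by rewrite /= mul1r. Qed.

Fact neg_is_zmod_morphism : zmod_morphism neg.
Proof. by move=> f g; apply: fpsP => n /=; rewrite mulrBr. Qed.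
Fact neg_is_monoid_morphism : monoid_morphism neg.
Proof.
split=> [|f g]; first by apply: fpsP => -[|n] /=; rewrite ?mulr1 ?mulr0.
apply: fpsP => n; rewrite fcoef_neg !fcoefM mulr_sumr; apply: eq_bigr => i _ /=.
have {1}-> : (n = i + (n - i))%N by rewrite subnKC // -ltnS.
by rewrite exprD; ring.
Qed.
HB.instance Definition _ := GRing.isZmodMorphism.Build (fps R) (fps R) neg neg_is_zmod_morphism.
HB.instance Definition _ := GRing.isMonoidMorphism.Build (fps R) (fps R) neg neg_is_monoid_morphism.

Lemma negK f : neg (neg f) = f.
Proof. by apply: fpsP => n /=; rewrite mulrA -exprMn mulrNN mulr1 expr1n mul1r. Qed.

Lemma neg_q : neg q = - q.
Proof.
by apply: fpsP => -[|[|n]]; rewrite fcoefN /= ?mulr0 ?oppr0 // expr1 mulr1.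
Qed.

Lemma neg_Veven r f : ~~ odd r -> neg (V r f) = V r f.
Proof.
move=> r2; apply: fpsP => n /=; case: ifP => [/dvdnP[m ->]|]; last by rewrite mulr0.
by rewrite -signr_odd oddM (negPf r2) andbF expr0 mul1r.
Qed.

(** The derivation [q d/dq]. *)
Definition D f : fps R := Fps (fun n => n%:R * f n).

Lemma fcoef_D f n : D f n = n%:R * f n. Proof. by []. Qed.

Lemma DD f g : D (f + g) = D f + D g.
Proof. by apply: fpsP => n; rewrite fcoefD /= mulrDr. Qed.
Lemma DN f : D (- f) = - D f.
Proof. by apply: fpsP => n; rewrite fcoefN /= mulrN. Qed.
Lemma DB f g : D (f - g) = D f - D g. Proof. by rewrite DD DN. Qed.
Lemma DM f g : D (f * g) = D f * g + f * D g.
Proof.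
apply: fpsP => n; rewrite fcoefD fcoef_D !fcoefM mulr_sumr -big_split /=.
apply: eq_bigr => i _; have {1}-> : (n = i + (n - i))%N by rewrite subnKC // -ltnS.
by rewrite natrD; ring.
Qed.
Lemma D1 : D 1 = 0.
Proof. by apply: fpsP => -[|n]; rewrite fcoef_D /= ?mul0r // mulr0. Qed.
Lemma D0 : D 0 = 0.
Proof. by apply: fpsP => n; rewrite fcoef_D /= mulr0. Qed.
Lemma DMn f k : D (f *+ k) = D f *+ k.
Proof. by elim: k => [|k IHk]; rewrite ?D0 // !mulrS DD IHk. Qed.
Lemma D_nat k : D k%:R = 0. Proof. by rewrite DMn D1 mul0rn. Qed.
Lemma DX f k : D (f ^+ k) = k%:R * f ^+ k.-1 * D f.
Proof.
elim: k => [|k IHk]; first by rewrite expr0 D1 !mul0r.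
rewrite exprS DM IHk /=; case: k {IHk} => [|k]; first by rewrite expr0 /=; ring.
by rewrite /= exprS -[k.+2]addn1 natrD; ring.
Qed.
Lemma D_q : D q = q.
Proof. by apply: fpsP => -[|[|n]]; rewrite fcoef_D /= ?mul0r ?mulr0 ?mul1r. Qed.
Lemma DV r f : (0 < r)%N -> D (V r f) = r%:R * V r (D f).
Proof.
move=> r0; apply: fpsP => n; rewrite fcoefZn fcoef_D /=; case: ifP; last by rewrite !mulr0.
by case/dvdnP=> m ->; rewrite mulnK // natrM; ring.
Qed.
Lemma Dneg f : D (neg f) = neg (D f).
Proof. by apply: fpsP => n /=; ring. Qed.
Lemma eqm_D N f g : eqm N f g -> eqm N (D f) (D g).
Proof. by move=> fg i iN; rewrite !fcoef_D fg. Qed.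

(** The operator keeping every [r]-th coefficient. *)
Definition U r f : fps R := Fps (fun n => f (r * n)%N).

Lemma fcoefU r f n : U r f n = f (r * n)%N. Proof. by []. Qed.

Lemma UD r f g : U r (f + g) = U r f + U r g.
Proof. by apply: fpsP. Qed.

Lemma UM_V r f g : (0 < r)%N -> U r (f * V r g) = U r f * g.
Proof.
move=> r0; apply: fpsP => n; rewrite fcoefU !fcoefM.
rewrite (bigID (fun i : 'I__ => r %| i)%N) /= [X in _ + X]big1 ?addr0 => [|i ri].
  rewrite (reindex_onto (fun j : 'I_n.+1 => (inord (r * j) : 'I_(r * n).+1))
             (fun i : 'I_(r * n).+1 => inord (i %/ r))) /=.
    have E (j : 'I_n.+1) : (r * j < (r * n).+1)%N by rewrite ltnS leq_mul2l -ltnS ltn_ord orbT.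
    apply: eq_big => [j | j].
      rewrite inordK ?E // dvdn_mulr //= mulKn //.
      by rewrite inord_val eqxx.
    by move=> _; rewrite inordK ?E // -mulnBr dvdn_mulr // mulKn.
  move=> i /dvdnP[m im]; apply/val_inj.
  have il : (i <= r * n)%N by rewrite -ltnS.
  rewrite /= im mulnK //; have ml : (m < n.+1)%N.
    by move: il; rewrite im mulnC leq_pmul2l.
  have -> : (inord m : 'I_n.+1) = m :> nat by rewrite inordK.
  by rewrite [(r * m)%N]mulnC inordK // -im ltn_ord.
rewrite dvdn_subr ?(negPf ri) ?mulr0 //; last by rewrite dvdn_mulr.
by rewrite -ltnS.
Qed.


End FpsRing.

Arguments q {R}.

Section FpsDomain.
Variable R : idomainType.
Implicit Types f g h : fps R.

Lemma fps_mul_eq0 f g : f * g = 0 -> f = 0 \/ g = 0.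
Proof.
move=> fg0; have [->|fN] := pselect (f = 0); first by left.
have [->|gN] := pselect (g = 0); first by right.
have ex h : h <> 0 -> exists n, h n != 0.
  by move=> hN; apply: contrapT => /forallNP H; apply: hN; apply: fpsP => n; apply/eqP; have /negP := H n; rewrite negbK.
case: (ex_minnP (ex f fN)) => i fi mini; case: (ex_minnP (ex g gN)) => j gj minj.
have /eqP := congr1 (fun h : fps R => h (i + j)%N) fg0.
rewrite fcoef0 fcoefM (bigD1 (inord i)) //= inordK ?ltnS ?leq_addr //.
rewrite addKn big1 ?addr0 ?mulf_eq0 ?(negPf fi) ?(negPf gj) // => k kN.
have [ki|ik|ki] := ltngtP k i.
- suff -> : f k = 0 by rewrite mul0r.
  by apply/eqP; apply: contraLR ki => /mini; rewrite -leqNgt.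
- suff -> : g (i + j - k)%N = 0 by rewrite mulr0.
  apply/eqP; apply: contraTT ik => /minj; rewrite -leqNgt.
  have := ltn_ord k; lia.
- by case/eqP: kN; apply/val_inj; rewrite /= inordK // ltnS leq_addr.
Qed.

Lemma fps_mulI f g h : f <> 0 -> f * g = f * h -> g = h.
Proof.
move=> fN /eqP; rewrite -subr_eq0 -mulrBr => /eqP /fps_mul_eq0[//|] /eqP.
by rewrite subr_eq0 => /eqP.
Qed.

Lemma fps_neq0 f n : f n != 0 -> f <> 0.
Proof. by move=> fn f0; rewrite f0 fcoef0 eqxx in fn. Qed.

End FpsDomain.

(** * Sums over finite families of integers *)

Lemma fsum_bij (I J : choiceType) (P : set I) (Q : set J) (h : I -> J) (g : J -> I)
    (F : J -> int) (G : I -> int) :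
  (forall i, P i -> Q (h i) /\ g (h i) = i) ->
  (forall j, Q j -> P (g j) /\ h (g j) = j) ->
  (forall i, P i -> F (h i) = G i) ->
  \sum_(j \in Q) F j = \sum_(i \in P) G i.
Proof.
move=> hP gQ FG; rewrite (@reindex_fsbig _ _ _ _ _ h P).
  by apply: eq_fsbigr => i; rewrite inE => /FG.
split=> [i /hP[]//|i i' /set_mem /hP[_ ii] /set_mem /hP[_ ii'] hh|j /gQ[Pj jj]].
  by rewrite -ii -ii' hh.
by exists (g j).
Qed.

Lemma fsum_split (I : choiceType) (A B C : set I) (F : I -> int) :
  finite_set A -> (forall x, A x <-> B x \/ C x) -> (forall x, B x -> C x -> False) ->
  \sum_(i \in A) F i = \sum_(i \in B) F i + \sum_(i \in C) F i.
Proof.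
move=> finA ABC BC; have AE : A = B `|` C by apply/seteqP; split=> x /ABC.
move: finA; rewrite AE finite_setU => -[fB fC].
by apply: fsbigU0 => // x [/BC].
Qed.

Lemma eq_fsum (I : choiceType) (A B : set I) (F G : I -> int) :
  (forall x, A x <-> B x) -> (forall x, A x -> F x = G x) ->
  \sum_(i \in A) F i = \sum_(i \in B) G i.
Proof.
move=> AB FG; have -> : B = A by apply/seteqP; split=> x /AB.
by apply: eq_fsbigr => i; rewrite inE => /FG.
Qed.

Lemma fsumN (I : choiceType) (A : set I) (F : I -> int) :
  finite_set A -> \sum_(i \in A) - F i = - \sum_(i \in A) F i.
Proof. by move=> finA; rewrite !fsbig_finite // sumrN. Qed.

Lemma finite_ibox (K : nat) : finite_set [set x : int | `|x| <= K%:Z].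
Proof.
apply: (@sub_finite_set _ _ ((fun n : nat => n%:Z) @` `I_K.+1 `|` (fun n : nat => - n%:Z) @` `I_K.+1)).
  move=> x /= xK; have [x0|x0] := leP 0 x.
    by left; exists (absz x) => /=; lia.
  by right; exists (absz x) => /=; lia.
by rewrite finite_setU; split; apply: finite_image; apply: finite_II.
Qed.

(** * Binary quadratic forms of a given discriminant *)

Definition qform := (int * int * int)%type.

Definition disc (Q : qform) : int := Q.1.2 ^+ 2 - 4 * Q.1.1 * Q.2.
Definition ev (Q : qform) (p r : int) : int :=
  Q.1.1 * p ^+ 2 + Q.1.2 * p * r + Q.2 * r ^+ 2.

Definition fshift (Q : qform) : qform := (Q.1.1, Q.1.2 + 2 * Q.1.1, Q.1.1 + Q.1.2 + Q.2).
Definition funshift (Q : qform) : qform := (Q.1.1, Q.1.2 - 2 * Q.1.1, Q.1.1 - Q.1.2 + Q.2).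
Definition fswap (Q : qform) : qform := (Q.2, Q.1.2, Q.1.1).
Definition frefl (Q : qform) : qform := (Q.1.1, - Q.1.2, Q.2).
Definition fopp (Q : qform) : qform := (- Q.1.1, - Q.1.2, - Q.2).

Lemma norm_le_sqr (x : int) : `|x| <= x ^+ 2.
Proof.
rewrite -[x ^+ 2]real_normK ?num_real // expr2.
have [->|x0] := eqVneq x 0; first by rewrite normr0 mul0r.
by rewrite ler_pMr ?normr_gt0 // -gtz0_ge1 normr_gt0.
Qed.

Lemma norm_le_mulr (x y : int) : y != 0 -> `|x| <= `|x * y|.
Proof. by move=> y0; rewrite normrM ler_peMr // -gtz0_ge1 normr_gt0. Qed.

(** Completing the square bounds [2 a p + b r] and [a Q(p, r)] in terms of the
    discriminant, as [a] and [Q(p, r)] have opposite signs. *)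
Lemma finite_forms (D p r : int) : r != 0 ->
  finite_set [set Q : qform | [/\ disc Q = D, Q.1.1 < 0 & 0 < ev Q p r]].
Proof.
move=> r0; pose M := `|D| * r ^+ 2; pose K := M + 2 * M * `|p|; pose L := M + K + K ^+ 2 + `|D|.
have M0 : 0 <= M by rewrite mulr_ge0 ?normr_ge0 ?sqr_ge0.
have K0 : 0 <= K by rewrite addr_ge0 // mulr_ge0 // mulr_ge0.
have K20 : 0 <= K ^+ 2 by rewrite sqr_ge0.
have D0 : 0 <= `|D| by [].
pose box := [set x : int | `|x| <= (absz L)%:Z].
apply: (@sub_finite_set _ _ ((box `*` box) `*` box)); last first.
  by repeat apply: finite_setX; apply: finite_ibox.
move=> [[a b] c] [] /=; rewrite /disc /ev /box /= => dQ a0.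
set e := _ + _ + _ => e0.
have key : (2 * a * p + b * r) ^+ 2 = D * r ^+ 2 + 4 * (a * e) by rewrite -dQ /e; ring.
have MD : D * r ^+ 2 <= M by rewrite /M ler_wpM2r ?sqr_ge0 ?ler_norm.
have t0 := sqr_ge0 (2 * a * p + b * r).
have ae0 : a * e < 0 by rewrite nmulr_rlt0.
have aM : `|a| <= M.
  have := @norm_le_mulr a e; rewrite (gt_eqF e0) => /(_ isT); lia.
have tM : `|2 * a * p + b * r| <= M.
  by apply: le_trans (norm_le_sqr _) _; lia.
have bK : `|b| <= K.
  apply: le_trans (norm_le_mulr b r0) _.
  have -> : b * r = (2 * a * p + b * r) - 2 * a * p by ring.
  apply: le_trans (ler_normB _ _) _; rewrite /K lerD //.
  by rewrite !normrM ler_wpM2r // ler_wpM2l.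
have cL : `|c| <= K ^+ 2 + `|D|.
  have a4 : 4 * a != 0 by rewrite mulf_neq0 // (lt_eqF a0).
  apply: le_trans (norm_le_mulr c a4) _.
  have -> : c * (4 * a) = b ^+ 2 - D by rewrite -dQ; ring.
  apply: le_trans (ler_normB _ _) _; rewrite lerD2r normrX.
  by rewrite lerXn2r // nnegrE.
have [L0 aL bL cL'] : [/\ 0 <= L, `|a| <= L, `|b| <= L & `|c| <= L].
  by rewrite /L; split; lra.
by rewrite gez0_abs.
Qed.

Section Zagier.
Variables (w : qform -> int -> int) (D : int).

Hypothesis w_shift : forall Q e, disc Q = D -> w (fshift Q) e = w Q e.
Hypothesis w_swap : forall Q e, disc Q = D -> w (fswap Q) e = w Q e.
Hypothesis w_refl : forall Q e, disc Q = D -> w (frefl Q) e = w Q e.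
Hypothesis w_opp : forall Q e, disc Q = D -> w (fopp Q) (- e) = - w Q e.
Hypothesis w_0 : forall Q, w Q 0 = 0.

(** Zagier's sums: for [w Q e = e ^ (k - 1)] the value at coprime [p, r] is a
    constant multiple of [r ^ (2 k - 2)] if there are no cusp forms of weight [2 k]
    and [D] is not a square. *)
Definition zagier (p r : int) : int :=
  \sum_(Q \in [set Q : qform | [/\ disc Q = D, Q.1.1 < 0 & 0 < ev Q p r]]) w Q (ev Q p r).

(** The sum over the simple forms; as a function of [(p, r)] it is the period
    polynomial that measures the failure of [zagier] to be symmetric. *)
Definition simple_sum (p r : int) : int :=
  \sum_(Q \in [set Q : qform | [/\ disc Q = D, Q.1.1 < 0 & 0 < Q.2]]) w Q (ev Q p r).

Lemma finite_simple : finite_set [set Q : qform | [/\ disc Q = D, Q.1.1 < 0 & 0 < Q.2]].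
Proof.
apply: (sub_finite_set _ (@finite_forms D 0 1 _)) => // -[[a b] c] [/= dQ a0 c0].
by split=> //; rewrite /ev /=; lia.
Qed.

Lemma zagier01 : zagier 0 1 = simple_sum 0 1.
Proof. by apply: eq_fsum => // -[[a b] c]; rewrite /ev /=; split=> -[? ? ?]; split=> //; lia. Qed.


Lemma zagier_shift p r : zagier (p + r) r = zagier p r.
Proof.
apply/esym; apply: (@fsum_bij _ _ _ _ fshift funshift).
- move=> [[a b] c] [/= dQ a0 e0]; split; last by rewrite /funshift /fshift /=; congr (_, _, _); ring.
  by split=> //=; [rewrite -dQ /disc /=; ring | move: e0; rewrite /ev /fshift /=; congr (_ < _); ring].
- move=> [[a b] c] [/= dQ a0 e0]; split; last by rewrite /funshift /fshift /=; congr (_, _, _); ring.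
  by split=> //=; [rewrite -dQ /disc /=; ring | move: e0; rewrite /ev /funshift /=; congr (_ < _); ring].
- move=> [[a b] c] [/= dQ a0 e0]; rewrite w_shift //; congr (w _ _).
  by rewrite /ev /fshift /=; ring.
Qed.

Lemma zagier_refl p r : zagier (- p) r = zagier p r.
Proof.
apply: (@fsum_bij _ _ _ _ frefl frefl).
- move=> [[a b] c] [/= dQ a0 e0]; split; last by rewrite /frefl /= opprK.
  by split=> //=; [rewrite -dQ /disc /=; ring | move: e0; rewrite /ev /frefl /=; congr (_ < _); ring].
- move=> [[a b] c] [/= dQ a0 e0]; split; last by rewrite /frefl /= opprK.
  by split=> //=; [rewrite -dQ /disc /=; ring | move: e0; rewrite /ev /frefl /=; congr (_ < _); ring].
- move=> [[a b] c] [/= dQ a0 e0]; rewrite w_refl //; congr (w _ _).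
  by rewrite /ev /frefl /=; ring.
Qed.

Lemma zagier_swapE p r : zagier r p =
  \sum_(Q \in [set Q : qform | [/\ disc Q = D, Q.2 < 0 & 0 < ev Q p r]]) w Q (ev Q p r).
Proof.
apply: (@fsum_bij _ _ _ _ fswap fswap).
- move=> [[a b] c] [/= dQ a0 e0]; split=> //.
  by split=> //=; [rewrite -dQ /disc /=; ring | move: e0; rewrite /ev /fswap /=; congr (_ < _); ring].
- move=> [[a b] c] [/= dQ a0 e0]; split=> //.
  by split=> //=; [rewrite -dQ /disc /=; ring | move: e0; rewrite /ev /fswap /=; congr (_ < _); ring].
- move=> [[a b] c] [/= dQ a0 e0]; rewrite w_swap //; congr (w _ _).
  by rewrite /ev /fswap /=; ring.
Qed.

Lemma finite_forms_swap p r : p != 0 ->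
  finite_set [set Q : qform | [/\ disc Q = D, Q.2 < 0 & 0 < ev Q p r]].
Proof.
move=> p0; apply: (sub_finite_set _ (finite_image fswap (@finite_forms D r p p0))).
move=> [[a b] c] [/= dQ a0 e0]; exists (c, b, a) => //.
by split=> //=; [rewrite -dQ /disc /=; ring | move: e0; rewrite /ev /=; congr (_ < _); ring].
Qed.

(** Swapping the variables turns the condition [a < 0] into [c < 0].  The forms
    with both conditions cancel; of the others, those with [a < 0 < c] and
    [c < 0 < a] are exchanged by [Q -> - Q], which flips the sign of [Q(p, r)]
    and assembles them into the full sum over simple forms.  The last two sums
    are empty unless the discriminant is a square. *)
Lemma zagier_swap p r : p != 0 -> r != 0 ->
  zagier p r - zagier r p = simple_sum p r
   + \sum_(Q \in [set Q : qform | [/\ disc Q = D, Q.1.1 < 0, Q.2 = 0 & 0 < ev Q p r]]) w Q (ev Q p r)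
   - \sum_(Q \in [set Q : qform | [/\ disc Q = D, Q.2 < 0, Q.1.1 = 0 & 0 < ev Q p r]]) w Q (ev Q p r).
Proof.
move=> p0 r0; rewrite (zagier_swapE p r).
pose A1 := [set Q : qform | [/\ disc Q = D, Q.1.1 < 0 & 0 < ev Q p r]].
pose A2 := [set Q : qform | [/\ disc Q = D, Q.2 < 0 & 0 < ev Q p r]].
have fA1 : finite_set A1 by apply: finite_forms.
have fA2 : finite_set A2 by apply: finite_forms_swap.
rewrite /zagier -/A1 -/A2.
pose B := [set Q : qform | [/\ disc Q = D, Q.1.1 < 0, Q.2 < 0 & 0 < ev Q p r]].
pose C1 := [set Q : qform | [/\ disc Q = D, Q.1.1 < 0, Q.2 = 0 & 0 < ev Q p r]].
pose C2 := [set Q : qform | [/\ disc Q = D, Q.2 < 0, Q.1.1 = 0 & 0 < ev Q p r]].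
pose E1 := [set Q : qform | [/\ disc Q = D, Q.1.1 < 0, 0 < Q.2 & 0 < ev Q p r]].
pose E2 := [set Q : qform | [/\ disc Q = D, Q.2 < 0, 0 < Q.1.1 & 0 < ev Q p r]].
pose G1 := [set Q : qform | [/\ disc Q = D, Q.1.1 < 0, 0 < Q.2 & ev Q p r < 0]].
rewrite (@fsum_split _ A1 B (C1 `|` E1)) //; last first.
- by move=> [[a b] c] [/= _ _ ? _] [] [/= _ _ ?]; lia.
- move=> [[a b] c]; split=> [[/= ? ? ?]|[[/= ? ? ? ?]|[] [/= ? ? ? ?]]] //.
  by have [?|?|?] := ltgtP c 0; [left | right; right | right; left].
rewrite (@fsum_split _ (C1 `|` E1) C1 E1) //; last first.
- by move=> [[a b] c] [/= _ _ ? _] [/= _ _ ?]; lia.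
- by apply: sub_finite_set fA1 => -[[a b] c] [] [/= ? ? ? ?].
rewrite (@fsum_split _ A2 B (C2 `|` E2)) //; last first.
- by move=> [[a b] c] [/= _ ? _ _] [] [/= _ _ ?]; lia.
- move=> [[a b] c]; split=> [[/= ? ? ?]|[[/= ? ? ? ?]|[] [/= ? ? ? ?]]] //.
  by have [?|?|?] := ltgtP a 0; [left | right; right | right; left].
rewrite (@fsum_split _ (C2 `|` E2) C2 E2) //; last first.
- by move=> [[a b] c] [/= _ _ ? _] [/= _ _ ?]; lia.
- by apply: sub_finite_set fA2 => -[[a b] c] [] [/= ? ? ? ?].
have -> : \sum_(Q \in E2) w Q (ev Q p r) = - \sum_(Q \in G1) w Q (ev Q p r).
  rewrite -fsumN; last first.
    by apply: sub_finite_set finite_simple => -[[a b] c] [/= ? ? ? ?].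
  apply: (@fsum_bij _ _ _ _ fopp fopp).
  - move=> [[a b] c] [/= dQ a0 c0 e0]; split; last by rewrite /fopp /= !opprK.
    split=> /=; rewrite ?oppr_lt0 ?oppr_gt0 //; first by rewrite -dQ /disc /=; ring.
    by rewrite -oppr_lt0; move: e0; rewrite /ev /=; congr (_ < _); ring.
  - move=> [[a b] c] [/= dQ a0 c0 e0]; split; last by rewrite /fopp /= !opprK.
    split=> /=; rewrite ?oppr_lt0 ?oppr_gt0 //; first by rewrite -dQ /disc /=; ring.
    by rewrite -oppr_gt0; move: e0; rewrite /ev /=; congr (_ < _); ring.
  - move=> [[a b] c] [/= dQ a0 c0 e0]; rewrite -w_opp //; congr (w _ _).
    by rewrite /ev /fopp /=; ring.
pose Z := [set Q : qform | [/\ disc Q = D, Q.1.1 < 0, 0 < Q.2 & ev Q p r = 0]].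
rewrite /simple_sum (@fsum_split _ _ E1 (G1 `|` Z) _ finite_simple); first last.
- by move=> [[a b] c] [/= _ _ _ ?] [] [/= _ _ _ ?]; lia.
- move=> [[a b] c]; split=> [[/= ? ? ?]|[[/= ? ? ? ?]|[] [/= ? ? ? ?]]] //.
  by have [?|?|?] := ltgtP (ev (a, b, c) p r) 0; [right; left | left | right; right].
rewrite (@fsum_split _ (G1 `|` Z) G1 Z) //; first last.
- by move=> [[a b] c] [/= _ _ _ ?] [/= _ _ _ ?]; lia.
- by apply: sub_finite_set finite_simple => -[[a b] c] [] [/= ? ? ? ?].
have -> : \sum_(Q \in Z) w Q (ev Q p r) = 0.
  by apply: fsbig1 => -[[a b] c] [_ _ _ ->].
ring.
Qed.

End Zagier.

(** * Roots of quadratic polynomials modulo an odd prime *)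

Section RootCount.
Variables (l : nat) (l_prime : prime l) (l_odd : odd l).
Notation F := 'F_l.

Lemma dvdz_Fp (x : int) : (l %| x)%Z = (x%:~R == 0 :> F).
Proof. exact: dvdz_pcharf (pchar_Fp l_prime) x. Qed.

Lemma sum_Fp (G : F -> int) : \sum_(j < l) G (j : nat)%:R = \sum_(x : F) G x.
Proof.
rewrite -(big_mkord xpredT (fun j : nat => G j%:R)) -{1}(Fp_cast l_prime) big_mkord.
by apply: eq_bigr => i _; rewrite natr_Zp.
Qed.

Lemma two_neq0_Fp : 2 != 0 :> F.
Proof.
rewrite -[2]/(2%:R) -(dvdn_pcharf (pchar_Fp l_prime)) dvdn_prime2 //.
by apply: contraL l_odd => /eqP ->.
Qed.

Lemma legendre_Fp (D : int) : ~~ (l %| D)%Z ->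
  legendre D l = if [exists x : F, x ^+ 2 == D%:~R] then 1 else -1.
Proof.
move=> lD; rewrite /legendre (negPf lD); congr (if _ then _ else _).
have E (x : nat) : ((x%:Z ^+ 2 == D %[mod l])%Z) = ((x%:R : F) ^+ 2 == D%:~R).
  by rewrite eqz_mod_dvd dvdz_Fp rmorphB rmorphXn /= subr_eq0.
apply/existsP/existsP => -[x].
  by rewrite E => ?; exists (x : nat)%:R.
move=> xD; have xl : (x < l)%N by rewrite -[X in (_ < X)%N](Fp_cast l_prime) ltn_ord.
by exists (Ordinal xl); rewrite E /= natr_Zp.
Qed.

Lemma sum1_pred1 (x0 : F) : \sum_(x : F) (x == x0)%:Z = 1.
Proof. by rewrite (bigD1 x0) //= eqxx big1 ?addr0 // => x /negPf ->. Qed.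

Lemma count_sqrt (D : int) : ~~ (l %| D)%Z ->
  \sum_(x : F) (x ^+ 2 == D%:~R)%:Z = 1 + legendre D l.
Proof.
move=> lD; rewrite legendre_Fp //; case: ifP => [/existsP[y /eqP yD]|/negbT].
  have yN0 : y != 0.
    by apply: contraNneq lD => y0; rewrite dvdz_Fp -yD y0 expr0n.
  have yy : y != - y.
    by rewrite -subr_eq0 opprK -mulr2n -mulr_natl mulf_neq0 ?two_neq0_Fp.
  rewrite -{1}(sum1_pred1 y) -(sum1_pred1 (- y)) -big_split /=.
  apply: eq_bigr => x _; rewrite -yD eqf_sqr.
  have [->|_] := eqVneq x y; first by rewrite (negPf yy).
  by case: (x == - y).
rewrite negb_exists => /forallP H; rewrite big1 // => x _.
by rewrite (negPf (H x)).
Qed.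

Lemma count_linear (A B : F) : A != 0 -> \sum_(x : F) (A * x + B == 0)%:Z = 1.
Proof.
move=> A0; rewrite -(sum1_pred1 (- B / A)); apply: eq_bigr => x _; congr (_%:Z).
by rewrite addr_eq0 -[in RHS](inj_eq (mulfI A0)) mulrCA divff // mulr1.
Qed.

(** The zeros on the projective line over ['F_l] of the binary form with
    coefficients [A, B, C]; the summand [l %| A] stands for the point at infinity. *)
Lemma count_root (A B C : int) : ~~ (l %| B ^+ 2 - 4 * A * C)%Z ->
  \sum_(j < l) (l %| C + j%:Z * B + j%:Z ^+ 2 * A)%Z%:Z + (l %| A)%Z%:Z
  = 1 + legendre (B ^+ 2 - 4 * A * C) l.
Proof.
move=> lD; pose a : F := A%:~R; pose b : F := B%:~R; pose c : F := C%:~R.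
have -> : \sum_(j < l) (l %| C + j%:Z * B + j%:Z ^+ 2 * A)%Z%:Z =
          \sum_(x : F) (c + x * b + x ^+ 2 * a == 0)%:Z.
  rewrite -sum_Fp; apply: eq_bigr => j _; rewrite dvdz_Fp.
  by rewrite !(rmorphD, rmorphM, rmorphXn) /=.
have DE : (B ^+ 2 - 4 * A * C)%:~R = b ^+ 2 - 4 * a * c :> F.
  by rewrite !(rmorphB, rmorphM, rmorphXn) /=.
rewrite [(l %| A)%Z]dvdz_Fp -/a; have [a0|aN0] := eqVneq a 0.
  have bN0 : b != 0.
    by apply: contraNneq lD => b0; rewrite dvdz_Fp DE a0 b0; apply/eqP; ring.
  have -> : legendre (B ^+ 2 - 4 * A * C) l = 1.
    rewrite legendre_Fp // ifT //; apply/existsP; exists b.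
    by rewrite DE a0; apply/eqP; ring.
  congr (_ + _); rewrite -[RHS](count_linear c bN0); apply: eq_bigr => x _.
  by rewrite a0; congr ((_ == _)%:Z); ring.
rewrite addr0 -count_sqrt // DE.
have aa : 2 * a != 0 by rewrite mulf_neq0 ?two_neq0_Fp.
have bij : bijective (fun x => 2 * a * x + b).
  exists (fun y => (y - b) / (2 * a)) => x; first by rewrite addrK mulrC mulKf.
  by rewrite mulrC divfK // subrK.
rewrite [RHS](reindex _ (onW_bij _ bij)) /=; apply: eq_bigr => x _; congr ((nat_of_bool _)%:Z).
have a4 : 4 * a != 0.
  by rewrite (_ : 4 = 2 * 2) ?mulf_neq0 ?two_neq0_Fp //; ring.
by rewrite -(inj_eq (mulfI a4)) mulr0 -[RHS]subr_eq0; congr (_ == _); ring.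
Qed.

End RootCount.

(** * The Hecke relation for the sums over simple forms *)

Section Hecke.
Variables (w : qform -> int -> int) (D : int) (l : nat) (kap : int).
Hypotheses (l_prime : prime l) (l_odd : odd l) (lD : ~~ (l %| D)%Z).

(** Together with [fsub_inf], the restrictions of [Q] to the [l + 1] sublattices
    of index [l]. *)
Definition fsub (j : int) (Q : qform) : qform :=
  (Q.1.1, l%:Z * Q.1.2 - 2 * j * Q.1.1,
   Q.1.1 * j ^+ 2 - l%:Z * j * Q.1.2 + l%:Z ^+ 2 * Q.2).
Definition fsub_inf (Q : qform) : qform := (l%:Z ^+ 2 * Q.1.1, l%:Z * Q.1.2, Q.2).
Definition fmul (Q : qform) : qform := (l%:Z * Q.1.1, l%:Z * Q.1.2, l%:Z * Q.2).

Hypothesis w_sub : forall j Q e, disc Q = D -> w (fsub j Q) e = w Q e.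
Hypothesis w_inf : forall Q e, disc Q = D -> w (fsub_inf Q) e = w Q e.
Hypothesis w_mul : forall Q e, disc Q = D -> w (fmul Q) (l%:Z * e) = kap * w Q e.

Let G := [set Q : qform | [/\ disc Q = l%:Z ^+ 2 * D, Q.1.1 < 0 & 0 < Q.2]].
Let cond (j : int) (Q : qform) : bool :=
  (l %| Q.1.2 + 2 * j * Q.1.1)%Z && ((l%:Z ^+ 2)%R %| Q.2 + j * Q.1.2 + j ^+ 2 * Q.1.1)%Z.
Let cond_inf (Q : qform) : bool := ((l%:Z ^+ 2)%R %| Q.1.1)%Z && (l %| Q.1.2)%Z.
Let cond_mul (Q : qform) : bool := [&& l %| Q.1.1, l %| Q.1.2 & l %| Q.2]%Z.

Let finG : finite_set G := finite_simple (l%:Z ^+ 2 * D).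

Let l0 : l%:Z != 0. Proof. by have := prime_gt0 l_prime; lia. Qed.
Let l20 : l%:Z ^+ 2 != 0. Proof. by rewrite expf_neq0. Qed.
Let lgt0 : 0 < l%:Z. Proof. by have := prime_gt0 l_prime; lia. Qed.
Let l2gt0 : 0 < l%:Z ^+ 2. Proof. by rewrite exprn_gt0. Qed.

Lemma hecke_sub (j : int) :
  zagier w D (- j) l = \sum_(Q \in G `&` [set Q | cond j Q]) w Q (ev Q 0 1).
Proof.
apply/esym; apply: (@fsum_bij _ _ _ _ (fsub j) (fun Q => (Q.1.1, (Q.1.2 + 2 * j * Q.1.1) %/ l,
    (Q.2 + j * Q.1.2 + j ^+ 2 * Q.1.1) %/ (l%:Z ^+ 2)%R)%Z)).
- move=> [[a b] c] [/= dQ a0 e0]; split; last first.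
    rewrite /fsub /=; congr (_, _, _).
      by rewrite [X in (X %/ _)%Z](_ : _ = b * l%:Z) ?mulzK //; ring.
    by rewrite [X in (X %/ _)%Z](_ : _ = c * l%:Z ^+ 2) ?mulzK //; ring.
  split; first split=> //=.
  + by rewrite -dQ /disc /=; ring.
  + by move: e0; rewrite /ev /=; congr (_ < _); ring.
  rewrite /cond /=; apply/andP; split; apply/dvdzP.
    by exists b; ring.
  by exists c; ring.
- move=> [[a b] c] [[/= dQ a0 c0] /andP[/= /dvdzP[B bE] /dvdzP[C cE]]].
  rewrite bE cE !mulzK //.
  have bE' : b = B * l%:Z - 2 * j * a by rewrite -bE; ring.
  have cE' : c = C * l%:Z ^+ 2 - j * b - j ^+ 2 * a by rewrite -cE; ring.
  split; last first.
    by rewrite /fsub /=; congr (_, _, _); rewrite ?cE' bE'; ring.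
  split=> //=.
    by apply: (mulfI l20); rewrite -dQ /disc /= cE' bE'; ring.
  by move: c0; rewrite cE' bE' /ev /=; congr (_ < _); ring.
- move=> [[a b] c] [/= dQ a0 e0]; rewrite w_sub //; congr (w _ _).
  by rewrite /ev /fsub /=; ring.
Qed.

Lemma hecke_inf :
  simple_sum w D 0 1 = \sum_(Q \in G `&` [set Q | cond_inf Q]) w Q (ev Q 0 1).
Proof.
apply/esym; apply: (@fsum_bij _ _ _ _ fsub_inf (fun Q => (Q.1.1 %/ (l%:Z ^+ 2)%R, Q.1.2 %/ l, Q.2)%Z)).
- move=> [[a b] c] [/= dQ a0 c0]; split; last first.
    by rewrite /fsub_inf /=; congr (_, _, _); rewrite mulrC mulzK.
  split; first split=> //=.
  + by rewrite -dQ /disc /=; ring.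
  + by rewrite pmulr_rlt0.
  by apply/andP; split; apply: dvdz_mulr (dvdzz _).
- move=> [[a b] c] [[/= dQ a0 c0] /andP[/= /dvdzP[A aE] /dvdzP[B bE]]].
  subst a b; rewrite !mulzK //; split; last first.
    by rewrite /fsub_inf /=; congr (_, _, _); rewrite mulrC.
  split=> //=; last by rewrite -(pmulr_llt0 _ l2gt0).
  by apply: (mulfI l20); rewrite -dQ /disc /=; ring.
- move=> [[a b] c] [/= dQ a0 e0]; rewrite w_inf //; congr (w _ _).
  by rewrite /ev /fsub_inf /=; ring.
Qed.

Lemma hecke_mul :
  kap * simple_sum w D 0 1 = \sum_(Q \in G `&` [set Q | cond_mul Q]) w Q (ev Q 0 1).
Proof.
rewrite /simple_sum mulr_fsumr; apply/esym.
apply: (@fsum_bij _ _ _ _ fmul (fun Q => (Q.1.1 %/ l, Q.1.2 %/ l, Q.2 %/ l)%Z)).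
- move=> [[a b] c] [/= dQ a0 c0]; split; last first.
    by rewrite /fmul /=; congr (_, _, _); rewrite mulrC mulzK.
  split; first split=> //=.
  + by rewrite -dQ /disc /=; ring.
  + by rewrite pmulr_rlt0.
  + by rewrite pmulr_rgt0.
  by apply/and3P; split; apply: dvdz_mulr (dvdzz _).
- move=> [[a b] c] [[/= dQ a0 c0] /and3P[/= /dvdzP[A aE] /dvdzP[B bE] /dvdzP[C cE]]].
  subst a b c; rewrite !mulzK //; split; last first.
    by rewrite /fmul /=; congr (_, _, _); rewrite mulrC.
  split=> //=; last by rewrite -(pmulr_lgt0 _ lgt0).
    by apply: (mulfI l20); rewrite -dQ /disc /=; ring.
  by rewrite -(pmulr_llt0 _ lgt0).
- move=> [[a b] c] [/= dQ a0 e0]; rewrite -w_mul //; congr (w _ _).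
  by rewrite /ev /fmul /=; ring.
Qed.

(** A form of discriminant [l ^ 2 * D] extends to exactly one superlattice of
    index [l], unless it is divisible by [l]: then the extensions correspond to
    the zeros of the quotient on the projective line over ['F_l]. *)
Lemma hecke_count Q : G Q ->
  \sum_(j < l) (cond j Q)%:Z + (cond_inf Q)%:Z = 1 + legendre D l * (cond_mul Q)%:Z.
Proof.
case: Q => [[a b] c] [/= dQ _ _]; rewrite /cond /cond_inf /cond_mul /=.
rewrite /disc /= in dQ.
have l2 x : ((l%:Z ^+ 2)%R %| x)%Z -> (l %| x)%Z.
  by apply: dvdz_trans; rewrite expr2 dvdz_mulr.
have dv x : (l %| x)%Z -> ((l%:Z ^+ 2)%R %| x ^+ 2 - l%:Z ^+ 2 * D)%Z.
  by move=> lx; apply: rpredB; [apply: dvdz_exp2r | apply: dvdz_mulr].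
have cop4 : coprimez (l%:Z ^+ 2)%R 4.
  rewrite coprimezE abszX coprimeXl // -[absz 4]/(2 ^ 2)%N coprimeXr //.
  by rewrite coprime_sym prime_coprime // dvdn2 l_odd.
(* a single finite point, the zero of [2 a X + b] *)
have [la|la] := boolP (l %| a)%Z; last first.
  have -> : ((l%:Z ^+ 2)%R %| a)%Z = false by apply: contraNF la => /l2.
  rewrite /= mulr0 !addr0.
  pose A : 'F_l := a%:~R; pose B : 'F_l := b%:~R.
  have A2 : 2 * A != 0 by rewrite mulf_neq0 ?two_neq0_Fp // -dvdz_Fp.
  rewrite -[RHS](count_linear B A2) -sum_Fp //; apply: eq_bigr => j _; congr (_%:Z).
  have -> : (2 * A * (j : nat)%:R + B == 0) = (l %| b + 2 * j%:Z * a)%Z.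
    rewrite dvdz_Fp // !(rmorphD, rmorphM) /=; congr (_ == _); rewrite /A /B.
    by rewrite -[(j%:Z)%:~R]/(j%:R); ring.
  have [lb|] //= := boolP (l %| b + 2 * j%:Z * a)%Z.
  have cop : coprimez (l%:Z ^+ 2)%R (4 * a).
    rewrite coprimezMr cop4 /= coprimezE abszX coprimeXl //.
    by rewrite prime_coprime // -dvdzE.
  rewrite -(Gauss_dvdzr _ cop).
  have -> : 4 * a * (c + j%:Z * b + j%:Z ^+ 2 * a) = (b + 2 * j%:Z * a) ^+ 2 - l%:Z ^+ 2 * D.
    by rewrite -dQ; ring.
  by rewrite dv.
have lb : (l %| b)%Z.
  have : (l %| b ^+ 2)%Z.
    have -> : b ^+ 2 = l%:Z ^+ 2 * D + 4 * a * c by rewrite -dQ; ring.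
    by apply: rpredD; apply: dvdz_mulr; [apply: l2; apply: dvdzz | apply: dvdz_mull].
  by rewrite !dvdzE abszX Euclid_dvdX // => /andP[].
have l2ac : ((l%:Z ^+ 2)%R %| a * c)%Z.
  rewrite -(Gauss_dvdzr _ cop4).
  have -> : 4 * (a * c) = b ^+ 2 - l%:Z ^+ 2 * D by rewrite -dQ; ring.
  by rewrite dv.
(* only the point at infinity *)
have [lc|lc] := boolP (l %| c)%Z; last first.
  have cop : coprimez (l%:Z ^+ 2)%R c.
    by rewrite coprimezE abszX coprimeXl // prime_coprime // -dvdzE.
  have -> : ((l%:Z ^+ 2)%R %| a)%Z by rewrite -(Gauss_dvdzl _ cop).
  rewrite lb /= mulr0 addr0 big1 ?add0r // => j _.
  suff -> : ((l%:Z ^+ 2)%R %| c + j%:Z * b + j%:Z ^+ 2 * a)%Z = false by rewrite andbF.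
  apply: contraNF lc => /l2.
  by rewrite -addrA rpredDr // rpredD ?dvdz_mull.
(* [l] divides the form: all the zeros of its quotient by [l] *)
rewrite lb /= mulr1.
case/dvdzP: la dQ l2ac => A ->; case/dvdzP: lb => B ->; case/dvdzP: lc => C ->.
move=> dQ _; have dE : B ^+ 2 - 4 * A * C = D by apply: (mulfI l20); rewrite -dQ; ring.
rewrite -dE -count_root ?dE //; congr (_ + _).
  apply: eq_bigr => j _; congr (_%:Z).
  have -> : (l %| B * l + 2 * j%:Z * (A * l))%Z by rewrite rpredD ?dvdz_mull.
  rewrite /= expr2.
  rewrite (_ : _ + _ = l%:Z * (C + j%:Z * B + j%:Z ^+ 2 * A)); last by ring.
  by rewrite dvdz_mul2l.
by rewrite expr2 dvdz_mul2r // andbT.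
Qed.

(** A simple form of discriminant [l ^ 2 D] is counted on the left once, and
    again [chi(l)] times if it is [l] times a form; on the right it is counted
    once for each lattice of index [l] to which it extends. *)
Lemma hecke_simple :
  simple_sum w (l%:Z ^+ 2 * D) 0 1 + legendre D l * kap * simple_sum w D 0 1
  = \sum_(j < l) zagier w D (- j%:Z) l + simple_sum w D 0 1.
Proof.
rewrite -mulrA hecke_mul [in RHS]hecke_inf.
under [in RHS]eq_bigr do rewrite hecke_sub.
have E (P : qform -> bool) : \sum_(Q \in G `&` [set Q | P Q]) w Q (ev Q 0 1)
    = \sum_(Q <- fset_set G) (P Q)%:Z * w Q (ev Q 0 1).
  rewrite fsbig_mkcondr fsbig_finite //; apply: eq_bigr => Q _.
  have -> : (Q \in [set Q | P Q]) = P Q by apply/idP/idP; rewrite inE.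
  by case: (P Q); rewrite ?mul1r ?mul0r.
rewrite !E; under [in RHS]eq_bigr do rewrite E.
rewrite exchange_big /= /simple_sum fsbig_finite // mulr_sumr -!big_split /=.
apply: eq_big_seq => Q; rewrite in_fset_set // inE => GQ.
rewrite -mulr_suml -mulrDl hecke_count //; ring.
Qed.

End Hecke.

(** * Evaluation of the sums by the Euclidean algorithm *)

(** The pairs of coprime numbers are generated from [(0, 1)] by the steps of the
    Euclidean algorithm. *)
Lemma euclid_ind (T : nat -> nat -> Prop) :
  T 0%N 1%N -> (forall p r, (0 < r)%N -> T p r -> T (p + r)%N r) ->
  (forall p r, (0 < p)%N -> (0 < r)%N -> coprime p r -> T p r -> T r p) ->
  forall p r, (0 < r)%N -> coprime p r -> T p r.
Proof.
move=> T01 Tsh Tsw p r; have [N] := ubnP (p + r)%N.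
elim: N => // N IHN in p r * => pr r0 cop.
have step p' r' : (p' + r' < N)%N -> (0 < r')%N -> coprime p' r' -> T (p' + r')%N r'.
  by move=> *; apply: Tsh => //; apply: IHN => //; lia.
have [rp|pr'] := leqP r p.
  rewrite -(subnK rp); apply: step; rewrite ?subnK //; first by lia.
  by rewrite coprime_sym /coprime -gcdnDr subnK // gcdnC.
have [p0|p0] := posnP p.
  by move: cop; rewrite p0 /coprime gcd0n => /eqP ->.
apply: Tsw => //; first by rewrite coprime_sym.
rewrite -(subnK (ltnW pr')); apply: step; rewrite ?subnK ?(ltnW pr') //; first by lia.
by rewrite coprime_sym /coprime -gcdnDr subnK // ltnW.
Qed.

Section Square.
Variable D : int.
Hypothesis nonsq : forall x : int, x ^+ 2 != D.

Lemma zagier_swap_nonsq (w : qform -> int -> int) :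
  (forall Q e, disc Q = D -> w (fswap Q) e = w Q e) ->
  (forall Q e, disc Q = D -> w (fopp Q) (- e) = - w Q e) ->
  (forall Q, w Q 0 = 0) ->
  forall p r, p != 0 -> r != 0 -> zagier w D p r = zagier w D r p + simple_sum w D p r.
Proof.
move=> w1 w2 w3 p r p0 r0.
have := @zagier_swap w D w1 w2 w3 p r p0 r0.
rewrite [X in _ + X - _]fsbig1 => [|[[a b] c]]; last first.
  by case=> /= + _ c0; rewrite /disc /= c0 mulr0 subr0 => /eqP; rewrite (negPf (nonsq b)).
rewrite [X in _ + _ - X]fsbig1 => [|[[a b] c]]; last first.
  by case=> /= + _ c0; rewrite /disc /= c0 mulr0 mul0r subr0 => /eqP; rewrite (negPf (nonsq b)).
by rewrite addr0 subr0 => <-; ring.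
Qed.

End Square.

Lemma zagier0l (w : qform -> int -> int) (D : int) (l : nat) : (0 < l)%N ->
  zagier w D 0 l = \sum_(Q \in [set Q : qform | [/\ disc Q = D, Q.1.1 < 0 & 0 < Q.2]])
    w Q (l%:Z ^+ 2 * Q.2).
Proof.
move=> l0; have evE Q : ev Q 0 l = l%:Z ^+ 2 * Q.2 by rewrite /ev /=; ring.
by apply: eq_fsum => Q; rewrite ?evE //= evE pmulr_rgt0 // exprn_gt0.
Qed.

Section Moments.
Variable D : int.
Let S := [set Q : qform | [/\ disc Q = D, Q.1.1 < 0 & 0 < Q.2]].
Implicit Types F G : qform -> int.

(** An involution of the simple forms; together with [frefl] it relates the
    coefficients of the polynomial [simple_sum]. *)
Definition fdual (Q : qform) : qform := (- Q.2, Q.1.2, - Q.1.1).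

Lemma simple_refl F : \sum_(Q \in S) F (frefl Q) = \sum_(Q \in S) F Q.
Proof.
apply/esym; apply: (@fsum_bij _ _ _ _ frefl frefl) => // -[[a b] c] [/= dQ a0 c0];
  (split; last by rewrite /frefl /= opprK); by split=> //; rewrite -dQ /disc /=; ring.
Qed.

Lemma simple_dual F : \sum_(Q \in S) F (fdual Q) = \sum_(Q \in S) F Q.
Proof.
apply/esym; apply: (@fsum_bij _ _ _ _ fdual fdual) => // -[[a b] c] [/= dQ a0 c0];
  (split; last by rewrite /fdual /= !opprK);
  by split=> /=; rewrite ?oppr_lt0 ?oppr_gt0 // -dQ /disc /=; ring.
Qed.

Lemma simple_lin c1 c2 c3 c4 (F1 F2 F3 F4 F5 : qform -> int) :
  \sum_(Q \in S) (c1 * F1 Q + (c2 * F2 Q + (c3 * F3 Q + (c4 * F4 Q + F5 Q)))) =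
  c1 * (\sum_(Q \in S) F1 Q) + (c2 * (\sum_(Q \in S) F2 Q) + (c3 * (\sum_(Q \in S) F3 Q) +
  (c4 * (\sum_(Q \in S) F4 Q) + \sum_(Q \in S) F5 Q))).
Proof.
have finS : finite_set S by exact: finite_simple.
by rewrite !fsbig_finite // !big_split /= -!mulr_sumr.
Qed.

Lemma simple_odd F : (forall Q, F (frefl Q) = - F Q) -> \sum_(Q \in S) F Q = 0.
Proof.
move=> FN; have := simple_refl F; under eq_fsbigr do rewrite FN.
by rewrite fsumN; [lia | exact: finite_simple].
Qed.

Lemma simple_antidual F G : (forall Q, F (fdual Q) = - G Q) ->
  \sum_(Q \in S) F Q = - \sum_(Q \in S) G Q.
Proof.
move=> FN; rewrite -simple_dual; under eq_fsbigr do rewrite FN.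
by rewrite fsumN //; exact: finite_simple.
Qed.

End Moments.

(** ** Sums of cubes of values *)

Definition w4 (Q : qform) (e : int) : int := e ^+ 3.
Definition B4 (D : int) : int := simple_sum w4 D 0 1.

Section Weight4.
Variable D : int.
Hypothesis nonsq : forall x : int, x ^+ 2 != D.

Let S := [set Q : qform | [/\ disc Q = D, Q.1.1 < 0 & 0 < Q.2]].
Let E := \sum_(Q \in S) 3 * (Q.1.1 * Q.2 ^+ 2 + Q.1.2 ^+ 2 * Q.2).

(** A polynomial of degree 6, even by the symmetry [frefl] and antisymmetric
    under [p <-> r] by the symmetry [fdual]: this leaves two coefficients. *)
Lemma simple_w4 p r : simple_sum w4 D p r =
  B4 D * (r ^+ 6 - p ^+ 6) + E * (p ^+ 2 * r ^+ 4 - p ^+ 4 * r ^+ 2).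
Proof.
have B4E : B4 D = \sum_(Q \in S) Q.2 ^+ 3.
  by apply: eq_fsum => // -[[a b] c] _; rewrite /w4 /ev /=; congr (_ ^+ _); ring.
have A4E : \sum_(Q \in S) Q.1.1 ^+ 3 = - B4 D.
  by rewrite B4E; apply: simple_antidual => -[[a b] c] /=; ring.
have E' : \sum_(Q \in S) 3 * (Q.1.1 ^+ 2 * Q.2 + Q.1.1 * Q.1.2 ^+ 2) = - E.
  by apply: simple_antidual => -[[a b] c] /=; ring.
pose O Q := 3 * Q.1.1 ^+ 2 * Q.1.2 * p ^+ 5 * r
  + (6 * Q.1.1 * Q.1.2 * Q.2 + Q.1.2 ^+ 3) * p ^+ 3 * r ^+ 3
  + 3 * Q.1.2 * Q.2 ^+ 2 * p * r ^+ 5 : int.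
have O0 : \sum_(Q \in S) O Q = 0.
  by apply: simple_odd => -[[a b] c]; rewrite /O /=; ring.
have -> : simple_sum w4 D p r = \sum_(Q \in S) (p ^+ 6 * Q.1.1 ^+ 3 + (r ^+ 6 * Q.2 ^+ 3 +
   (p ^+ 4 * r ^+ 2 * (3 * (Q.1.1 ^+ 2 * Q.2 + Q.1.1 * Q.1.2 ^+ 2)) +
   (p ^+ 2 * r ^+ 4 * (3 * (Q.1.1 * Q.2 ^+ 2 + Q.1.2 ^+ 2 * Q.2)) + O Q)))).
  by apply: eq_fsum => // -[[a b] c] _; rewrite /w4 /ev /O /=; ring.
rewrite simple_lin O0 E' A4E -B4E -/E; ring.
Qed.

Let swap p r : p != 0 -> r != 0 -> zagier w4 D p r = zagier w4 D r p + simple_sum w4 D p r.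
Proof.
by apply: zagier_swap_nonsq => // Q e _; rewrite /w4; ring.
Qed.

Let shift p r : zagier w4 D (p + r) r = zagier w4 D p r.
Proof. exact: zagier_shift. Qed.

Let refl p r : zagier w4 D (- p) r = zagier w4 D p r.
Proof. exact: zagier_refl. Qed.

(** The value at [2 / 3] is reached both from [3 / 2] by a swap and from [- 1 / 3]
    by a shift; the comparison forces the middle coefficient to vanish.  This is
    the absence of cusp forms of weight 8. *)
Let E0 : E = 0.
Proof.
have f01 : zagier w4 D 0 1 = B4 D by exact: zagier01.
have f11 := shift 0 1; have f21 := shift 1 1; have f31 := shift 2 1.
have f12 := swap (p := 1) (r := 2) isT isT; have f13 := swap (p := 1) (r := 3) isT isT.
have f32 := shift 1 2; have f23 := swap (p := 2) (r := 3) isT isT.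
have f23' := shift (-1) 3; rewrite refl in f23'.
rewrite !simple_w4 in f12 f13 f23.
rewrite (_ : 0 + 1 = 1) // in f11; rewrite (_ : 1 + 1 = 2) // in f21.
rewrite (_ : 2 + 1 = 3) // in f31; rewrite (_ : 1 + 2 = 3) // in f32.
rewrite (_ : -1 + 3 = 2) // in f23'.
lra.
Qed.

Lemma zagier_w4 (p r : nat) : (0 < r)%N -> coprime p r ->
  zagier w4 D p r = B4 D * r%:Z ^+ 6.
Proof.
move: p r; apply: euclid_ind => [|p r r0|p r p0 r0 _].
- by rewrite zagier01 expr1n mulr1.
- by rewrite PoszD shift.
- move=> f; rewrite swap ?simple_w4 ?f ?E0; [ring | lia | lia].
Qed.

End Weight4.

(** All the [l + 1] terms of the Hecke relation are now known: each of [l] points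
    contributes [l ^ 6], and the point at infinity contributes [1]. *)
Lemma hecke_w4 (D : int) (l : nat) : prime l -> odd l -> ~~ (l %| D)%Z ->
  (forall x : int, x ^+ 2 != D) ->
  B4 (l%:Z ^+ 2 * D) + legendre D l * l%:Z ^+ 3 * B4 D = (1 + l%:Z ^+ 7) * B4 D.
Proof.
move=> l_prime l_odd lD nonsq; rewrite /B4 (@hecke_simple w4 D l (l%:Z ^+ 3)) //; last first.
  by move=> Q e _; rewrite /w4; ring.
have l0 := prime_gt0 l_prime.
have E (j : 'I_l) : zagier w4 D (- (j : nat)%:Z) l = B4 D * l%:Z ^+ 6.
  rewrite zagier_refl //; have [->|j0] := posnP (j : nat).
    rewrite [LHS]zagier0l // /B4 /simple_sum mulrC mulr_fsumr; apply: eq_fsum => // -[[a b] c] _.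
    by rewrite /w4 /ev /=; ring.
  apply: zagier_w4 => //; rewrite coprime_sym prime_coprime //.
  by rewrite gtnNdvd.
rewrite (eq_bigr _ (fun j _ => E j)) sumr_const card_ord -mulr_natl natz /B4; ring.
Qed.

(** ** Sums of values *)

Definition w2 (Q : qform) (e : int) : int := e.
Definition B2 (D : int) : int := simple_sum w2 D 0 1.

Lemma simple_w2 D p r : simple_sum w2 D p r = B2 D * (r ^+ 2 - p ^+ 2).
Proof.
pose S := [set Q : qform | [/\ disc Q = D, Q.1.1 < 0 & 0 < Q.2]].
have B2E : B2 D = \sum_(Q \in S) Q.2.
  by apply: eq_fsum => // -[[a b] c] _; rewrite /w2 /ev /=; ring.
have A2E : \sum_(Q \in S) Q.1.1 = - B2 D.
  by rewrite B2E; apply: simple_antidual => -[[a b] c].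
have b0 : \sum_(Q \in S) Q.1.2 = 0 by apply: simple_odd => -[[a b] c].
have -> : simple_sum w2 D p r = \sum_(Q \in S) (p ^+ 2 * Q.1.1 + (r ^+ 2 * Q.2 +
   (p * r * Q.1.2 + (0 * Q.1.2 + 0 * Q.1.2)))).
  by apply: eq_fsum => // -[[a b] c] _; rewrite /w2 /ev /=; ring.
rewrite (simple_lin D _ _ _ _ _ _ _ _ (fun Q : qform => 0 * Q.1.2)) A2E -B2E b0.
rewrite [X in _ + (_ + (_ + (_ + X)))]fsbig1 => [|Q _]; last by rewrite mul0r.
ring.
Qed.

Lemma zagier_w2 (D : int) (p r : nat) : (forall x : int, x ^+ 2 != D) ->
  (0 < r)%N -> coprime p r -> zagier w2 D p r = B2 D * r%:Z ^+ 2.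
Proof.
move=> nonsq; move: p r; apply: euclid_ind => [|p r r0|p r p0 r0 _].
- by rewrite zagier01 expr1n mulr1.
- by rewrite PoszD zagier_shift.
- by move=> f; rewrite (zagier_swap_nonsq nonsq) ?simple_w2 ?f //; [ring | lia | lia].
Qed.

Lemma zagier_w2_0l D l : (0 < l)%N -> zagier w2 D 0 l = B2 D * l%:Z ^+ 2.
Proof.
move=> l0; rewrite zagier0l // /B2 /simple_sum mulrC mulr_fsumr; apply: eq_fsum => // -[[a b] c] _.
by rewrite /w2 /ev /=; ring.
Qed.

Lemma hecke_w2_zagier (D : int) (l : nat) : prime l -> odd l -> ~~ (l %| D)%Z ->
  B2 (l%:Z ^+ 2 * D) + legendre D l * l%:Z * B2 D =
  \sum_(j < l) zagier w2 D j l + B2 D.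
Proof.
move=> l_prime l_odd lD; rewrite /B2 (@hecke_simple w2 D l l%:Z) //.
by congr (_ + _); apply: eq_bigr => j _; rewrite zagier_refl.
Qed.

Lemma hecke_w2 (D : int) (l : nat) : prime l -> odd l -> ~~ (l %| D)%Z ->
  (forall x : int, x ^+ 2 != D) ->
  B2 (l%:Z ^+ 2 * D) + legendre D l * l%:Z * B2 D = (1 + l%:Z ^+ 3) * B2 D.
Proof.
move=> l_prime l_odd lD nonsq; rewrite hecke_w2_zagier //.
have l0 := prime_gt0 l_prime.
have E (j : 'I_l) : zagier w2 D (j : nat) l = B2 D * l%:Z ^+ 2.
  have [->|j0] := posnP (j : nat); first exact: zagier_w2_0l.
  apply: zagier_w2 => //; rewrite coprime_sym prime_coprime //.
  by rewrite gtnNdvd.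
rewrite (eq_bigr _ (fun j _ => E j)) sumr_const card_ord -mulr_natl natz; ring.
Qed.

(** When the discriminant is a square, the forms with an isotropic vector at one
    end contribute a Bernoulli-type correction. *)
Section SquareDiscriminant.
Variable s : nat.
Hypothesis s0 : (0 < s)%N.
Notation D := (s%:Z ^+ 2).

(** [r ^ 2] times [x (1 - x)] at the fractional part of [x / r]: essentially the
    second periodic Bernoulli polynomial. *)
Definition rho (x r : nat) : int := (x %% r)%N%:Z * (r%:Z - (x %% r)%N%:Z).

(** The forms that vanish at one end of the interval; they exist since the
    discriminant is a square. *)
Definition isotropic_sum (p r : nat) : int :=
  \sum_(Q \in [set Q : qform | [/\ disc Q = D, Q.1.1 < 0, Q.2 = 0 & 0 < ev Q p r]]) w2 Q (ev Q p r).

Lemma sum_arith (p x : int) (m : nat) :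
  2 * \sum_(i < m.+1) ((i != 0 :> nat)%:Z * (p * (x - i%:Z * p))) =
  p * m%:Z * (2 * x - (m%:Z + 1) * p).
Proof.
elim: m => [|m IHm]; first by rewrite big_ord1 /=; ring.
by rewrite big_ord_recr /= mulrDr IHm intS; ring.
Qed.

(** The forms are [[- i, s, 0]] with [0 < i p < s r], and their values form an
    arithmetic progression. *)
Lemma isotropic_sumE (p r : nat) : (0 < p)%N -> (0 < r)%N ->
  2 * isotropic_sum p r = D * r%:Z ^+ 2 - s%:Z * p%:Z * r%:Z + rho (s * r) p.
Proof.
move=> p0 r0; pose m := ((s * r) %/ p)%N; pose x : int := s%:Z * r%:Z.
have mE : x = m%:Z * p%:Z + ((s * r) %% p)%N%:Z by rewrite /x /m; have := divn_eq (s * r) p; lia.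
have rl : ((s * r) %% p < p)%N by rewrite ltn_mod.
have -> : isotropic_sum p r =
    \sum_(i \in [set i : nat | (0 < i)%N /\ (i * p < s * r)%N]) (p%:Z * (x - i%:Z * p%:Z)).
  apply: (@fsum_bij _ _ _ _ (fun i : nat => (- i%:Z, s%:Z, 0)) (fun Q => absz Q.1.1)).
  - move=> i /= [i0 ip]; split; last by rewrite abszN absz_nat.
    split=> //=; first by rewrite /disc /=; ring.
      by lia.
    rewrite /ev /= mul0r addr0.
    have -> : - i%:Z * p%:Z ^+ 2 + s%:Z * p%:Z * r%:Z = p%:Z * (x - i%:Z * p%:Z).
      by rewrite /x; ring.
    by rewrite pmulr_rgt0 ?subr_gt0 // /x; lia.
  - move=> [[a b] c] [/= dQ a0 c0]; rewrite /ev /= c0 mul0r addr0 => e0.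
    have bs : b = s%:Z.
      have : b ^+ 2 == D by rewrite -dQ /disc /= c0; apply/eqP; ring.
      rewrite eqf_sqr => /orP[/eqP // | /eqP bE]; exfalso.
      move: e0; rewrite bE.
      have -> : a * p%:Z ^+ 2 + - s%:Z * p%:Z * r%:Z = - (p%:Z * ((- a) * p%:Z + s%:Z * r%:Z)) by ring.
      by rewrite oppr_gt0 pmulr_rlt0 //; lia.
    have aE : a = - (absz a)%:Z by lia.
    split; last by rewrite -aE bs.
    split; first by lia.
    move: e0; have -> : a * p%:Z ^+ 2 + b * p%:Z * r%:Z = p%:Z * (x - (absz a)%:Z * p%:Z).
      by rewrite /x bs {1}aE; ring.
    by rewrite pmulr_rgt0 // /x; lia.
  - by move=> i _; rewrite /w2 /ev /x /=; ring.
pose G (i : nat) : int := (i != 0)%:Z * (p%:Z * (x - i%:Z * p%:Z)).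
rewrite (@eq_fsbigr _ _ _ _ _ G) => [|i]; last first.
  by rewrite inE => -[i0 _]; rewrite /G -lt0n i0 mul1r.
rewrite (fsbig_widen _ `I_m.+1).
- rewrite -fsbig_ord sum_arith /rho.
  have -> : D * r%:Z ^+ 2 - s%:Z * p%:Z * r%:Z = x ^+ 2 - x * p%:Z by rewrite /x; ring.
  by rewrite mE; ring.
- by move=> i /= [i0 ip]; rewrite ltnS /m leq_divRL // ltnW.
- move=> i [/=]; rewrite ltnS /m leq_divRL // /G => im.
  have [->|i0] := posnP i; first by rewrite mul0r.
  move=> /not_andP[//|/negP]; rewrite -leqNgt => mi.
  have -> : x = i%:Z * p%:Z by rewrite /x; lia.
  by rewrite subrr !mulr0.
Qed.

Lemma isotropic_sum_swap (p r : nat) :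
  \sum_(Q \in [set Q : qform | [/\ disc Q = D, Q.2 < 0, Q.1.1 = 0 & 0 < ev Q p r]]) w2 Q (ev Q p r)
  = isotropic_sum r p.
Proof.
have evE Q : ev (fswap Q) r p = ev Q p r by rewrite /ev /fswap /=; ring.
have evE' Q : ev (fswap Q) p r = ev Q r p by rewrite /ev /fswap /=; ring.
have dE Q : disc (fswap Q) = disc Q by rewrite /disc /fswap /=; ring.
apply: (@fsum_bij _ _ _ _ fswap fswap) => -[[a b] c] [/= dQ ? ? ?].
- by split=> //; split; rewrite ?dE ?evE'.
- by split=> //; split; rewrite ?dE ?evE.
- by rewrite /w2 evE'.
Qed.

Lemma zagier_w2_square (p r : nat) : (0 < r)%N -> coprime p r ->
  2 * zagier w2 D p r = 2 * B2 D * r%:Z ^+ 2 + D * (r%:Z ^+ 2 - 1) - rho (s * p) r.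
Proof.
move: p r; apply: euclid_ind => [|p r r0|p r p0 r0 _].
- by rewrite zagier01 /rho !muln0 mod0n -/(B2 D); ring.
- rewrite PoszD zagier_shift // => ->; congr (_ - _).
  by rewrite /rho mulnDr addnC modnMDl.
- move=> f; have := @zagier_swap w2 D _ _ _ r p.
  rewrite isotropic_sum_swap -/(isotropic_sum r p) simple_w2 => H.
  have {}H := H (fun Q e _ => erefl) (fun Q e _ => erefl) (fun Q => erefl).
  have := isotropic_sumE p0 r0; have := isotropic_sumE r0 p0.
  have rz : r%:Z != 0 by lia.
  have pz : p%:Z != 0 by lia.
  have := H rz pz; move: f; lra.
Qed.

(** Multiplication by [s] permutes the residues modulo [l]. *)
Lemma sum_rho (l : nat) : prime l -> odd l -> coprime s l ->
  6 * \sum_(j < l) rho (s * j) l = l%:Z * (l%:Z ^+ 2 - 1).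
Proof.
move=> l_prime l_odd sl.
pose G (x : 'F_l) : int := (x : nat)%:Z * (l%:Z - (x : nat)%:Z).
have s_unit : (s%:R : 'F_l) != 0.
  by rewrite -(dvdn_pcharf (pchar_Fp l_prime)) -prime_coprime // coprime_sym.
have -> : \sum_(j < l) rho (s * j) l = \sum_(x : 'F_l) G x.
  have bij : bijective (fun x : 'F_l => s%:R * x).
    by exists (fun x => s%:R^-1 * x) => x; rewrite ?mulKf ?mulVKf.
  rewrite [RHS](reindex _ (onW_bij _ bij)) -sum_Fp //=; apply: eq_bigr => j _.
  by rewrite /G -natrM !val_Fp_nat.
have -> : \sum_(x : 'F_l) G x = \sum_(0 <= i < l) (i%:Z * (l%:Z - i%:Z)).
  rewrite -sum_Fp // big_mkord; apply: eq_bigr => j _.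
  by rewrite /G !val_Fp_nat // modn_small.
suff E n : 6 * \sum_(0 <= i < n) (i%:Z * (l%:Z - i%:Z)) =
   n%:Z * (n%:Z - 1) * (3 * l%:Z - 2 * n%:Z + 1) by rewrite E; ring.
elim: n => [|n IHn]; first by rewrite big_nil; ring.
by rewrite big_nat_recr //= mulrDr IHn intS; ring.
Qed.

(** Summing [zagier_w2_square] over the residues modulo [l]; the correction does
    not depend on the residue of [s], which is why it is explicit. *)
Lemma hecke_w2_square (l : nat) : prime l -> odd l -> coprime s l ->
  12 * (B2 (l%:Z ^+ 2 * D) + l%:Z * B2 D) = 12 * ((1 + l%:Z ^+ 3) * B2 D)
    + 6 * D * (l%:Z ^+ 2 - 1) * (l%:Z - 1) - l%:Z * (l%:Z ^+ 2 - 1).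
Proof.
move=> l_prime l_odd sl; have l0 := prime_gt0 l_prime.
have lD : ~~ (l %| D)%Z.
  by rewrite dvdzE abszX Euclid_dvdX // negb_and -prime_coprime // coprime_sym sl.
have leg : legendre D l = 1.
  rewrite legendre_Fp // ifT //; apply/existsP; exists s%:R.
  by rewrite rmorphXn.
have := hecke_w2_zagier l_prime l_odd lD; rewrite leg mul1r => ->.
have E (j : 'I_l) : 2 * zagier w2 D (j : nat) l = 2 * B2 D * l%:Z ^+ 2 +
    (j != 0 :> nat)%:Z * D * (l%:Z ^+ 2 - 1) - rho (s * j) l.
  have [->|j0] := posnP (j : nat).
    by rewrite zagier_w2_0l // muln0 /rho mod0n /=; ring.
  rewrite zagier_w2_square //; last first.
    by rewrite coprime_sym prime_coprime // gtnNdvd.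
  by rewrite /=; ring.
have S0 : \sum_(j < l) (j != 0 :> nat)%:Z = l%:Z - 1.
  case: (l) l0 => // k _; rewrite big_ord_recl /= add0r (eq_bigr (fun=> 1)) //.
  by rewrite sumr_const card_ord natz intS; ring.
have := sum_rho l_prime l_odd sl.
have : 2 * \sum_(j < l) zagier w2 D j l = l%:Z * (2 * B2 D * l%:Z ^+ 2)
   + (l%:Z - 1) * D * (l%:Z ^+ 2 - 1) - \sum_(j < l) rho (s * j) l.
  rewrite mulr_sumr (eq_bigr _ (fun j _ => E j)) !big_split /= sumrN -!mulr_suml S0.
  have -> : \sum_(i < l) (2 : int) = 2 * l%:Z by rewrite sumr_const card_ord -[LHS]mulr_natr (natz l).
  ring.
move=> H1 H2; lra.
Qed.

End SquareDiscriminant.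

(** ** Sums of genus characters *)

Definition chi4 (a : int) : int :=
  if (a %% 4)%Z == 1 then 1 else if (a %% 4)%Z == 3 then -1 else 0.

Lemma chi4D4 a k : chi4 (a + 4 * k) = chi4 a.
Proof. by rewrite /chi4 mulrC addrC modzMDl. Qed.

Lemma chi4N a : chi4 (- a) = - chi4 a.
Proof. by rewrite /chi4; do !case: eqP; lia. Qed.

Lemma chi4M a b : chi4 (a * b) = chi4 a * chi4 b.
Proof.
rewrite {1}/chi4 -modzMml -modzMmr -/(chi4 _).
have aE := divz_eq a 4; have bE := divz_eq b 4.
rewrite -[chi4 a](chi4D4 _ (- (a %/ 4)%Z)) -[chi4 b](chi4D4 _ (- (b %/ 4)%Z)).
have a4 : 0 <= (a %% 4)%Z < 4 by rewrite modz_ge0 // ltz_pmod.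
have b4 : 0 <= (b %% 4)%Z < 4 by rewrite modz_ge0 // ltz_pmod.
have -> : a + 4 * - (a %/ 4)%Z = (a %% 4)%Z by lia.
have -> : b + 4 * - (b %/ 4)%Z = (b %% 4)%Z by lia.
by case: (a %% 4)%Z a4 => [[|[|[|[|?]]]]|?] //; case: (b %% 4)%Z b4 => [[|[|[|[|?]]]]|?].
Qed.

Lemma chi4_sqr l : odd l -> chi4 (l%:Z ^+ 2) = 1.
Proof.
move=> lo; have [k ->] : exists k, l = (2 * k + 1)%N by exists (l %/ 2)%N; lia.
have -> : (2 * k + 1)%N%:Z ^+ 2 = 1 + 4 * (k%:Z ^+ 2 + k%:Z) by rewrite PoszD PoszM; ring.
by rewrite chi4D4.
Qed.

(** The genus character of discriminant [- 4]: the value of [chi4] at any odd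
    integer represented by the form. *)
Definition chiQ (Q : qform) : int := if (2 %| Q.1.1)%Z then chi4 Q.2 else chi4 Q.1.1.
(** For weight 1 the weight [e ^ 0] is replaced by the genus character, restricted
    to even values of the form; the condition [e != 0] makes it
    vanish at [0]. *)
Definition w1 (Q : qform) (e : int) : int := chiQ Q * ((2 %| e)%Z && (e != 0))%:Z.
Definition R1 (D : int) : int := simple_sum w1 D 0 1.

Section Weight1.
Variable n : int.
Hypothesis n3 : (n %% 8)%Z = 3.
Notation D := (4 * n).

Variant form_spec (Q : qform) : Prop :=
 | FormEvenOdd a x c of Q = (4 * a + 2, 4 * x + 2, 2 * c + 1)
 | FormOddEven a x c of Q = (2 * a + 1, 4 * x + 2, 4 * c + 2)
 | FormOddOdd a x k of Q = (2 * a + 1, 4 * x, 2 * a + 1 + 4 * k).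

(** As [n] is [3] modulo [8], the residues of the coefficients modulo [4] fall into
    three classes, permuted by the action of the modular group. *)
Lemma formP Q : disc Q = D -> form_spec Q.
Proof.
case: Q => [[a b] c]; rewrite /disc /= => dQ.
have [m nE] : exists m, n = 8 * m + 3 by exists (n %/ 8)%Z; lia.
have [x bE] : exists x, b = 2 * x.
  have [[x ->]|[x bE]] : (exists x, b = 2 * x) \/ (exists x, b = 2 * x + 1); last 2 first.
  - by exists x.
  - have E : 4 * (x ^+ 2 + x - a * c - n) = -1 by move: dQ; rewrite bE; lra.
    lia.
  have [b2|b2] : (b %% 2)%Z = 0 \/ (b %% 2)%Z = 1 by lia.
    by left; exists (b %/ 2)%Z; lia.
  by right; exists (b %/ 2)%Z; lia.
have E : x ^+ 2 = 8 * m + 3 + a * c by move: dQ; rewrite bE nE; lra.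
have half (y : int) : (exists k, y = 2 * k) \/ (exists k, y = 2 * k + 1).
  have [b2|b2] : (y %% 2)%Z = 0 \/ (y %% 2)%Z = 1 by lia.
    by left; exists (y %/ 2)%Z; lia.
  by right; exists (y %/ 2)%Z; lia.
have tri (y : int) : exists k, y ^+ 2 + y = 2 * k.
  by have [[k ->]|[k ->]] := half y; [exists (2 * k ^+ 2 + k) | exists (2 * k ^+ 2 + 3 * k + 1)]; ring.
have [[a' aE]|[a' aE]] := half a; have [[c' cE]|[c' cE]] := half c; have [[y xE]|[y xE]] := half x;
  have [t tE] := tri y; rewrite ?aE ?cE ?xE in E bE *; rewrite bE.
- by have : 2 * (2 * y ^+ 2 - 4 * m - 2 * (a' * c') - 1) = 1 by [lra]; lia.
- by have : 2 * (2 * t - 2 * m - a' * c') = 1 by [lra]; lia.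
- by have : 2 * (2 * y ^+ 2 - 4 * m - a' * (2 * c' + 1) - 1) = 1 by [lra]; lia.
- have [[u uE]|[u uE]] := half a'.
    have : 4 * (2 * t - 2 * m - u * (2 * c' + 1)) = 2 by rewrite uE in E; lra.
    lia.
  by apply: (@FormEvenOdd _ u y c'); rewrite uE; congr (_, _, _); ring.
- by have : 2 * (2 * y ^+ 2 - 4 * m - c' * (2 * a' + 1) - 1) = 1 by [lra]; lia.
- have [[u uE]|[u uE]] := half c'.
    have : 4 * (2 * t - 2 * m - u * (2 * a' + 1)) = 2 by rewrite uE in E; lra.
    lia.
  by apply: (@FormOddEven _ a' y u); rewrite uE; congr (_, _, _); ring.
- have E2 : a' + c' = 2 * (y ^+ 2 - 2 * m - 1 - a' * c') by lra.
  have [[u uE]|[u uE]] := half (c' - a').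
    have cE' : c' = a' + 2 * u by lia.
    by apply: (@FormOddOdd _ a' y u); rewrite cE'; congr (_, _, _); ring.
  lia.
- by have : 2 * (4 * t - 4 * m - 2 * (a' * c') - a' - c' - 2) = -1 by [lra]; lia.
Qed.

Lemma dvd2 (x : int) : (2 %| 2 * x)%Z = true. Proof. exact: dvdz_mulr. Qed.
Lemma dvd2n (x : int) : (2 %| 2 * x + 1)%Z = false. Proof. lia. Qed.

Lemma chiQ_shift Q : disc Q = D -> chiQ (fshift Q) = chiQ Q.
Proof.
move/formP => [a x c|a x c|a x k] -> ; rewrite /chiQ /fshift /=.
- have -> : (2 %| 4 * a + 2)%Z by lia.
  by rewrite -[RHS](chi4D4 _ (a + x + 1)); congr chi4; ring.
- by have -> : (2 %| 2 * a + 1)%Z = false by lia.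
- by have -> : (2 %| 2 * a + 1)%Z = false by lia.
Qed.

Lemma chiQ_swap Q : disc Q = D -> chiQ (fswap Q) = chiQ Q.
Proof.
move/formP => [a x c|a x c|a x k] -> ; rewrite /chiQ /fswap /=.
- have -> : (2 %| 4 * a + 2)%Z by lia.
  by have -> : (2 %| 2 * c + 1)%Z = false by lia.
- have -> : (2 %| 4 * c + 2)%Z by lia.
  by have -> : (2 %| 2 * a + 1)%Z = false by lia.
- have -> : (2 %| 2 * a + 1)%Z = false by lia.
  have -> : (2 %| 2 * a + 1 + 4 * k)%Z = false by lia.
  exact: chi4D4.
Qed.

Lemma chiQ_opp Q : chiQ (fopp Q) = - chiQ Q.
Proof. by rewrite /chiQ /fopp /= rpredN !chi4N; case: ifP. Qed.

Lemma w1_shift Q e : disc Q = D -> w1 (fshift Q) e = w1 Q e.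
Proof. by move=> dQ; rewrite /w1 chiQ_shift. Qed.
Lemma w1_swap Q e : disc Q = D -> w1 (fswap Q) e = w1 Q e.
Proof. by move=> dQ; rewrite /w1 chiQ_swap. Qed.
Lemma w1_opp Q e : disc Q = D -> w1 (fopp Q) (- e) = - w1 Q e.
Proof. by move=> _; rewrite /w1 chiQ_opp rpredN oppr_eq0 mulNr. Qed.

(** [3] is not a square modulo [8]. *)
Lemma sqr_eq_even (X p : int) : X ^+ 2 = n * p ^+ 2 -> (2 %| p)%Z && (2 %| X)%Z.
Proof.
have [m ->] : exists m, n = 8 * m + 3 by exists (n %/ 8)%Z; lia.
have [u uE] : exists u, X = 2 * u \/ X = 2 * u + 1 by exists (X %/ 2)%Z; lia.
have [v vE] : exists v, p = 2 * v \/ p = 2 * v + 1 by exists (p %/ 2)%Z; lia.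
case: uE => ->; case: vE => ->; rewrite ?dvd2 ?dvd2n // => E.
- by have : 4 * (u ^+ 2 - (8 * m + 3) * (v ^+ 2 + v) - 2 * m) = 3 by [lra]; lia.
- by have : 2 * (2 * (u ^+ 2 + u) - 2 * ((8 * m + 3) * v ^+ 2)) = -1 by [lra]; lia.
- by have : 4 * (u ^+ 2 + u - (8 * m + 3) * (v ^+ 2 + v) - 2 * m) = 2 by [lra]; lia.
Qed.

Lemma ev_neq0 Q (p r : int) : disc Q = D -> ~~ ((2 %| p)%Z && (2 %| r)%Z) -> ev Q p r != 0.
Proof.
move=> dQ; apply: contraNneq; rewrite /ev.
move: (dQ); case/formP: dQ => [a x c|a x c|a x k] -> /=; rewrite /disc /= => dQ e0.
- have : ((2 * c + 1) * r + (2 * x + 1) * p) ^+ 2 = n * p ^+ 2.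
    have -> : n = (2 * x + 1) ^+ 2 - (4 * a + 2) * (2 * c + 1) by lra.
    apply/eqP; rewrite -subr_eq0; apply/eqP.
    by rewrite -[RHS](mulr0 (2 * c + 1)) -e0; ring.
  by case/sqr_eq_even/andP=> p2; rewrite p2; lia.
- have : ((2 * a + 1) * p + (2 * x + 1) * r) ^+ 2 = n * r ^+ 2.
    have -> : n = (2 * x + 1) ^+ 2 - (2 * a + 1) * (4 * c + 2) by lra.
    apply/eqP; rewrite -subr_eq0; apply/eqP.
    by rewrite -[RHS](mulr0 (2 * a + 1)) -e0; ring.
  by case/sqr_eq_even/andP=> p2; rewrite p2; lia.
- have : ((2 * a + 1) * p + (2 * x) * r) ^+ 2 = n * r ^+ 2.
    have -> : n = (2 * x) ^+ 2 - (2 * a + 1) * (2 * a + 1 + 4 * k) by lra.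
    apply/eqP; rewrite -subr_eq0; apply/eqP.
    by rewrite -[RHS](mulr0 (2 * a + 1)) -e0; ring.
  by case/sqr_eq_even/andP=> p2; rewrite p2; lia.
Qed.

Lemma nonsq4 (x : int) : x ^+ 2 != D.
Proof.
apply/eqP => xD; have /andP[_] : (2 %| 2)%Z && (2 %| x)%Z.
  apply: contraTT isT => _; have := @ev_neq0 (0, x, 0) 1 0.
  by rewrite /disc /ev /= xD => /(_ _ isT); rewrite !mulr0 !mul0r subr0 !addr0 => /(_ erefl).
move=> _; have := @ev_neq0 (0, x, 0) 1 0.
by rewrite /disc /ev /= xD !mulr0 !mul0r subr0 !addr0 eqxx => /(_ erefl isT).
Qed.

Lemma even_ev (Q : qform) (p r : int) : disc Q = D ->
  (2 %| ev Q p r)%Z = (2 %| Q.1.1 * (p %% 2)%Z + Q.2 * (r %% 2)%Z)%Z.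
Proof.
move=> dQ; have [x bE] : exists x, Q.1.2 = 2 * x.
  by case/formP: dQ => [a x c|a x c|a x k] -> /=; [exists (2 * x + 1) | exists (2 * x + 1) | exists (2 * x)]; ring.
have sqm (y : int) : exists k, y ^+ 2 = (y %% 2)%Z + 2 * k.
  have [k [kE|kE]] : exists k, y = 2 * k \/ y = 2 * k + 1 by exists (y %/ 2)%Z; lia.
    by exists (2 * k ^+ 2); rewrite (_ : (y %% 2)%Z = 0) ?kE; [ring | lia].
  by exists (2 * (k ^+ 2 + k)); rewrite (_ : (y %% 2)%Z = 1) ?kE; [ring | lia].
have [u uE] := sqm p; have [v vE] := sqm r.
have -> : ev Q p r = (Q.1.1 * (p %% 2)%Z + Q.2 * (r %% 2)%Z) + 2 * (Q.1.1 * u + x * p * r + Q.2 * v).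
  by rewrite /ev bE uE vE; ring.
by rewrite rpredDr // dvdz_mulr.
Qed.

(** Whether [Q(p, r)] is even depends on the parities of [a], [c], [p] and [r]
    only; the involution [fdual] changes the sign of the character and exchanges
    [a] and [c]. *)
Lemma simple_w1 (p r : nat) : coprime p r ->
  simple_sum w1 D p r = ((odd r)%:Z - (odd p)%:Z) * R1 D.
Proof.
move=> cop.
have pr : ~~ ((2 %| p%:Z)%Z && (2 %| r%:Z)%Z).
  apply/negP => /andP[p2 r2]; have : (2 %| gcdn p r)%N by rewrite dvdn_gcd; lia.
  by rewrite (eqP cop).
have val Q : disc Q = D -> w1 Q (ev Q p r) =
    chiQ Q * (2 %| Q.1.1 * (odd p)%:Z + Q.2 * (odd r)%:Z)%Z%:Z.
  move=> dQ; rewrite /w1 ev_neq0 // andbT even_ev //.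
  have modE (k : nat) : (k%:Z %% 2)%Z = (odd k)%:Z by lia.
  by rewrite !modE.
have R1E : R1 D = \sum_(Q \in [set Q : qform | [/\ disc Q = D, Q.1.1 < 0 & 0 < Q.2]])
     chiQ Q * (2 %| Q.2)%Z%:Z.
  apply: eq_fsum => // -[[a b] c] [/= dQ a0 c0]; rewrite /w1; congr (_ * _%:Z).
  by rewrite /ev /= !mulr0 !add0r expr1n mulr1 (gt_eqF c0) andbT.
have dual Q : disc Q = D -> chiQ (fdual Q) = - chiQ Q.
  move=> dQ; rewrite -(chiQ_swap dQ) -chiQ_opp; by case: Q {dQ} => [[a b] c].
have pr' : odd p || odd r.
  by move: pr; lia.
rewrite /simple_sum (eq_fsum (B := [set Q : qform | [/\ disc Q = D, Q.1.1 < 0 & 0 < Q.2]])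
  (G := fun Q => chiQ Q * (2 %| Q.1.1 * (odd p)%:Z + Q.2 * (odd r)%:Z)%Z%:Z)) //; last first.
  by move=> Q [dQ _ _]; exact: val.
have dQ' (F G : qform -> int) : (forall Q, disc Q = D -> F (fdual Q) = - G Q) ->
    \sum_(Q \in [set Q : qform | [/\ disc Q = D, Q.1.1 < 0 & 0 < Q.2]]) F Q =
    - \sum_(Q \in [set Q : qform | [/\ disc Q = D, Q.1.1 < 0 & 0 < Q.2]]) G Q.
  move=> FG; rewrite -simple_dual -fsumN; last exact: finite_simple.
  by apply: eq_fsum => // Q [dQ _ _]; exact: FG.
rewrite R1E; case: (odd p) (odd r) pr' => [] [] // _; rewrite ?subrr ?mul0r ?sub0r ?subr0 ?mul1r ?mulN1r.
- have := dQ' (fun Q => chiQ Q * (2 %| Q.1.1 * 1 + Q.2 * 1)%Z%:Z) (fun Q => chiQ Q * (2 %| Q.1.1 * 1 + Q.2 * 1)%Z%:Z).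
  move=> H; suff : forall Q, disc Q = D -> chiQ (fdual Q) * (2 %| (fdual Q).1.1 * 1 + (fdual Q).2 * 1)%Z%:Z = - (chiQ Q * (2 %| Q.1.1 * 1 + Q.2 * 1)%Z%:Z).
    by move=> /H; rewrite -[nat_of_bool true]/1%N; set X := (X in X = - X); rewrite -/X; lia.
  move=> Q /dual ->; rewrite mulNr; congr (- (_ * _%:Z)); case: Q => [[a b] c] /=; lia.
- rewrite -[RHS](dQ' (fun Q => chiQ Q * (2 %| Q.1.1)%Z%:Z)) => [|Q /dual ->].
    by apply: eq_fsum => // Q _; congr (_ * (nat_of_bool _)%:Z);
      rewrite -[Posz true]/(1 : int) -[Posz false]/(0 : int) mulr1 mulr0 ?addr0 ?add0r.
  by rewrite mulNr; congr (- (_ * (nat_of_bool _)%:Z)); case: Q => [[a b] c] /=; rewrite rpredN.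
- by apply: eq_fsum => // Q _; congr (_ * (nat_of_bool _)%:Z);
      rewrite -[Posz true]/(1 : int) -[Posz false]/(0 : int) mulr1 mulr0 ?addr0 ?add0r.
Qed.

Lemma zagier_w1 (p r : nat) : (0 < r)%N -> coprime p r ->
  zagier w1 D p r = (odd r)%:Z * R1 D.
Proof.
move: p r; apply: euclid_ind => [|p r r0|p r p0 r0 cop].
- by rewrite zagier01 mul1r.
- by rewrite PoszD zagier_shift // => *; exact: w1_shift.
- move=> f; rewrite (zagier_swap_nonsq nonsq4 w1_swap w1_opp) ?f; try lia.
    by rewrite simple_w1 1?coprime_sym //; ring.
  by move=> Q; rewrite /w1 eqxx andbF mulr0.
Qed.

(** The character takes the value [chi4 l] on a multiple by [l], and is unchanged
    on the sublattices of index [l], as [l] is odd. *)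
Lemma hecke_w1 (l : nat) : prime l -> odd l -> ~~ (l %| n)%Z ->
  R1 (l%:Z ^+ 2 * D) + legendre D l * chi4 l * R1 D = (l%:Z + 1) * R1 D.
Proof.
move=> l_prime l_odd ln; have l0 := prime_gt0 l_prime.
have lD : ~~ (l %| D)%Z.
  rewrite dvdzE abszM Euclid_dvdM // -dvdzE negb_or ln andbT.
  apply/negP; rewrite dvdzE => l4; have : (l %| 2 ^ 2)%N by exact: l4.
  by rewrite Euclid_dvdX // dvdn_prime2 // => /andP[/eqP l2]; rewrite l2 in l_odd.
have l2 x : (2 %| l%:Z * x)%Z = (2 %| x)%Z by lia.
rewrite /R1 (@hecke_simple w1 D l (chi4 l)) //.
- have E (j : 'I_l) : zagier w1 D (- (j : nat)%:Z) l = R1 D.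
    rewrite zagier_refl //; have [->|j0] := posnP (j : nat).
      rewrite [LHS]zagier0l // /R1 /simple_sum; apply: eq_fsum => // -[[a b] c] [/= dQ a0 c0].
      rewrite /w1; congr (_ * (nat_of_bool _)%:Z).
      have -> : ev (a, b, c) 0 1 = c by rewrite /ev /=; ring.
      by rewrite expr2 -mulrA !l2 !mulf_eq0 (gt_eqF c0) !orbF; have -> : l%:Z == 0 = false by lia.
    rewrite zagier_w1 // ?l_odd ?mul1r // coprime_sym prime_coprime //.
    by rewrite gtnNdvd.
  by rewrite (eq_bigr _ (fun j _ => E j)) sumr_const card_ord -[R1 D *+ l]mulr_natl (natz l) /R1; ring.
- move=> j Q e dQ; rewrite /w1; congr (_ * _); rewrite /chiQ /fsub /=.
  case/formP: dQ => [a x c|a x c|a x k] -> /=.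
  + have -> : (2 %| 4 * a + 2)%Z by lia.
    have [t tE] : exists t, l%:Z ^+ 2 = 4 * t + 1.
      have [k ->] : exists k, l = (2 * k + 1)%N by exists (l %/ 2)%N; lia.
      by exists (k%:Z ^+ 2 + k%:Z); rewrite PoszD PoszM; ring.
    have [k [kE|kE]] : exists k, j = 2 * k \/ j = 2 * k + 1 by exists (j %/ 2)%Z; lia.
      rewrite -[RHS](chi4D4 _ ((4 * a + 2) * k ^+ 2 - l%:Z * k * (2 * x + 1) * 1 + t * (2 * c + 1))); congr chi4.
      by rewrite tE kE; ring.
    have [i iE] : exists i, l%:Z = 2 * i + 1 by exists (l%:Z %/ 2)%Z; lia.
    rewrite -[RHS](chi4D4 _ ((4 * a + 2) * (k ^+ 2 + k) + a - l%:Z * k * (2 * x + 1) - i * (2 * x + 1) - x + t * (2 * c + 1))); congr chi4.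
    by rewrite tE kE iE; ring.
  + by have -> : (2 %| 2 * a + 1)%Z = false by lia.
  + by have -> : (2 %| 2 * a + 1)%Z = false by lia.
- move=> Q e dQ; rewrite /w1; congr (_ * _); rewrite /chiQ /fsub_inf /= expr2 -mulrA !l2.
  by rewrite mulrA -expr2 chi4M chi4_sqr // mul1r.
- move=> Q e dQ; rewrite /w1 /chiQ /fmul /= !l2 mulf_eq0.
  have -> : l%:Z == 0 = false by lia.
  by rewrite !chi4M; case: ifP => _; ring.
Qed.

End Weight1.

(** * Generating functions of maps with finite fibres *)

(** The generating series counting the fibres of [N]. *)
Definition cgf (I : choiceType) (N : I -> nat) : fps int :=
  Fps (fun n => \sum_(i \in [set i | N i = n]) (1 : int)).

Definition ffib (I : choiceType) (N : I -> nat) := forall n, finite_set [set i | (N i <= n)%N].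

Section Cgf.
Variables (I J : choiceType).

Lemma fcoef_cgfM (N : I -> nat) (G : fps int) n : ffib N ->
  (cgf N * G) n = \sum_(i \in [set i | (N i <= n)%N]) G (n - N i)%N.
Proof.
move=> fN; rewrite fcoefM fsbig_finite //.
transitivity (\sum_(i <- fset_set [set i | (N i <= n)%N]) \sum_(k < n.+1) (N i == k)%:R * G (n - k)%N).
  rewrite exchange_big /=; apply: eq_bigr => k _; rewrite -mulr_suml; congr (_ * _).
  rewrite (eq_fsum (B := [set i | (N i <= n)%N] `&` [set i | N i = k]) (G := fun=> 1)) //; last first.
    by move=> i /=; split=> [->|[]] //; split=> //; rewrite -ltnS.
  rewrite fsbig_mkcondr fsbig_finite //; apply: eq_bigr => i _.
  have -> : (i \in [set i | N i = k]) = (N i == k) by apply/idP/idP; rewrite inE => /eqP.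
  by case: (N i == k).
apply: eq_big_seq => i; rewrite in_fset_set // inE /= => Nin.
have Ni : (N i < n.+1)%N by [].
rewrite (bigD1 (Ordinal Ni)) //= eqxx mul1r big1 ?addr0 // => k /eqP kN.
case: eqP => [NE|]; last by rewrite mul0r.
by case: kN; apply/val_inj.
Qed.

Lemma cgf_bij (N : I -> nat) (M : J -> nat) (h : I -> J) (g : J -> I) :
  cancel h g -> cancel g h -> (forall i, M (h i) = N i) -> cgf M = cgf N.
Proof.
move=> hg gh NM; apply: fpsP => n /=.
apply: (@fsum_bij _ _ _ _ h g) => [i /= <-|j /= <-|//]; first by rewrite NM hg.
by rewrite -NM gh.
Qed.


Lemma cgf_sum (N : I -> nat) (M : J -> nat) : ffib N -> ffib M ->
  cgf (fun x : I + J => match x with inl i => N i | inr j => M j end) = cgf N + cgf M.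
Proof.
move=> fN fM; apply: fpsP => n; rewrite fcoefD /=.
rewrite (@fsum_split _ _ [set x : I + J | exists2 i, x = inl i & N i = n]
   [set x : I + J | exists2 j, x = inr j & M j = n]); first last.
- by move=> x [i ->] _ [].
- move=> [i|j] /=; split.
  + by move=> Nn; left; exists i.
  + by case=> [[k [->]]|[k]].
  + by move=> Nn; right; exists j.
  + by case=> [[k]|[k [->]]].
- apply: (@sub_finite_set _ _ (inl @` [set i | N i = n] `|` inr @` [set j | M j = n])).
    by move=> [i|j] /= H; [left; exists i | right; exists j].
  rewrite finite_setU; split; apply: finite_image; [apply: sub_finite_set (fN n)|apply: sub_finite_set (fM n)];
  by move=> i /= ->.
congr (_ + _).
- rewrite (_ : [set x | _] = inl @` [set i | N i = n]).
    by rewrite fsbig_image // => i i' _ _ [].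
  by apply/seteqP; split=> [x [i -> Ni]|x [i Ni <-]]; exists i.
- rewrite (_ : [set x | _] = inr @` [set i | M i = n]).
    by rewrite fsbig_image // => i i' _ _ [].
  by apply/seteqP; split=> [x [i -> Ni]|x [i Ni <-]]; exists i.
Qed.

Lemma ffib_pair (N : I -> nat) (M : J -> nat) : ffib N -> ffib M ->
  ffib (fun x : I * J => N x.1 + M x.2)%N.
Proof.
move=> fN fM n; apply: sub_finite_set (finite_setX (fN n) (fM n)) => -[i j] /= H.
by split=> /=; lia.
Qed.

Lemma cgfM (N : I -> nat) (M : J -> nat) : ffib N -> ffib M ->
  cgf N * cgf M = cgf (fun x : I * J => N x.1 + M x.2)%N.
Proof.
move=> fN fM; apply: fpsP => n; rewrite fcoef_cgfM //=.
have fNn := fN n; have fMn := fM n.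
transitivity (\sum_(i \in [set i | (N i <= n)%N]) \sum_(j \in [set j | (M j <= n)%N])
   (N i + M j == n)%N%:Z).
  apply: eq_fsum => // i /= iN.
  rewrite (eq_fsum (B := [set j | (M j <= n)%N] `&` [set j | (N i + M j == n)%N]) (G := fun=> 1)) //.
    rewrite fsbig_mkcondr; apply: eq_fsum => // j _.
    have -> : (j \in [set j | (N i + M j == n)%N]) = (N i + M j == n)%N.
      by apply/idP/idP; rewrite inE.
    by case: eqP.
  by move=> j /=; split=> [|[]]; lia.
rewrite pair_fsbig //.
rewrite [RHS](eq_fsum (B := ([set i | (N i <= n)%N] `*` [set j | (M j <= n)%N])
   `&` [set x | (N x.1 + M x.2 == n)%N]) (G := fun=> 1)) //.
  rewrite [RHS]fsbig_mkcondr; apply: eq_fsum => // -[i j] _ /=.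
  have -> : ((i, j) \in [set x | (N x.1 + M x.2 == n)%N]) = (N i + M j == n)%N.
    by apply/idP/idP; rewrite inE.
  by case: eqP.
by move=> [i j] /=; split=> [H|[_ /eqP //]]; split; [split=> /=; lia | apply/eqP].
Qed.

End Cgf.

Lemma cgf_V (I : choiceType) r (N : I -> nat) : (0 < r)%N -> V r (cgf N) = cgf (fun i => r * N i)%N.
Proof.
move=> r0; apply: fpsP => n /=; case: ifP => [/dvdnP[m ->]|rn].
  by rewrite mulnK //; apply: eq_fsum => // i /=; split; nia.
by rewrite fsbig1 // => i /= H; move: rn; rewrite -H dvdn_mulr.
Qed.

Lemma cgf_q (I : choiceType) k (N : I -> nat) : q ^+ k * cgf N = cgf (fun i => k + N i)%N.
Proof.
apply: fpsP => n; rewrite fcoefqXM /=; case: leqP => kn.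
  by apply: eq_fsum => // i /=; split; lia.
by rewrite fsbig1 // => i /=; lia.
Qed.

(** * Theta functions *)

Definition tri (x : int) : nat := (absz (x * (x + 1)))./2.

Lemma triE (x : int) : 2 * (tri x)%:Z = x * (x + 1).
Proof.
rewrite /tri; have [k [kE|kE]] : exists k, x = 2 * k \/ x = 2 * k + 1 by exists (x %/ 2)%Z; lia.
  have E : x * (x + 1) = 2 * (k * (2 * k + 1)) by rewrite kE; ring.
  have : 0 <= k * (2 * k + 1) by nia.
  by rewrite E; lia.
have E : x * (x + 1) = 2 * ((2 * k + 1) * (k + 1)) by rewrite kE; ring.
have : 0 <= (2 * k + 1) * (k + 1) by nia.
by rewrite E; lia.
Qed.

Definition sqz (x : int) : nat := (absz x ^ 2)%N.

Lemma sqzE (x : int) : (sqz x)%:Z = x ^+ 2.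
Proof. by rewrite /sqz -[(absz x ^ 2)%N]abszX gez0_abs // sqr_ge0. Qed.

HB.lock Definition theta : fps int := cgf sqz.
(** The sum of [q ^ (k (k + 1) / 2)] over the natural numbers; each triangular
    number is taken twice when [k] runs over the integers, see [cgf_tri]. *)
HB.lock Definition psi : fps int := cgf (fun k : nat => tri k).

Lemma ffib_sqz : ffib sqz.
Proof.
move=> n; apply: sub_finite_set (finite_ibox n) => x /= xn.
by apply: le_trans (norm_le_sqr x) _; rewrite -sqzE lez_nat.
Qed.

Lemma tri_ge (x : int) : (absz x <= tri x + 1)%N.
Proof. by have := triE x; nia. Qed.

Lemma ffib_tri : ffib tri.
Proof.
move=> n; apply: sub_finite_set (finite_ibox n.+1) => x /= xn.
by have := tri_ge x; lia.
Qed.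

Lemma ffib_trin : ffib (fun k : nat => tri k).
Proof.
move=> n; apply: sub_finite_set (finite_II n.+2) => x /= xn.
by have := tri_ge x; lia.
Qed.

Lemma ffib_lin (I : choiceType) k r (N : I -> nat) : (0 < r)%N -> ffib N -> ffib (fun i => k + r * N i)%N.
Proof. by move=> r0 fN n; apply: sub_finite_set (fN n) => i /=; nia. Qed.

Lemma ffib_mul (I : choiceType) r (N : I -> nat) : (0 < r)%N -> ffib N -> ffib (fun i => r * N i)%N.
Proof. by move=> r0 fN n; apply: sub_finite_set (fN n) => i /=; nia. Qed.

Lemma cgf_tri : cgf tri = 2%:R * psi.
Proof.
rewrite psi.unlock mulr_natl mulr2n -(cgf_sum ffib_trin ffib_trin).
apply: (@cgf_bij _ _ _ _ (fun x : nat + nat => match x with inl k => k%:Z | inr k => - k%:Z - 1 end)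
  (fun x => match x with Posz k => inl k | Negz k => inr k end)) => [[k|k]|[k|k]|[k|k]] //=.
- by have -> : - k%:Z - 1 = Negz k by rewrite NegzE; lia.
- by rewrite NegzE; lia.
- by have := triE (- k%:Z - 1); have := triE k; nia.
Qed.

(** Even and odd summation variable. *)
Lemma theta_dissection : theta = V 4 theta + 2%:R * (q * V 8 psi).
Proof.
have -> : 2%:R * (q * V 8 psi) = q ^+ 1 * V 8 (cgf tri).
  by rewrite cgf_tri rmorphM rmorph_nat /= expr1; ring.
rewrite theta.unlock !cgf_V // cgf_q -cgf_sum; last 2 first.
- exact: ffib_mul ffib_sqz.
- exact: ffib_lin ffib_tri.
apply: (@cgf_bij _ _ _ _ (fun x : int + int => match x with inl k => 2 * k | inr k => 2 * k + 1 end)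
  (fun x => if (2 %| x)%Z then inl (x %/ 2)%Z else inr (x %/ 2)%Z)) => [[k|k]|x|[k|k]].
- by rewrite dvdz_mulr // mulKz.
- by have -> : (2 %| 2 * k + 1)%Z = false by [lia]; congr inr; lia.
- by case: ifP; lia.
- by apply/eqP; rewrite -eqz_nat PoszM !sqzE; apply/eqP; ring.
- apply/eqP; rewrite -eqz_nat PoszD PoszM !sqzE; apply/eqP.
  have -> : 8 * (tri k)%:Z = 4 * (2 * (tri k)%:Z) by ring.
  by rewrite triE; ring.
Qed.

(** The pairs [(x, y)] with [x + y] even form a lattice similar to the square
    lattice; those with [x + y] odd form a translate of it. *)
Lemma theta_sqr : theta ^+ 2 = V 2 (theta ^+ 2) + 4%:R * (q * V 4 (psi ^+ 2)).
Proof.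
have -> : 4%:R * (q * V 4 (psi ^+ 2)) = q ^+ 1 * V 4 (cgf tri ^+ 2).
  by rewrite cgf_tri !(rmorphM, rmorphXn, rmorph_nat) /= expr1; ring.
rewrite theta.unlock !expr2 !cgfM ?cgf_V // ?cgf_q; try exact: ffib_sqz; try exact: ffib_tri.
rewrite -cgf_sum; last 2 first.
- by apply: ffib_mul => //; apply: ffib_pair ffib_sqz ffib_sqz.
- by apply: ffib_lin => //; apply: ffib_pair ffib_tri ffib_tri.
apply: (@cgf_bij _ _ _ _ (fun x : int * int + int * int =>
    match x with inl (u, v) => (u + v, u - v) | inr (k, m) => (k + m + 1, k - m) end)
  (fun x => if (2 %| x.1 + x.2)%Z then inl ((x.1 + x.2) %/ 2, (x.1 - x.2) %/ 2)%Z
     else inr ((x.1 + x.2) %/ 2, (x.1 - x.2) %/ 2)%Z)) => [[[k m]|[k m]]|[x y]|[[k m]|[k m]]] /=.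
- by rewrite ifT; [congr (inl (_, _)); lia | lia].
- by rewrite ifF; [congr (inr (_, _)); lia | lia].
- by case: ifP => H; congr (_, _); lia.
- by apply/eqP; rewrite -eqz_nat PoszM !PoszD !sqzE; apply/eqP; ring.
- have : (sqz (k + m + 1))%:Z + (sqz (k - m))%:Z = 1 + 4 * ((tri k)%:Z + (tri m)%:Z).
    by rewrite !sqzE; have := triE k; have := triE m; lra.
  lia.
Qed.

(** The map [(x, y) -> (x + y, x - y)] again, on pairs of triangular numbers. *)
Lemma psi_sqr : psi ^+ 2 = theta * V 2 psi.
Proof.
have four0 : (4%:R : fps int) <> 0 by apply: (@fps_neq0 _ _ 0); rewrite fcoef_nat.
apply: (fps_mulI four0).
have -> : 4%:R * psi ^+ 2 = cgf tri ^+ 2 by rewrite cgf_tri; ring.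
have -> : 4%:R * (theta * V 2 psi) = theta * V 2 (cgf tri) + theta * V 2 (cgf tri).
  by rewrite cgf_tri rmorphM rmorph_nat /=; ring.
have fp : ffib (fun x : int * int => sqz x.1 + 2 * tri x.2)%N.
  by apply: (@ffib_pair _ _ sqz (fun x => 2 * tri x)%N); [exact: ffib_sqz | exact: ffib_mul ffib_tri].
rewrite theta.unlock expr2 cgfM ?cgf_V // ?cgfM; try exact: ffib_sqz; try exact: ffib_tri; try exact: ffib_mul ffib_tri.
rewrite -(cgf_sum fp fp).
apply: (@cgf_bij _ _ _ _ (fun x : int * int + int * int =>
    match x with inl (u, v) => (v + u, v - u) | inr (u, v) => (u + v, u - v - 1) end)
  (fun x => if (2 %| x.1 + x.2)%Z then inl ((x.1 - x.2) %/ 2, (x.1 + x.2) %/ 2)%Z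
     else inr ((x.1 + x.2 + 1) %/ 2, (x.1 - x.2) %/ 2)%Z)) => [[[k m]|[k m]]|[x y]|[[k m]|[k m]]] /=.
- by rewrite ifT; [congr (inl (_, _)); lia | lia].
- by rewrite ifF; [congr (inr (_, _)); lia | lia].
- by case: ifP => H; congr (_, _); lia.
- have : (tri (m + k))%:Z + (tri (m - k))%:Z = (sqz k)%:Z + 2 * (tri m)%:Z.
    by rewrite !sqzE; have := triE (m + k); have := triE (m - k); have := triE m; lra.
  lia.
- have : (tri (k + m))%:Z + (tri (k - m - 1))%:Z = (sqz k)%:Z + 2 * (tri m)%:Z.
    by rewrite !sqzE; have := triE (k + m); have := triE (k - m - 1); have := triE m; lra.
  lia.
Qed.

(** * Differential relations between theta functions *)

(** Equal to the sum of [sigma_1(n) q ^ n] over odd [n], by [thetaF_sigma]. *)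
HB.lock Definition thetaF : fps int := q * V 2 (psi ^+ 4).
HB.lock Definition thetab : fps int := neg theta ^+ 4.

Section ThetaCalculus.

Local Notation X := (V 4 theta).
Local Notation Z := (2%:R * (q * V 8 psi)).

Lemma thetaFE : thetaF = q * V 2 (psi ^+ 4). Proof. by rewrite thetaF.unlock. Qed.
Lemma thetabX : thetab = neg theta ^+ 4. Proof. by rewrite thetab.unlock. Qed.

Lemma psi0 : psi 0%N = 1.
Proof.
rewrite psi.unlock /=; rewrite (_ : [set i : nat | tri i = 0%N] = [set 0%N]) ?fsbig_set1 //.
apply/seteqP; split=> [i|i ->] //=; have := triE i => /[swap] ->; rewrite mulr0 => /esym/eqP.
by rewrite mulf_eq0 => /orP[|]; lia.
Qed.

Lemma theta0 : theta 0%N = 1.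
Proof.
rewrite theta.unlock /=; rewrite (_ : [set i : int | sqz i = 0%N] = [set 0 : int]) ?fsbig_set1 //.
apply/seteqP; split=> [i|i ->] //=; have := sqzE i => /[swap] ->.
by move=> /esym/eqP; rewrite expf_eq0 => /andP[_ /eqP].
Qed.

Lemma thetaF0 : thetaF 0%N = 0. Proof. by rewrite thetaFE fcoef0M mul0r. Qed.
Lemma thetaF1 : thetaF 1%N = 1.
Proof. by rewrite thetaFE fcoefqM V0 fcoef0X psi0 expr1n. Qed.
Lemma thetab0 : thetab 0%N = 1.
Proof. by rewrite thetabX fcoef0X neg0 theta0 expr1n. Qed.

Lemma theta_neq0 : theta <> 0. Proof. by apply: (@fps_neq0 _ _ 0); rewrite theta0. Qed.
Lemma thetaF_neq0 : thetaF <> 0. Proof. by apply: (@fps_neq0 _ _ 1); rewrite thetaF1. Qed.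

Lemma mul_neq0 (f g : fps int) : f <> 0 -> g <> 0 -> f * g <> 0.
Proof. by move=> f0 g0 /fps_mul_eq0[]. Qed.

Lemma X_neq0 : X <> 0. Proof. by apply: (@fps_neq0 _ _ 0); rewrite V0 theta0. Qed.
Lemma Z_neq0 : Z <> 0.
Proof. by apply: (@fps_neq0 _ _ 1); rewrite fcoefZn fcoefqM V0 psi0. Qed.
Lemma nat_neq0 k : (k.+1%:R : fps int) <> 0.
Proof. by apply: (@fps_neq0 _ _ 0); rewrite fcoef_nat mul1r pnatr_eq0. Qed.
Lemma exp_neq0 (f : fps int) k : f <> 0 -> f ^+ k <> 0.
Proof.
by move=> f0; elim: k => [|k IHk]; [exact: nat_neq0 0 | rewrite exprS; apply: mul_neq0].
Qed.

Lemma theta_XZ : theta = X + Z. Proof. exact: theta_dissection. Qed.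

Lemma neg_theta : neg theta = X - Z.
Proof.
rewrite {1}theta_XZ rmorphD !rmorphM rmorph_nat /= neg_q !neg_Veven //; ring.
Qed.

Lemma theta4_XZ : theta ^+ 4 = (X + Z) ^+ 4.
Proof. by rewrite -theta_XZ. Qed.

Lemma theta_neg_XZ : theta * neg theta = (X + Z) * (X - Z).
Proof. by rewrite -neg_theta -theta_XZ. Qed.

Lemma V2_theta_sqr : V 2 theta ^+ 2 = X ^+ 2 + Z ^+ 2.
Proof.
have := congr1 (V 2) theta_sqr.
rewrite !(rmorphXn, rmorphD, rmorphM, rmorph_nat) /= !V_comp // V_q //= => ->; ring.
Qed.

Lemma thetaF_XZ : 2%:R * thetaF = X * Z * (X ^+ 2 + Z ^+ 2).
Proof.
rewrite thetaFE -V2_theta_sqr rmorphXn /=.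
have e1 : V 2 psi ^+ 2 = V 2 theta * V 4 psi.
  by rewrite -rmorphXn /= psi_sqr rmorphM /= V_comp.
have e2 : V 4 psi ^+ 2 = X * V 8 psi.
  by rewrite -rmorphXn /= psi_sqr rmorphM /= V_comp.
rewrite (_ : V 2 psi ^+ 4 = (V 2 psi ^+ 2) ^+ 2); last by ring.
by rewrite e1 exprMn e2; ring.
Qed.

(** This and [thetaF_XZ] are what makes the dissection modulo [4] useful: powers
    of [Z] reduce to [1, Z, Z ^ 2, Z ^ 3] with coefficients in [q ^ 4]. *)
Lemma Z4 : Z ^+ 4 = 16%:R * V 4 thetaF.
Proof. by rewrite thetaFE rmorphM !rmorphXn /= V_comp // V_q //; ring. Qed.

Lemma thetaF_sqr : thetaF ^+ 2 = V 2 (theta ^+ 4 * thetaF).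
Proof.
rewrite thetaFE !(rmorphXn, rmorphM) /= V_comp // V_q //.
have e1 : V 2 psi ^+ 2 = V 2 theta * V 4 psi.
  by rewrite -rmorphXn /= psi_sqr rmorphM /= V_comp.
rewrite (_ : V 2 psi ^+ 4 = (V 2 psi ^+ 2) ^+ 2); last by ring.
by rewrite e1; ring.
Qed.

Lemma theta_neg : theta * neg theta = V 2 (neg theta) ^+ 2.
Proof.
have := congr1 (fun f => V 2 (neg f)) theta_sqr.
rewrite !(rmorphXn, rmorphD, rmorphM, rmorph_nat) /= neg_q !neg_Veven //.
rewrite !(rmorphXn, rmorphN, rmorphM, rmorph_nat) /= !V_comp // V_q // => ->.
by rewrite theta_neg_XZ; ring.
Qed.

Lemma thetabE : thetab = theta ^+ 4 - 16%:R * thetaF.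
Proof.
rewrite thetabX neg_theta theta4_XZ (_ : 16%:R * thetaF = 8%:R * (2%:R * thetaF)); last by ring.
by rewrite thetaF_XZ; ring.
Qed.

Lemma neg_thetaF : neg thetaF = - thetaF.
Proof. by rewrite thetaFE rmorphM /= neg_q neg_Veven //; ring. Qed.

Lemma neg_thetab : neg thetab = theta ^+ 4.
Proof. by rewrite thetabX rmorphXn /= negK. Qed.

Lemma V4_thetab : V 4 thetab = X ^+ 4 - Z ^+ 4.
Proof. by rewrite thetabE !(rmorphXn, rmorphB, rmorphM, rmorph_nat) /= -Z4. Qed.

(** A coefficient at [n > 0] is [0] unless [r] divides [n], and then it is the one at
    [n / r]: the descent ends in [0]. *)
Lemma V_fixed r (f : fps int) : (1 < r)%N -> V r f = f -> f = fpsC (f 0%N).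
Proof.
move=> r1 Vf; apply: fpsP => n; rewrite fcoefC.
elim/ltn_ind: n => -[|n] IHn; first by rewrite mul1r.
rewrite mul0r -Vf fcoefV; case: ifP => // /dvdnP[m mE].
rewrite mE mulnK; last by lia.
by rewrite IHn ?mul0r //; case: m mE => //; nia.
Qed.

(** The quotient [Z / X] has fourth power [16 thetaF / theta ^ 4] at [q ^ 4], so if
    [a] is the logarithmic derivative of [thetaF / theta ^ 4], that of [Z / X] is
    [a(q ^ 4)]. *)
Lemma wronskian a : D thetaF * theta - 4%:R * thetaF * D theta = a * thetaF * theta ->
  X * D Z - Z * D X = V 4 a * Z * X.
Proof.
move=> aE; apply: (@fps_mulI _ (4%:R * Z ^+ 3)).
  by apply: mul_neq0; [exact: nat_neq0 | apply: exp_neq0; exact: Z_neq0].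
have := congr1 (V 4) aE.
rewrite !(rmorphB, rmorphM, rmorph_nat) /= => aE'.
have D1 : 4%:R * Z ^+ 3 * D Z = 64%:R * V 4 (D thetaF).
  have : D (Z ^+ 4) = 64%:R * V 4 (D thetaF) by rewrite Z4 DM D_nat DV //; ring.
  by rewrite DX.
have D2 : D X = 4%:R * V 4 (D theta) by rewrite DV.
have -> : 4%:R * Z ^+ 3 * (X * D Z - Z * D X) = 4%:R * Z ^+ 3 * D Z * X - 4%:R * Z ^+ 4 * D X by ring.
rewrite D1 Z4 D2.
have -> : 64%:R * V 4 (D thetaF) * X - 4%:R * (16%:R * V 4 thetaF) * (4%:R * V 4 (D theta))
   = 64%:R * (V 4 (D thetaF) * X - 4%:R * V 4 thetaF * V 4 (D theta)) by ring.
rewrite aE' (_ : 4%:R * Z ^+ 3 * (V 4 a * Z * X) = 4%:R * Z ^+ 4 * V 4 a * X); last by ring.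
by rewrite Z4; ring.
Qed.

(** The logarithmic derivative of [t = thetaF / theta ^ 4] is [thetab].  Call it [a].
    Both [t] and [t(q ^ 4)] are rational in [Z / X], so [a] and [a(q ^ 4)] are
    related; as [thetab] satisfies the same relation, [a / thetab] is fixed by
    [q -> q ^ 4] and therefore constant. *)
Lemma Dlog_t : D thetaF * theta - 4%:R * thetaF * D theta = thetab * thetaF * theta.
Proof.
have [it [tit _]] := fps_inv theta0.
have u0 : (V 2 (psi ^+ 4)) 0%N = 1 by rewrite V0 fcoef0X psi0 expr1n.
have [iu [uiu _]] := fps_inv u0.
have b0 := thetab0; have [ib [bib _]] := fps_inv b0.
(* the logarithmic derivative of [t]; the [1] comes from the factor [q] of [thetaF] *)
pose a := 1 + D (V 2 (psi ^+ 4)) * iu - 4%:R * D theta * it.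
have aE : D thetaF * theta - 4%:R * thetaF * D theta = a * thetaF * theta.
  rewrite thetaFE DM D_q /a; set u := V 2 _ in uiu *.
  have -> : (1 + D u * iu - 4%:R * D theta * it) * (q * u) * theta =
    q * u * theta + q * D u * theta * (u * iu) - 4%:R * D theta * (q * u) * (theta * it) by ring.
  by rewrite uiu tit; ring.
pose W := X * D Z - Z * D X.
have WE : W = V 4 a * Z * X by apply: wronskian.
have main : a * (X ^+ 2 + Z ^+ 2) * (X + Z) = V 4 a * (X - Z) ^+ 3.
  apply: (@fps_mulI _ (X * Z)); first exact: mul_neq0 X_neq0 Z_neq0.
  have -> : X * Z * (a * (X ^+ 2 + Z ^+ 2) * (X + Z)) = 2%:R * (a * thetaF * theta).
    transitivity (a * (X * Z * (X ^+ 2 + Z ^+ 2)) * (X + Z)); first by ring.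
    by rewrite -thetaF_XZ -theta_XZ; ring.
  rewrite -aE.
  have -> : X * Z * (V 4 a * (X - Z) ^+ 3) = W * (X - Z) ^+ 3 by rewrite WE; ring.
  have -> : 2%:R * (D thetaF * theta - 4%:R * thetaF * D theta)
     = D (2%:R * thetaF) * (X + Z) - 4%:R * (2%:R * thetaF) * D (X + Z).
    by rewrite -theta_XZ DM D_nat; ring.
  rewrite thetaF_XZ /W; move: (V 4 theta) (2%:R * (q * V 8 psi)) => x y.
  rewrite !(DM, DD, DX) /=; ring.
have abV : a * V 4 thetab = V 4 a * thetab.
  rewrite V4_thetab thetabX neg_theta.
  have -> : a * (X ^+ 4 - Z ^+ 4) = a * (X ^+ 2 + Z ^+ 2) * (X + Z) * (X - Z) by ring.
  by rewrite main; ring.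
pose c := a * ib.
have cV : V 4 c = c.
  have Vbib : V 4 thetab * V 4 ib = 1 by rewrite -rmorphM /= bib rmorph1.
  rewrite /c rmorphM /=.
  have -> : a * ib = (a * V 4 thetab) * ib * V 4 ib.
    rewrite (_ : a * _ * _ * _ = a * ib * (V 4 thetab * V 4 ib)); last by ring.
    by rewrite Vbib mulr1.
  rewrite abV (_ : V 4 a * thetab * ib * V 4 ib = V 4 a * V 4 ib * (thetab * ib)); last by ring.
  by rewrite bib mulr1.
have a0 : a 0%N = 1.
  by rewrite /a fcoefB fcoefD !fcoef0M fcoef1 !fcoef_D !(mul0r, mulr0) addr0 subr0.
have c1 : c = 1.
  have -> := V_fixed _ cV; last by [].
  rewrite /c fcoef0M a0 mul1r.
  have := congr1 (fun f : fps int => f 0%N) bib; rewrite fcoef0M thetab0 mul1r => ->.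
  by rewrite fcoef1 rmorph1.
have -> : thetab = a.
  by rewrite -[a]mulr1 -bib mulrCA -/c c1 mulr1.
exact: aE.
Qed.

Lemma Dlog_theta_ex : exists e : fps int, D theta = theta * e.
Proof.
have [it [tit _]] := fps_inv theta0; exists (D theta * it).
by rewrite mulrCA tit mulr1.
Qed.

(** The logarithmic derivative of [theta], a quasimodular form of weight 2. *)
Definition thetae : fps int := sval (cid Dlog_theta_ex).

Lemma D_theta : D theta = theta * thetae.
Proof. by rewrite /thetae; case: cid. Qed.

Lemma D_neg_theta : D (neg theta) = neg theta * neg thetae.
Proof. by rewrite Dneg D_theta rmorphM. Qed.

Lemma thetae0 : thetae 0%N = 0.
Proof.
have := congr1 (fun f : fps int => f 0%N) D_theta.
by rewrite fcoef_D fcoef0M mul0r theta0 mul1r.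
Qed.

Lemma D_thetaF : D thetaF = thetaF * (4%:R * thetae + thetab).
Proof.
apply: (fps_mulI theta_neq0); have := Dlog_t; rewrite D_theta => /eqP.
rewrite subr_eq => /eqP H; rewrite mulrC H; ring.
Qed.

Lemma D_thetab : D thetab = 4%:R * thetab * neg thetae.
Proof. by rewrite thetabX DX D_neg_theta /=; ring. Qed.

Lemma thetae_sum : thetae + neg thetae = 4%:R * V 2 (neg thetae).
Proof.
have n0 : theta * neg theta <> 0.
  by apply: mul_neq0 theta_neq0 _; apply: (@fps_neq0 _ _ 0); rewrite neg0 theta0.
apply: (fps_mulI n0); have := congr1 (@D _) theta_neg.
rewrite DM DX /= D_theta D_neg_theta expr1 DV // D_neg_theta rmorphM /= => H.
transitivity (theta * thetae * neg theta + theta * (neg theta * neg thetae)); first by ring.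
by rewrite H theta_neg; ring.
Qed.

(** The logarithmic derivative of [theta / theta(- q) = (X + Z) / (X - Z)] is
    proportional to the Wronskian of [X] and [Z]. *)
Lemma thetae_diff : thetae - neg thetae = 4%:R * thetaF.
Proof.
have n0 : theta * neg theta <> 0.
  by apply: mul_neq0 theta_neq0 _; apply: (@fps_neq0 _ _ 0); rewrite neg0 theta0.
apply: (fps_mulI n0).
have -> : theta * neg theta * (thetae - neg thetae) = D theta * neg theta - theta * D (neg theta).
  by rewrite D_theta D_neg_theta; ring.
have WE : X * D Z - Z * D X = (X ^+ 4 - Z ^+ 4) * Z * X.
  by rewrite -V4_thetab; apply: wronskian Dlog_t.
have -> : D theta * neg theta - theta * D (neg theta) = 2%:R * (X * D Z - Z * D X).
  transitivity (D (X + Z) * (X - Z) - (X + Z) * D (X - Z)); first by rewrite -neg_theta -theta_XZ.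
  by rewrite DB DD; ring.
rewrite WE (_ : 4%:R * thetaF = 2%:R * (2%:R * thetaF)); last by ring.
by rewrite thetaF_XZ theta_neg_XZ; ring.
Qed.

Lemma thetae_rec : thetae = 2%:R * V 2 (neg thetae) + 2%:R * thetaF.
Proof.
apply: (fps_mulI (@nat_neq0 1)).
have -> : 2%:R * thetae = (thetae + neg thetae) + (thetae - neg thetae) by ring.
by rewrite thetae_sum thetae_diff; ring.
Qed.

(** A Ramanujan equation: the defect [Y] satisfies [Y(q) = 4 Y(- q ^ 2)], which
    forces all its coefficients to vanish. *)
Lemma D_thetae : D thetae = 2%:R * thetae ^+ 2 + 2%:R * thetaF * thetab.
Proof.
pose Y := D thetae - 2%:R * thetae ^+ 2 - 2%:R * thetaF * thetab.
have YE : Y = 4%:R * V 2 (neg Y).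
  have De : D thetae = 4%:R * V 2 (neg (D thetae)) + 2%:R * thetaF * (4%:R * thetae + thetab).
    by rewrite {1}thetae_rec DD !DM !D_nat DV // Dneg D_thetaF; ring.
  have -> : V 2 (neg Y) = V 2 (neg (D thetae)) - 2%:R * V 2 (neg thetae) ^+ 2 + 2%:R * thetaF ^+ 2.
    rewrite /Y !(rmorphXn, rmorphB, rmorphM, rmorph_nat) /= neg_thetaF neg_thetab thetaF_sqr.
    by rewrite !(rmorphXn, rmorphM, rmorphN) /=; ring.
  rewrite {1}/Y {1}De; move: (V 2 (neg (D thetae))) => De2.
  have := thetae_rec; move: (V 2 (neg thetae)) => e2; move: thetae => e ->; ring.
suff Y0 : Y = 0.
  by have : Y + 2%:R * thetae ^+ 2 + 2%:R * thetaF * thetab = D thetae by [rewrite /Y; ring]; rewrite Y0 add0r => <-.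
apply: fpsP => n; elim/ltn_ind: n => -[|n] IHn.
  by rewrite /Y !fcoefB fcoef_D fcoef0 mul0r !fcoef0M thetae0 thetaF0 !(mulr0, mul0r) !subr0.
rewrite YE fcoefZn fcoefV; case: ifP => [/dvdnP[m mE]|]; last by rewrite mulr0.
rewrite mE mulnK // fcoef_neg IHn ?mulr0 //; lia.
Qed.

(** Logarithmic derivative of [thetaF ^ 2 = (theta ^ 4 thetaF)(q ^ 2)]. *)
Lemma thetab_V2 : thetab - V 2 thetab = 8%:R * V 2 thetae - 4%:R * thetae.
Proof.
have F2 : thetaF ^+ 2 <> 0 by rewrite expr2; apply: mul_neq0; exact: thetaF_neq0.
suff H : thetaF ^+ 2 * (4%:R * thetae + thetab) = thetaF ^+ 2 * V 2 (8%:R * thetae + thetab).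
  have := fps_mulI F2 H; rewrite rmorphD rmorphM rmorph_nat /= => E.
  have -> : thetab - V 2 thetab = (4%:R * thetae + thetab) - V 2 thetab - 4%:R * thetae by ring.
  by rewrite E; ring.
apply: (fps_mulI (@nat_neq0 1)).
have := congr1 (@D _) thetaF_sqr; rewrite DX DV // DM DX D_theta D_thetaF /= => H.
transitivity (2%:R * thetaF * (thetaF * (4%:R * thetae + thetab))); first by ring.
rewrite -[2%:R * thetaF]/(2%:R * thetaF ^+ 1) H.
rewrite (_ : 4%:R * theta ^+ 3 * (theta * thetae) * thetaF + _ = theta ^+ 4 * thetaF * (8%:R * thetae + thetab)); last by ring.
by rewrite rmorphM /= -thetaF_sqr.
Qed.

End ThetaCalculus.

(** * Gauss's product for the alternating theta series *)

Section Gauss.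
Notation Q := (q ^+ 2 : fps int).

(** The Gaussian binomial coefficient in the variable [q ^ 2]. *)
Fixpoint gbin (N k : nat) : fps int :=
  match N, k with
  | _, 0 => 1
  | 0, _ => 0
  | N'.+1, k'.+1 => gbin N' k'.+1 + Q ^+ (N' - k') * gbin N' k'
  end.

Definition qfact (n : nat) : fps int := \prod_(k < n) (1 - Q ^+ k.+1).
Definition qodd (n : nat) : fps int := \prod_(k < n) (1 - q ^+ (2 * k + 1)).

Lemma gbin0 N : gbin N 0 = 1. Proof. by case: N. Qed.
Lemma gbin_gt N k : (N < k)%N -> gbin N k = 0.
Proof.
elim: N k => [|N IHN] [|k] //= Nk.
by rewrite !IHN ?mulr0 ?addr0 // ltnW.
Qed.

Lemma qfactS n : qfact n.+1 = qfact n * (1 - Q ^+ n.+1).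
Proof. by rewrite /qfact big_ord_recr. Qed.
Lemma qoddS n : qodd n.+1 = qodd n * (1 - q ^+ (2 * n + 1)).
Proof. by rewrite /qodd big_ord_recr. Qed.

Lemma oneB_qX0 k : (0 < k)%N -> (1 - q ^+ k : fps int) 0%N = 1.
Proof. by move=> k0; rewrite fcoefB fcoef1 fcoef_qX eq_sym (gtn_eqF k0) subr0. Qed.

Lemma qfact0 n : qfact n 0%N = 1.
Proof.
elim: n => [|n IHn]; first by rewrite /qfact big_ord0.
by rewrite qfactS fcoef0M IHn mul1r -exprM oneB_qX0.
Qed.

Lemma qfact_neq0 n : qfact n <> 0. Proof. by apply: (@fps_neq0 _ _ 0); rewrite qfact0. Qed.

Lemma gbin_fact N k : (k <= N)%N -> gbin N k * qfact k * qfact (N - k) = qfact N.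
Proof.
elim: N k => [|N IHN] [|k] kN //.
- by rewrite subn0 /qfact big_ord0 !mulr1.
- by rewrite gbin0 subn0 {1}/qfact big_ord0 !mul1r.
rewrite /= subSS mulrDl mulrDl.
have -> : Q ^+ (N - k) * gbin N k * qfact k.+1 * qfact (N - k) =
   Q ^+ (N - k) * (1 - Q ^+ k.+1) * qfact N.
  by rewrite qfactS -(IHN k) //; ring.
have -> : gbin N k.+1 * qfact k.+1 * qfact (N - k) = (1 - Q ^+ (N - k)) * qfact N.
  have [kN'|Nk] := ltnP k N; last first.
    by rewrite gbin_gt //; have -> : (N - k = 0)%N by [lia]; rewrite expr0; ring.
  have -> : (N - k = (N - k.+1).+1)%N by lia.
  by rewrite (qfactS (N - k.+1)) -(IHN k.+1) // ; ring.
rewrite qfactS; have -> : Q ^+ N.+1 = Q ^+ (N - k) * Q ^+ k.+1 by rewrite -exprD; congr (_ ^+ _); lia.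
ring.
Qed.

Lemma gbin_pascal N k : (k <= N)%N ->
  gbin N.+1 k.+1 = Q ^+ k.+1 * gbin N k.+1 + gbin N k.
Proof.
move=> kN; apply: (@fps_mulI _ (qfact k.+1 * qfact (N - k))).
  by apply: mul_neq0; exact: qfact_neq0.
have -> : qfact k.+1 * qfact (N - k) * gbin N.+1 k.+1 = qfact N.+1.
  by rewrite -(@gbin_fact N.+1 k.+1) // subSS; ring.
have -> : qfact k.+1 * qfact (N - k) * (Q ^+ k.+1 * gbin N k.+1 + gbin N k) =
   Q ^+ k.+1 * (gbin N k.+1 * qfact k.+1 * qfact (N - k)) + (1 - Q ^+ k.+1) * qfact N.
  by rewrite -(@gbin_fact N k) // qfactS; ring.
have -> : gbin N k.+1 * qfact k.+1 * qfact (N - k) = (1 - Q ^+ (N - k)) * qfact N.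
  have [kN'|Nk] := ltnP k N; last first.
    by rewrite gbin_gt //; have -> : (N - k = 0)%N by [lia]; rewrite expr0; ring.
  have -> : (N - k = (N - k.+1).+1)%N by lia.
  by rewrite (qfactS (N - k.+1)) -(@gbin_fact N k.+1) //; ring.
rewrite qfactS; have -> : Q ^+ N.+1 = Q ^+ (N - k) * Q ^+ k.+1 by rewrite -exprD; congr (_ ^+ _); lia.
ring.
Qed.

(** The finite form of the triple product at [z = -1]; the index is shifted by
    [N] to be a natural number. *)
Definition jsum (M N : nat) : fps int :=
  \sum_(i < (M + N).+1) (-1) ^+ (i + N) * q ^+ sqz (i%:Z - N%:Z) * gbin (M + N) i.

Lemma jsum_M M N : jsum M.+1 N = jsum M N * (1 - q ^+ (2 * M + 1)).
Proof.
have -> : jsum M.+1 N = jsum M N + \sum_(i < (M + N).+1) (-1) ^+ (i.+1 + N) *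
    q ^+ sqz (i.+1%:Z - N%:Z) * (Q ^+ (M + N - i) * gbin (M + N) i).
  rewrite {1}/jsum addSn big_ord_recl gbin0.
  under eq_bigr => i _ do rewrite /bump /= mulrDr.
  rewrite big_split /= addrA; congr (_ + _).
  by rewrite /jsum [RHS]big_ord_recl gbin0 [X in _ + X = _]big_ord_recr /= gbin_gt // mulr0 addr0.
rewrite mulrBr mulr1; congr (_ + _); rewrite /jsum mulr_suml -sumrN.
apply: eq_bigr => -[i /= il] _; rewrite -exprM.
have E : (sqz (i.+1%:Z - N%:Z) + 2 * (M + N - i) = sqz (i%:Z - N%:Z) + (2 * M + 1))%N.
  have : (sqz (i.+1%:Z - N%:Z))%:Z + 2 * (M + N - i)%N%:Z = (sqz (i%:Z - N%:Z))%:Z + (2 * M%:Z + 1).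
    rewrite !sqzE; have -> : (M + N - i)%N%:Z = M%:Z + N%:Z - i%:Z by lia.
    by rewrite intS; ring.
  lia.
have qq : q ^+ sqz (i.+1%:Z - N%:Z) * q ^+ (2 * (M + N - i)) =
    q ^+ sqz (i%:Z - N%:Z) * q ^+ (2 * M + 1) :> fps int by rewrite -!exprD E.
have -> : (-1) ^+ (i.+1 + N) = - (-1) ^+ (i + N) :> fps int by rewrite addSn exprS mulN1r.
transitivity (- (-1) ^+ (i + N) * (q ^+ sqz (i.+1%:Z - N%:Z) * q ^+ (2 * (M + N - i))) * gbin (M + N) i).
  ring.
by rewrite qq; ring.
Qed.

Lemma jsum_N M N : jsum M N.+1 = jsum M N * (1 - q ^+ (2 * N + 1)).
Proof.
have -> : jsum M N.+1 = jsum M N + \sum_(i < (M + N).+1) (-1) ^+ (i + N.+1) *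
    q ^+ sqz (i%:Z - N.+1%:Z) * (Q ^+ i * gbin (M + N) i).
  rewrite {1}/jsum addnS big_ord_recl gbin0.
  under eq_bigr => i _.
    rewrite /bump /= -/(gbin (M + N).+1 i.+1) gbin_pascal -1?ltnS // mulrDr.
    over.
  rewrite big_split /= addrA addrC; congr (_ + _).
    apply: eq_bigr => i _; congr (_ * _ * _).
      have -> : (bump 0 i + N.+1 = (i + N).+2)%N by rewrite /bump; lia.
      by rewrite 2!exprS mulrA mulrNN !mul1r.
    by congr (_ ^+ sqz _); rewrite /bump; lia.
  rewrite [X in _ + X]big_ord_recr /= gbin_gt // !mulr0 addr0.
  by rewrite [RHS]big_ord_recl gbin0 expr0 mul1r.
rewrite mulrBr mulr1; congr (_ + _); rewrite /jsum mulr_suml -sumrN.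
apply: eq_bigr => -[i /= il] _; rewrite -exprM.
have E : (sqz (i%:Z - N.+1%:Z) + 2 * i = sqz (i%:Z - N%:Z) + (2 * N + 1))%N.
  have : (sqz (i%:Z - N.+1%:Z))%:Z + 2 * i%:Z = (sqz (i%:Z - N%:Z))%:Z + (2 * N%:Z + 1).
    by rewrite !sqzE intS; ring.
  lia.
have qq : q ^+ sqz (i%:Z - N.+1%:Z) * q ^+ (2 * i) =
    q ^+ sqz (i%:Z - N%:Z) * q ^+ (2 * N + 1) :> fps int by rewrite -!exprD E.
have -> : (-1) ^+ (i + N.+1) = - (-1) ^+ (i + N) :> fps int by rewrite addnS exprS mulN1r.
transitivity (- (-1) ^+ (i + N) * (q ^+ sqz (i%:Z - N.+1%:Z) * q ^+ (2 * i)) * gbin (M + N) i).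
  ring.
by rewrite qq; ring.
Qed.

(** The finite sum gains one factor each time [M] or [N] grows, by the two Pascal
    rules. *)
Lemma jsumE M N : jsum M N = qodd M * qodd N.
Proof.
have J0 : jsum 0 0 = 1 by rewrite /jsum big_ord1 /= mulr1 mul1r.
elim: N => [|N IHN].
  elim: M => [|M IHM]; first by rewrite J0 /qodd !big_ord0 mulr1.
  by rewrite jsum_M IHM qoddS; ring.
by rewrite jsum_N IHN qoddS; ring.
Qed.

Lemma qfact_eqm m n : (m <= n)%N -> eqm (2 * m + 2) (qfact n) (qfact m).
Proof.
move=> mn; rewrite -(subnKC mn); elim: (n - m)%N => [|k IHk]; first by rewrite addn0.
rewrite [(m + k.+1)%N]addnS qfactS -[X in eqm _ _ X]mulr1; apply: eqmM IHk _.
rewrite -[X in eqm _ _ X]subr0; apply: eqmB => //; rewrite -exprM -[q ^+ _]mulr1.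
by apply: (@eqm_leq _ _ (2 * (m + k).+1)); [lia | exact: eqm0_qX].
Qed.

Lemma eqm_cancel N (a f g : fps int) : a 0%N = 1 -> eqm N (a * f) (a * g) -> eqm N f g.
Proof.
move=> a0 H; have [b [ab _]] := fps_inv a0.
have := eqmM (@eqm_refl _ N b) H.
by rewrite !mulrA ![b * a]mulrC ab !mul1r.
Qed.

Lemma gbin_eqm n i : (i <= 2 * n)%N ->
  eqm (2 * n + 1) (q ^+ sqz (i%:Z - n%:Z) * (gbin (2 * n) i * qfact (2 * n))) (q ^+ sqz (i%:Z - n%:Z)).
Proof.
move=> i2; pose d := absz (i%:Z - n%:Z).
have dn : (d <= n)%N by rewrite /d; lia.
pose m := (n - d)%N.
have H : eqm (2 * m + 2) (gbin (2 * n) i * qfact (2 * n)) 1.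
  apply: (@eqm_cancel _ (qfact m)); first exact: qfact0.
  have e1 : eqm (2 * m + 2) (qfact (2 * n)) (qfact m) by apply: qfact_eqm; rewrite /m; lia.
  have e2 : eqm (2 * m + 2) (qfact i) (qfact m) by apply: qfact_eqm; rewrite /m /d; lia.
  have e3 : eqm (2 * m + 2) (qfact (2 * n - i)) (qfact m) by apply: qfact_eqm; rewrite /m /d; lia.
  rewrite mulr1.
  have -> : qfact m * (gbin (2 * n) i * qfact (2 * n)) = gbin (2 * n) i * qfact (2 * n) * qfact m by ring.
  apply: (eqm_trans (g := gbin (2 * n) i * qfact i * qfact (2 * n - i))); last first.
    by rewrite gbin_fact.
  apply: eqmM; last exact: eqm_sym.
  by apply: eqmM => //; apply: eqm_trans e1 (eqm_sym e2).
rewrite -[X in eqm _ _ X]mulr1 -/d => k kn.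
rewrite !fcoefqXM; case: ifP => // dk; apply: H.
have -> : sqz (i%:Z - n%:Z) = (d ^ 2)%N by [].
by rewrite /m; nia.
Qed.

(** Gauss: [theta (- q) = \prod (1 - q ^ k) / (1 + q ^ k)].  This is the limit of
    [jsumE] for [M = N = n], where the Gaussian binomials become constant. *)
Lemma gauss_eqm n : eqm (2 * n + 1) (neg theta) (qfact (2 * n) * qodd n ^+ 2).
Proof.
apply: eqm_sym; apply: (@eqm_trans _ _ (\sum_(i < (2 * n).+1) (-1) ^+ (i + n) * q ^+ sqz (i%:Z - n%:Z))).
  rewrite expr2 -jsumE /jsum addnn -mul2n mulr_sumr; apply: eqm_sum => -[i /= il] _.
  rewrite [X in eqm _ X _](_ : _ = (-1) ^+ (i + n) *
    (q ^+ sqz (i%:Z - n%:Z) * (gbin (2 * n) i * qfact (2 * n)))); last by ring.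
  by apply: eqmM => //; apply: gbin_eqm.
move=> m mn; rewrite fcoef_neg theta.unlock /= fcoef_sum.
have sgn i : ((-1) ^+ (i + n) * q ^+ sqz (i%:Z - n%:Z) : fps int) m
    = (-1) ^+ m * (sqz (i%:Z - n%:Z) == m)%:R.
  have -> : (-1) ^+ (i + n) = fpsC ((-1) ^+ (i + n)) :> fps int by rewrite rmorphXn rmorphN1.
  rewrite fcoefCM fcoef_qX eq_sym; case: eqP => [<-|]; last by rewrite !mulr0.
  rewrite !mulr1 -signr_odd -[RHS]signr_odd; congr (_ ^+ _); congr nat_of_bool.
  by have := sqzE (i%:Z - n%:Z); rewrite /sqz oddX /=; lia.
rewrite (eq_bigr (fun i : 'I__ => (-1) ^+ m * (sqz ((i : nat)%:Z - n%:Z) == m)%:R)) => [|i _]; last exact: sgn.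
rewrite -mulr_sumr; congr (_ * _).
rewrite (@fsum_bij _ _ ([set i : nat | (i < (2 * n).+1)%N] `&` [set i : nat | sqz (i%:Z - n%:Z) = m]) _
   (fun i : nat => i%:Z - n%:Z) (fun x => absz (x + n%:Z)) _ (fun=> 1)) //.
- rewrite [RHS]fsbig_mkcondr -fsbig_ord; apply: eq_bigr => -[i /= _] _.
  have -> : (i \in [set i : nat | sqz (i%:Z - n%:Z) = m]) = (sqz (i%:Z - n%:Z) == m).
    by apply/idP/idP; rewrite inE => /eqP.
  by case: eqP.
- by move=> i [/= i1 i2]; split=> //; lia.
- move=> x /= xm; have xn : (absz x <= n)%N.
    rewrite leqNgt; apply/negP => nx.
    by move: xm; rewrite /sqz => H; nia.
  have E : (absz (x + n%:Z))%:Z - n%:Z = x by lia.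
  by split=> [|//]; split=> /=; [lia | rewrite E].
Qed.

End Gauss.

(** * Lambert series *)

(** The geometric series [q / (1 - q)]. *)
Definition geom : fps int := Fps (fun n => (0 < n)%N%:R).

Definition sigma (k n : nat) : int := \sum_(i < n) (i.+1 %| n)%N%:R * i.+1%:R ^+ k.

Definition lambert : fps int := Fps (sigma 1).

Lemma geomE : geom * (1 - q) = q.
Proof.
apply: fpsP => n; rewrite mulrBr mulr1 fcoefB mulrC fcoefqM fcoef_q /=.
by case: n => [|[|n]] //=; rewrite ?subr0 ?subrr.
Qed.

Lemma V_geomE k : V k.+1 geom * (1 - q ^+ k.+1) = q ^+ k.+1.
Proof.
by have := congr1 (V k.+1) geomE; rewrite rmorphM rmorphB rmorph1 /= V_q.
Qed.

Lemma fcoef_V_geom k n : V k.+1 geom n = ((0 < n)%N && (k.+1 %| n)%N)%:R.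
Proof.
rewrite fcoefV /=; case: ifP => [/dvdnP[m ->]|]; last by rewrite andbF.
by rewrite mulnK // muln_gt0 !andbT.
Qed.

Lemma V_geom_eqm k N : (N <= k)%N -> eqm N.+1 (V k.+1 geom) 0.
Proof.
move=> Nk n nN; rewrite fcoef_V_geom; case: n nN => [|n] nN //=.
by rewrite gtnNdvd //; lia.
Qed.

Definition lambert_trunc K : fps int := \sum_(k < K) k.+1%:R * V k.+1 geom.

Lemma lambert_truncS K : lambert_trunc K.+1 = lambert_trunc K + K.+1%:R * V K.+1 geom.
Proof. by rewrite /lambert_trunc big_ord_recr. Qed.

Lemma lambert_eqm K : eqm K.+1 (lambert_trunc K) lambert.
Proof.
have step m k : (m <= k)%N -> eqm m.+1 (lambert_trunc k) (lambert_trunc m).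
  move=> mk; rewrite -(subnKC mk); elim: (k - m)%N => [|d IHd]; first by rewrite addn0.
  rewrite addnS lambert_truncS -[X in eqm _ _ X]addr0; apply: eqmD => //.
  by rewrite -[X in eqm _ _ X](mulr0 (m + d).+1%:R); apply: eqmM => //; apply: V_geom_eqm; lia.
move=> n nK; rewrite (@step n K) // /lambert_trunc /= fcoef_sum; apply: eq_bigr => k _.
rewrite fcoefZn fcoef_V_geom expr1 mulrC; congr (_ * _).
by case: n nK k => [|n] nK k; [case: k | rewrite ltn0Sn].
Qed.

(** * Overpartitions *)

Section OverpartitionSeries.
Variables PB OB : nat -> fps int.
Hypotheses (PB0 : PB 0 = 1) (OB0 : OB 0 = 0).
Hypothesis PBS : forall K, (1 - q ^+ K.+1) * PB K.+1 = (1 + q ^+ K.+1) * PB K.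
Hypothesis OBS : forall K, (1 - q ^+ K.+1) * OB K.+1 =
  (1 + q ^+ K.+1) * OB K + (-1) ^+ K * K.+1%:R * q ^+ K.+1 * PB K.

Let unitB K : (1 - q ^+ K.+1 : fps int) <> 0.
Proof. by apply: (@fps_neq0 _ _ 0); rewrite oneB_qX0. Qed.


Let unitP K : (1 + q ^+ K.+1 : fps int) <> 0.
Proof. by apply: (@fps_neq0 _ _ 0); rewrite fcoefD fcoef1 fcoef_qX. Qed.

Lemma PB00 K : PB K 0%N = 1.
Proof.
elim: K => [|K IHK]; first by rewrite PB0.
have := congr1 (fun f : fps int => f 0%N) (PBS K).
have -> : ((1 + q ^+ K.+1) * PB K) 0%N = 1.
  by rewrite fcoef0M IHK mulr1 fcoefD fcoef1 fcoef_qX.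
by rewrite fcoef0M oneB_qX0 // mul1r.
Qed.

(** The product [\prod (1 + q ^ k) / (1 - q ^ k)] rewritten without denominators,
    using [1 + q ^ k = (1 - q ^ (2 k)) / (1 - q ^ k)]. *)
Lemma PB_prod n : PB (2 * n) * qfact n ^+ 2 * qodd n ^+ 2 = qfact (2 * n).
Proof.
pose A K : fps int := \prod_(k < K) (1 - q ^+ k.+1).
have PA K : PB K * A K ^+ 2 = qfact K.
  elim: K => [|K IHK]; first by rewrite PB0 /A /qfact !big_ord0 expr1n mulr1.
  rewrite qfactS -IHK /A big_ord_recr /= -/(A K).
  transitivity ((1 - q ^+ K.+1) * PB K.+1 * A K ^+ 2 * (1 - q ^+ K.+1)); first by ring.
  by rewrite PBS -exprM mulnC exprM; ring.
have AE m : A (2 * m)%N = qfact m * qodd m.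
  elim: m => [|m IHm]; first by rewrite muln0 /A /qfact /qodd !big_ord0 mulr1.
  have -> : (2 * m.+1 = (2 * m).+2)%N by lia.
  rewrite /A 2!big_ord_recr /= -/(A (2 * m)%N) IHm qfactS qoddS -exprM.
  have -> : (2 * m.+1 = (2 * m).+2)%N by lia.
  by rewrite addn1; ring.
by rewrite -(PA (2 * n)%N) AE; ring.
Qed.

Lemma PB_theta n : eqm (2 * n + 1) (PB (2 * n) * neg theta) 1.
Proof.
apply: (@eqm_cancel _ (qfact n ^+ 2)); first by rewrite fcoef0X qfact0 expr1n.
have le : (2 * n + 1 <= 2 * n + 2)%N by lia.
have e1 : eqm (2 * n + 1) (qfact (2 * n)) (qfact n).
  by apply: (eqm_leq le); apply: qfact_eqm; lia.
apply: (@eqm_trans _ _ (qfact n ^+ 2 * (PB (2 * n) * (qfact (2 * n) * qodd n ^+ 2)))).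
  by do 2!apply: eqmM => //; apply: gauss_eqm.
rewrite (_ : _ * _ = (PB (2 * n) * qfact n ^+ 2 * qodd n ^+ 2) * qfact (2 * n)); last by ring.
by rewrite PB_prod mulr1 expr2; apply: eqmM.
Qed.

Lemma D_PB K : D (PB K) = 2%:R * (lambert_trunc K - V 2 (lambert_trunc K)) * PB K.
Proof.
elim: K => [|K IHK].
  by rewrite PB0 D1 /lambert_trunc big_ord0 rmorph0 subrr mulr0 mul0r.
pose T := lambert_trunc K - V 2 (lambert_trunc K).
pose x := V K.+1 geom.
have xE : x * (1 - q ^+ K.+1) = q ^+ K.+1 := V_geomE K.
have x2E : V 2 x * (1 - q ^+ K.+1 ^+ 2) = q ^+ K.+1 ^+ 2.
  have E : V 2 (q ^+ K.+1) = q ^+ K.+1 ^+ 2 :> fps int by rewrite rmorphXn /= V_q // -!exprM mulnC.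
  by have := congr1 (V 2) xE; rewrite rmorphM rmorphB rmorph1 /= E.
rewrite lambert_truncS rmorphD rmorphM rmorph_nat /= -/x.
have -> : lambert_trunc K + K.+1%:R * x - (V 2 (lambert_trunc K) + K.+1%:R * V 2 x)
   = T + K.+1%:R * (x - V 2 x) by rewrite /T; ring.
have Dq k : D (q ^+ k : fps int) = k%:R * q ^+ k.
  rewrite DX D_q; case: k => [|k]; first by rewrite !mul0r.
  by rewrite /= exprS; ring.
have := congr1 (@D _) (PBS K); rewrite !DM IHK -/T DB DD D1 Dq => DE.
apply: (@fps_mulI _ ((1 - q ^+ K.+1) * (1 + q ^+ K.+1))); first exact: mul_neq0.
set Y := q ^+ K.+1 in xE x2E DE *; set k : fps int := K.+1%:R in DE *.
have P := PBS K; rewrite -/Y in P.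
have -> : (1 - Y) * (1 + Y) * D (PB K.+1) =
   (1 + Y) * ((0 - k * Y) * PB K.+1 + (1 - Y) * D (PB K.+1)) + (1 + Y) * (k * Y) * PB K.+1 by ring.
rewrite DE.
have -> : (1 - Y) * (1 + Y) * (2%:R * (T + k * (x - V 2 x)) * PB K.+1) =
  2%:R * T * (1 + Y) * ((1 - Y) * PB K.+1) + 2%:R * k * (x * (1 - Y) * (1 + Y) - V 2 x * (1 - Y ^+ 2)) * PB K.+1 by ring.
rewrite xE x2E.
have -> : (1 + Y) * ((0 + k * Y) * PB K + (1 + Y) * (2%:R * T * PB K)) + (1 + Y) * (k * Y) * PB K.+1
  = k * Y * ((1 + Y) * PB K) + 2%:R * T * (1 + Y) * ((1 + Y) * PB K) + (1 + Y) * (k * Y) * PB K.+1 by ring.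
by rewrite -P; ring.
Qed.

(** Logarithmic derivative of Gauss's product. *)
Lemma neg_thetae_lambert : neg thetae = - (2%:R * (lambert - V 2 lambert)).
Proof.
apply: eqm_eq_leq => N; exists (2 * N + 1)%N; first by lia.
have le : (2 * N + 1 <= (2 * N).+1)%N by lia.
set M := (2 * N + 1)%N in le *.
have Lt := eqm_leq le (@lambert_eqm (2 * N)).
have t0 : neg theta 0%N = 1 by rewrite neg0 theta0.
apply: (@eqm_cancel _ (PB (2 * N) * neg theta)).
  by rewrite fcoef0M PB00 t0 mul1r.
have VL : eqm M (V 2 (lambert_trunc (2 * N))) (V 2 lambert).
  move=> i iM; rewrite !fcoefV; case: ifP => // _; apply: Lt.
  exact: leq_ltn_trans (leq_div _ _) iM.
have H : eqm M (D (PB (2 * N)) * neg theta + PB (2 * N) * D (neg theta)) 0.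
  by rewrite -DM -D1; apply: eqm_D; apply: PB_theta.
rewrite D_PB D_neg_theta in H.
have -> : PB (2 * N) * neg theta * neg thetae =
  (2%:R * (lambert_trunc (2 * N) - V 2 (lambert_trunc (2 * N))) * PB (2 * N) * neg theta
    + PB (2 * N) * (neg theta * neg thetae))
  - 2%:R * (lambert_trunc (2 * N) - V 2 (lambert_trunc (2 * N))) * (PB (2 * N) * neg theta) by ring.
apply: eqm_trans (eqmB H (@eqm_refl _ _ _)) _.
rewrite sub0r -mulNr [X in eqm _ _ X]mulrC; apply: eqmM => //.
by apply: eqmN; apply: eqmM => //; apply: eqmB.
Qed.

(** The overlined part [k] contributes [q ^ k / (1 + q ^ k)], which is
    [V k geom - 2 V (2 k) geom]. *)
Definition osum_trunc K : fps int := \sum_(k < K) (-1) ^+ k * k.+1%:R * (V k.+1 geom - 2%:R * V 2 (V k.+1 geom)).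

Lemma OB_PB K : OB K = osum_trunc K * PB K.
Proof.
elim: K => [|K IHK]; first by rewrite OB0 /osum_trunc big_ord0 mul0r.
rewrite /osum_trunc big_ord_recr /= -/(osum_trunc K).
pose x := V K.+1 geom.
have xE : x * (1 - q ^+ K.+1) = q ^+ K.+1 := V_geomE K.
have x2E : V 2 x * (1 - q ^+ K.+1 ^+ 2) = q ^+ K.+1 ^+ 2.
  have E : V 2 (q ^+ K.+1) = q ^+ K.+1 ^+ 2 :> fps int by rewrite rmorphXn /= V_q // -!exprM mulnC.
  by have := congr1 (V 2) xE; rewrite rmorphM rmorphB rmorph1 /= E.
rewrite -/x; have P := PBS K; have O := OBS K; rewrite IHK in O.
set Y := q ^+ K.+1 in xE x2E P O *.
have hE : (x - 2%:R * V 2 x) * (1 + Y) = Y.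
  apply: (@fps_mulI _ (1 - Y)); first exact: unitB.
  transitivity (x * (1 - Y) * (1 + Y) - 2%:R * (V 2 x * (1 - Y ^+ 2))); first by ring.
  by rewrite xE x2E; ring.
apply: (@fps_mulI _ (1 - Y)); first exact: unitB.
rewrite O (_ : (1 - Y) * (_ * PB K.+1) = (osum_trunc K + (-1) ^+ K * K.+1%:R * (x - 2%:R * V 2 x)) * ((1 - Y) * PB K.+1)); last by ring.
rewrite P.
transitivity (osum_trunc K * (1 + Y) * PB K + (-1) ^+ K * K.+1%:R * ((x - 2%:R * V 2 x) * (1 + Y)) * PB K).
  by rewrite hE; ring.
ring.
Qed.

Definition osum : fps int := lambert - 6%:R * V 2 lambert + 8%:R * V 4 lambert.

Lemma osum_eqm M : eqm (2 * M + 1) (osum_trunc (2 * M)) osum.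
Proof.
pose L := lambert_trunc.
have osumE m : osum_trunc (2 * m) = (L (2 * m)%N - 2%:R * V 2 (L (2 * m)%N)) - 4%:R * V 2 (L m - 2%:R * V 2 (L m)).
  elim: m => [|m IHm].
    by rewrite muln0 /osum_trunc /L /lambert_trunc !big_ord0 !rmorphB !rmorph0 /=; ring.
  have -> : (2 * m.+1 = (2 * m).+2)%N by lia.
  rewrite /osum_trunc 2!big_ord_recr /= -/(osum_trunc _) IHm /L 3!lambert_truncS.
  rewrite !(rmorphB, rmorphD, rmorphM, rmorph_nat) /=.
  have sgn : (-1) ^+ (2 * m) = 1 :> fps int by rewrite exprM sqrrN expr1n expr1n.
  have sgn' : (-1) ^+ (2 * m).+1 = -1 :> fps int by rewrite exprS sgn mulr1.
  have VE : V (2 * m).+2 geom = V 2 (V m.+1 geom).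
    by rewrite V_comp //; congr (V _ _); lia.
  have nE : (2 * m).+2%:R = 2%:R * m.+1%:R :> fps int.
    by rewrite -natrM; congr (_%:R); lia.
  by rewrite sgn sgn' VE nE; ring.
rewrite osumE /osum.
have le : (2 * M + 1 <= (2 * M).+1)%N by lia.
have L1 := eqm_leq le (@lambert_eqm (2 * M)).
have VL r N f g : (0 < r)%N -> eqm N.+1 f g -> eqm (r * N + 1) (V r f : fps int) (V r g).
  move=> r0 fg i iM; rewrite !fcoefV; case: ifP => // /dvdnP[m mE]; apply: fg.
  by move: iM; rewrite mE mulnK //; nia.
have L2 : eqm (2 * M + 1) (V 2 (L (2 * M)%N)) (V 2 lambert).
  by apply: (@eqm_leq _ _ (2 * (2 * M) + 1)); [lia | apply: VL => //; apply: lambert_eqm].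
have L3 : eqm (2 * M + 1) (V 2 (L M)) (V 2 lambert).
  by apply: VL => //; apply: lambert_eqm.
have L4 : eqm (2 * M + 1) (V 4 (L M)) (V 4 lambert).
  by apply: (@eqm_leq _ _ (4 * M + 1)); [lia | apply: VL => //; apply: lambert_eqm].
rewrite rmorphB rmorphM rmorph_nat /= V_comp //.
have -> : lambert - 6%:R * V 2 lambert + 8%:R * V 4 lambert =
  (lambert - 2%:R * V 2 lambert) - 4%:R * (V 2 lambert - 2%:R * V 4 lambert) by ring.
apply: eqmB; [apply: eqmB => // | apply: eqmM => //; apply: eqmB => //];
  by apply: eqmM.
Qed.

(** Jacobi's four-square theorem at [- q]: [thetab_V2] and the Lambert series of
    the logarithmic derivative give [thetab - V 2 thetab], and a series is
    determined by this difference and its constant term. *)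
Lemma thetab_osum : thetab = 1 - 8%:R * osum.
Proof.
have eE : thetae = 2%:R * (lambert - V 2 lambert) - 8%:R * V 2 (lambert - V 2 lambert).
  have nE := neg_thetae_lambert.
  have := thetae_sum; rewrite nE => /eqP; rewrite subr_eq => /eqP ->.
  by rewrite rmorphN rmorphM rmorph_nat /=; ring.
have fix2 : V 2 (thetab + 8%:R * osum) = thetab + 8%:R * osum.
  have bE : V 2 thetab = thetab - (8%:R * V 2 thetae - 4%:R * thetae).
    by rewrite -thetab_V2; ring.
  rewrite rmorphD rmorphM rmorph_nat /= bE eE /osum !(rmorphB, rmorphD, rmorphM, rmorph_nat) /= !V_comp //=.
  by ring.
have := V_fixed _ fix2 => /(_ isT).
have -> : (thetab + 8%:R * osum) 0%N = 1.
  rewrite fcoefD fcoefZn thetab0 /osum fcoefD fcoefB !fcoefZn !V0.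
  have -> : lambert 0%N = 0 by rewrite /= /sigma big_ord0.
  by rewrite !(mulr0, subr0, addr0).
move=> E; have -> : thetab = (thetab + 8%:R * osum) - 8%:R * osum by ring.
by rewrite E; congr (_ - _); exact: rmorph1.
Qed.

Lemma OB_theta n : eqm (2 * n + 1) (8%:R * OB (2 * n) * neg theta) (1 - neg theta ^+ 4).
Proof.
rewrite -thetabX thetab_osum OB_PB.
have -> : 1 - (1 - 8%:R * osum) = 8%:R * osum * 1 by ring.
have -> : 8%:R * (osum_trunc (2 * n) * PB (2 * n)) * neg theta = 8%:R * osum_trunc (2 * n) * (PB (2 * n) * neg theta) by ring.
by apply: eqmM; [apply: eqmM => //; apply: osum_eqm | apply: PB_theta].
Qed.

Lemma thetaF_odd n : odd n -> thetaF n = sigma 1 n.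
Proof.
move=> no; have := congr1 (fun f : fps int => f n) thetae_diff.
have eE : thetae = neg (- (2%:R * (lambert - V 2 lambert))) by rewrite -neg_thetae_lambert negK.
rewrite fcoefB fcoefZn fcoef_neg -signr_odd no eE fcoef_neg -signr_odd no expr1 fcoefN fcoefZn.
rewrite fcoefB fcoefV; have -> : (2 %| n)%N = false by rewrite dvdn2 no.
by rewrite subr0 /=; lra.
Qed.

End OverpartitionSeries.

(** ** Enumeration of overpartitions by largest part *)

Section Enumeration.
Local Open Scope nat_scope.
Notation marked := (seq (nat * bool)).
Implicit Types s : marked.

Definition marks s : bool :=
  all (fun i => (nth (0, false) s i).2 ==> first_occurrence s i) (iota 0 (size s)).

(** Parts of size [K] may still be added in front of [s] without one of the old
    marks ceasing to be at a first occurrence. *)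
Definition unmarked K s : bool := all (fun p => p.2 ==> (p.1 != K)) s.

(** Overpartitions of any size with largest part at most [K]. *)
Definition bounded K s : bool :=
  [&& sorted geq (parts s), all (fun p => 0 < p) (parts s), all (fun p => p <= K) (parts s)
    & marks s].

Lemma marks_cons k b s : marks ((k, b) :: s) = marks s && unmarked k s.
Proof.
have -> : unmarked k s = all (fun i => (nth (0, false) s i).2 ==> (nth 0 (parts s) i != k)) (iota 0 (size s)).
  rewrite /unmarked -[s in all _ s](mkseq_nth (0, false)) /mkseq all_map.
  apply: eq_in_all => i; rewrite mem_iota => /andP[_ ilt] /=.
  by rewrite /parts /unzip1 (nth_map (0, false)).
rewrite /marks -all_predI /= implybT /= -[1]addn0 iotaDl all_map.
apply: eq_all => i /=; rewrite add1n /first_occurrence /= in_cons negb_or.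
by case: (nth _ s i).2 => //=; rewrite andbC.
Qed.

Lemma bounded_cons K k b s :
  bounded K ((k, b) :: s) = (0 < k <= K) && (bounded k s && unmarked k s).
Proof.
rewrite /bounded /= marks_cons path_sortedE; last by move=> x y z /= h1 h2; apply: leq_trans h2 h1.
have -> : all (geq k) (parts s) = all (fun p => p <= k) (parts s) by apply: eq_all.
have [k0|] := boolP (0 < k); last by rewrite !andbF.
have [kK|] := boolP (k <= K); last by rewrite !andbF.
rewrite /=; case le: (all (fun p => p <= k) (parts s)); last by rewrite !andbF.
have -> : all (fun p => p <= K) (parts s).
  by apply: sub_all le => p /leq_trans; apply.
by rewrite /= !andbA.
Qed.

Lemma bounded_unmarked K s : bounded K s -> unmarked K.+1 s.
Proof.
case/and4P=> _ _ + _; rewrite /parts all_map => /allP le; apply/allP => p /le /= pK.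
by apply/implyP => _; rewrite ltn_eqF.
Qed.


Fixpoint add_part (f : nat -> seq marked) (K fuel n : nat) : seq marked :=
  f n ++ (if fuel is fuel'.+1 then
            if K <= n then [seq (K, false) :: s | s <- add_part f K fuel' (n - K)] else [::]
          else [::]).

(** Enumeration by the number of parts equal to the bound: only the one in front
    may be overlined. *)
Fixpoint overps (K n : nat) : seq marked :=
  if K is K'.+1 then
    add_part (overps K') K n n ++
    (if K <= n then [seq (K, true) :: s | s <- add_part (overps K') K (n - K) (n - K)] else [::])
  else if n == 0 then [:: [::]] else [::].

Definition overps_unmarked K n := add_part (overps K) K.+1 n n.

Lemma add_part_fuel f K fuel n : n <= fuel -> add_part f K.+1 fuel n = add_part f K.+1 n n.
Proof.
elim/ltn_ind: n fuel => n IHn [|fuel]; first by case: n {IHn}.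
case: n IHn => [|n] IHn nf //=; congr (_ ++ _).
case: ifP => // Kn; congr map; rewrite IHn; try lia.
by rewrite [RHS]IHn //; lia.
Qed.

Lemma overps_unmarkedE K n : overps_unmarked K n = overps K n ++
  (if K.+1 <= n then [seq (K.+1, false) :: s | s <- overps_unmarked K (n - K.+1)] else [::]).
Proof.
rewrite /overps_unmarked; case: n => [|n] //=; congr (_ ++ _).
by case: ifP => // Kn; rewrite add_part_fuel //; lia.
Qed.

Lemma overpsS K n : overps K.+1 n = overps_unmarked K n ++
  (if K.+1 <= n then [seq (K.+1, true) :: s | s <- overps_unmarked K (n - K.+1)] else [::]).
Proof. by []. Qed.

Lemma mem_cons_map (p : nat * bool) (t : seq marked) s :
  (s \in [seq p :: u | u <- t]) = (if s is x :: u then (x == p) && (u \in t) else false).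
Proof.
case: s => [|x u]; first by apply/mapP => -[].
apply/mapP/andP => [[v vt [-> ->]] | [/eqP -> ut]]; first by rewrite eqxx.
by exists u.
Qed.

Lemma mem_overps K n s : (s \in overps K n) = bounded K s && (sumn (parts s) == n).
Proof.
elim: K n s => [|K IHK] n s.
  rewrite /=; case: n => [|n]; rewrite /=.
    rewrite inE; case: s => [|[k b] s] //=.
    by rewrite bounded_cons /=; case: k.
  by case: s => [|[k b] s] //; rewrite bounded_cons /=; case: k.
have memU m u : (u \in overps_unmarked K m) = [&& bounded K.+1 u, unmarked K.+1 u & sumn (parts u) == m].
  elim/ltn_ind: m u => m IHm u; rewrite overps_unmarkedE mem_cat IHK.
  have -> : (u \in if K < m then [seq (K.+1, false) :: s0 | s0 <- overps_unmarked K (m - K.+1)] else [::])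
    = (K < m) && (if u is x :: v then (x == (K.+1, false)) && (v \in overps_unmarked K (m - K.+1)) else false).
    by case: ifP => // _; rewrite mem_cons_map.
  case: u => [|[k b] v]; first by rewrite andbF orbF.
  rewrite !bounded_cons /= xpair_eqE.
  have [kK|kK|->] := ltngtP k K.+1; last 1 first.
  - rewrite ltnn /=; case: b => /=; first by rewrite !andbF.
    have [Km|mK] := ltnP K m; last first.
      rewrite /=; have -> : (K.+1 + sumn (parts v) == m) = false by apply/eqP; lia.
      by rewrite !andbF.
    rewrite IHm; last by lia.
    have -> : (sumn (parts v) == m - K.+1) = (K.+1 + sumn (parts v) == m) by apply/eqP/eqP; lia.
    by case: (bounded _ v); case: (unmarked _ v).
  - have -> : k <= K by lia.
    rewrite /= andbF orbF implybT /=; case: (0 < k) => //=.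
    case bv: (bounded k v) => //=; case uv: (unmarked k v) => //=.
    suff -> : unmarked K.+1 v by [].
    by apply: bounded_unmarked; case/and4P: bv => h1 h2 h3 h4; apply/and4P; split=> //;
       apply: sub_all h3 => p /leq_trans; apply; rewrite -ltnS.
  - have -> : (k <= K) = false by lia.
    by rewrite /= !andbF.
rewrite overpsS mem_cat memU.
have -> : (s \in if K < n then [seq (K.+1, true) :: s0 | s0 <- overps_unmarked K (n - K.+1)] else [::])
    = (K < n) && (if s is x :: v then (x == (K.+1, true)) && (v \in overps_unmarked K (n - K.+1)) else false).
  by case: ifP => // _; rewrite mem_cons_map.
case: s => [|[k b] v]; first by rewrite andbF orbF.
rewrite memU !bounded_cons /= xpair_eqE.
have [kK|kK|->] := ltngtP k K.+1; last 1 first.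
- rewrite /= ; case: b => /=.
    rewrite !andbF /=; have [Km|mK] := ltnP K n; last first.
      rewrite /=; have -> : (K.+1 + sumn (parts v) == n) = false by apply/eqP; lia.
      by rewrite !andbF.
    have -> : (sumn (parts v) == n - K.+1) = (K.+1 + sumn (parts v) == n) by apply/eqP/eqP; lia.
    by case: (bounded _ v); case: (unmarked _ v).
  by rewrite andbF orbF; case: (bounded _ v); case: (unmarked _ v).
- rewrite /= andbF orbF implybT /=.
  case: (0 < k) => //=; case bv: (bounded k v) => //=; case uv: (unmarked k v) => //=.
  suff -> : unmarked K.+1 v by [].
  by apply: bounded_unmarked; case/and4P: bv => h1 h2 h3 h4; apply/and4P; split=> //;
       apply: sub_all h3 => p /leq_trans; apply; rewrite -ltnS.
- by rewrite /= !andbF.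
Qed.

Lemma uniq_overps K n : uniq (overps K n).
Proof.
elim: K n => [|K IHK] n; first by rewrite /=; case: eqP.
have cinj p : injective (cons p : marked -> marked) by move=> s t [].
have uniqU m : uniq (overps_unmarked K m).
  elim/ltn_ind: m => m IHm; rewrite overps_unmarkedE cat_uniq IHK /=.
  case: ifP => Km; last by [].
  rewrite map_inj_uniq ?IHm ?andbT //; last by lia.
  apply/hasPn => u /=; rewrite mem_cons_map mem_overps; case: u => [|[k b] v] //.
  by case/andP=> /eqP[-> _] _; rewrite bounded_cons ltnn !andbF.
rewrite overpsS cat_uniq uniqU /=; case: ifP => Kn; last by [].
rewrite map_inj_uniq ?uniqU ?andbT //.
apply/hasPn => u /=; rewrite mem_cons_map (overps_unmarkedE K n) mem_cat mem_overps.
case: u => [|[k b] v] //; case/andP=> /eqP[-> ->] _; rewrite bounded_cons ltnn !andbF /=.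
by case: ifP => // _; rewrite mem_cons_map xpair_eqE /= andbF.
Qed.

End Enumeration.

Arguments overps : simpl never.

Definition oweight (s : seq (nat * bool)) : int :=
  (overlined_sum odd s)%:Z - (overlined_sum (fun p => ~~ odd p) s)%:Z.

Lemma oweight_cons k b s :
  oweight ((k.+1, b) :: s) = (if b then (-1) ^+ k * k.+1%:Z else 0) + oweight s.
Proof.
rewrite /oweight /overlined_sum !big_cons /= -signr_odd.
by case: b => /=; case: (odd k) => /=; rewrite ?PoszD; ring.
Qed.

Definition overp_series K : fps int := Fps (fun n => (size (overps K n))%:Z).
Definition osome_series K : fps int := Fps (fun n => \sum_(s <- overps K n) oweight s).

Lemma overp_series0 : overp_series 0 = 1.
Proof. by apply: fpsP => -[|n]. Qed.

Lemma osome_series0 : osome_series 0 = 0.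
Proof.
apply: fpsP => -[|n] /=; rewrite ?big_nil ?big_seq1 //.
by rewrite /oweight /overlined_sum !big_nil.
Qed.

Section Recurrences.
Variable K : nat.
Let Y : fps int := q ^+ K.+1.
Let PU : fps int := Fps (fun n => (size (overps_unmarked K n))%:Z).
Let OU : fps int := Fps (fun n => \sum_(s <- overps_unmarked K n) oweight s).

Let PUE : PU = overp_series K + Y * PU.
Proof.
apply: fpsP => n; rewrite fcoefD fcoefqXM /= overps_unmarkedE size_cat PoszD.
by case: ifP => _ //; rewrite size_map.
Qed.

Let PSE : overp_series K.+1 = PU + Y * PU.
Proof.
apply: fpsP => n; rewrite fcoefD fcoefqXM /= overpsS size_cat PoszD.
by case: ifP => _ //; rewrite size_map.
Qed.

Let OUE : OU = osome_series K + Y * OU.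
Proof.
apply: fpsP => n; rewrite fcoefD fcoefqXM /= overps_unmarkedE big_cat /=.
case: ifP => _; last by rewrite big_nil.
by rewrite big_map; congr (_ + _); apply: eq_bigr => s _; rewrite oweight_cons add0r.
Qed.

Let OSE : osome_series K.+1 = OU + Y * (OU + (-1) ^+ K * K.+1%:R * PU).
Proof.
have -> : (-1) ^+ K * K.+1%:R = fpsC ((-1) ^+ K * K.+1%:R) :> fps int.
  by rewrite rmorphM rmorphXn rmorphN1 rmorph_nat.
apply: fpsP => n; rewrite fcoefD fcoefqXM -[LHS]/(\sum_(s <- overps K.+1 n) oweight s) overpsS.
rewrite big_cat; congr (_ + _); case: ifP => _; last by rewrite big_nil.
rewrite big_map fcoefD fcoefCM.
rewrite (eq_bigr (fun s => (-1) ^+ K * K.+1%:Z + oweight s)) => [|s _]; last first.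
  by rewrite oweight_cons.
rewrite big_split /= addrC (natz K.+1); congr (_ + _).
by elim: (overps_unmarked K _) => [|u t IHt]; rewrite ?big_nil ?mulr0 // big_cons IHt /= intS; ring.
Qed.

(** The parts of size [K + 1] contribute the factor
    [(1 + q ^ (K + 1)) / (1 - q ^ (K + 1))]. *)
Lemma overp_seriesS : (1 - q ^+ K.+1) * overp_series K.+1 = (1 + q ^+ K.+1) * overp_series K.
Proof.
rewrite -/Y; have -> : overp_series K = PU - Y * PU by rewrite {1}PUE addrK.
by rewrite PSE; ring.
Qed.

(** The derivative, with respect to the weight of overlined parts, of the product
    formula. *)
Lemma osome_seriesS : (1 - q ^+ K.+1) * osome_series K.+1 =
  (1 + q ^+ K.+1) * osome_series K + (-1) ^+ K * K.+1%:R * q ^+ K.+1 * overp_series K.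
Proof.
rewrite -/Y; have -> : overp_series K = PU - Y * PU by rewrite {1}PUE addrK.
have -> : osome_series K = OU - Y * OU by rewrite {1}OUE addrK.
by rewrite OSE; ring.
Qed.

End Recurrences.

Lemma is_overpartitionE n s : is_overpartition n s = bounded n s && (sumn (parts s) == n).
Proof.
rewrite /is_overpartition /bounded -/(marks s).
have le : sumn (parts s) == n -> all (fun p => p <= n)%N (parts s).
  move=> /eqP <-; elim: (parts s) => //= x t IHt; rewrite leq_addr /=.
  by apply: sub_all IHt => p /leq_trans; apply; apply: leq_addl.
case sn: (sumn (parts s) == n); last by rewrite !andbF.
by rewrite le // !andbT.
Qed.

Lemma OSOME_series n : OSOME n = osome_series n n.
Proof.
have PoszS (P : pred (overpartition_codes n)) F : Posz (\sum_(c | P c) F c) = \sum_(c | P c) Posz (F c).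
  exact: (big_morph Posz PoszD).
rewrite /OSOME /OSOME_o /OSOME_e !PoszS -sumrB /=.
rewrite -(big_map (@decode n) (fun s => is_overpartition n s) oweight) -big_filter.
apply: perm_big; apply: uniq_perm; last 1 first.
- move=> s; rewrite mem_filter mem_overps is_overpartitionE.
  case ov: (bounded n s && (sumn (parts s) == n)) => //=; apply/mapP; rewrite -is_overpartitionE in ov.
  by have [c cs] := overpartition_code ov; exists c; rewrite ?mem_index_enum.
- by rewrite filter_uniq // map_inj_uniq ?index_enum_uniq //; apply: decode_inj.
- exact: uniq_overps.
Qed.

Lemma osome_stable n K : (n <= K)%N -> osome_series K n = OSOME n.
Proof.
move=> nK; rewrite OSOME_series -(subnKC nK); elim: (K - n)%N => [|d IHd]; first by rewrite addn0.
rewrite addnS -IHd /= overpsS overps_unmarkedE.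
by have -> : ((n + d).+1 <= n)%N = false by [lia]; rewrite !cats0.
Qed.

(** Multiplied by [theta(- q)], the series of [OSOME] becomes the Lambert series
    [osum], and Jacobi's theorem expresses it by [theta(- q) ^ 4]. *)
Lemma OSOME_theta : 8%:R * Fps OSOME * neg theta = 1 - neg theta ^+ 4.
Proof.
apply: eqm_eq_leq => N; exists (2 * N + 1)%N; first by lia.
apply: (@eqm_trans _ _ (8%:R * osome_series (2 * N) * neg theta)); last first.
  exact: (OB_theta overp_series0 osome_series0 overp_seriesS osome_seriesS).
apply: eqmM => //; apply: eqmM => // i iN.
by rewrite /= -(@osome_stable _ (2 * N)) //; lia.
Qed.

Lemma thetab_lambert : thetab = 1 - 8%:R * osum.
Proof. exact: (thetab_osum overp_series0 overp_seriesS). Qed.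

Lemma thetaF_sigma n : odd n -> thetaF n = sigma 1 n.
Proof. exact: (thetaF_odd overp_series0 overp_seriesS). Qed.

(** * The hypergeometric expansion of [theta ^ 2] *)

Definition itheta : fps int := sval (cid (fps_inv theta0)).

Lemma itheta_spec : theta * itheta = 1 /\ itheta 0%N = 1.
Proof. by rewrite /itheta; case: cid. Qed.

Lemma thetaV : theta * itheta = 1. Proof. by case: itheta_spec. Qed.

(** The modular function [t = thetaF / theta ^ 4], a Hauptmodul for the group
    [Gamma_0(4)]. *)
HB.lock Definition thetat : fps int := thetaF * itheta ^+ 4.

Lemma theta4_t : theta ^+ 4 * thetat = thetaF.
Proof.
rewrite thetat.unlock (_ : _ * _ = (theta * itheta) ^+ 4 * thetaF); last by ring.
by rewrite thetaV expr1n mul1r.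
Qed.

Lemma thetab_t : thetab = theta ^+ 4 * (1 - 16%:R * thetat).
Proof. by rewrite thetabE -theta4_t; ring. Qed.

Lemma thetat0 : thetat 0%N = 0.
Proof. by rewrite thetat.unlock fcoef0M thetaF0 mul0r. Qed.

Lemma D_itheta : D itheta = - (itheta * thetae).
Proof.
apply: (fps_mulI theta_neq0).
have := congr1 (@D _) thetaV; rewrite DM D1 D_theta => /eqP; rewrite addr_eq0 => /eqP E.
have -> : theta * D itheta = - (theta * thetae * itheta) by rewrite E opprK.
ring.
Qed.

Lemma D_thetat : D thetat = thetab * thetat.
Proof.
rewrite thetat.unlock DM DX D_itheta D_thetaF /=; ring.
Qed.

Definition cbin2 (n : nat) : nat := ('C(2 * n, n) ^ 2)%N.

Lemma cbin2S n : (n.+1 ^ 2 * cbin2 n.+1 = 4 * (2 * n + 1) ^ 2 * cbin2 n)%N.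
Proof.
have h1 := mul_bin_diag (2 * n).+2 n; have h2 := mul_bin_down (2 * n).+1 n.
rewrite /cbin2; have -> : (2 * n.+1 = (2 * n).+2)%N by lia.
rewrite /= in h1 h2; have s : ((2 * n).+1 - n = n.+1)%N by lia.
rewrite s in h2.
have E : (n.+1 * 'C((2 * n).+2, n.+1) = 2 * (2 * n + 1) * 'C(2 * n, n))%N.
  apply/eqP; rewrite -(eqn_pmul2l (ltn0Sn n)); apply/eqP.
  transitivity (n.+1 * ((2 * n).+2 * 'C((2 * n).+1, n)))%N; first by rewrite h1.
  transitivity ((2 * n).+2 * (n.+1 * 'C((2 * n).+1, n)))%N; first by ring.
  by rewrite -h2; have -> : ((2 * n).+2 = 2 * n.+1)%N by [lia]; have -> : ((2 * n).+1 = 2 * n + 1)%N by [lia]; ring.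
by rewrite -expnMn E; ring.
Qed.

Definition hyper N : fps int := \sum_(n < N) (cbin2 n)%:R * thetat ^+ n.

(** The Picard-Fuchs operator: it kills [theta ^ 2], and maps [t ^ n] to
    [thetab theta ^ 4] times a combination of [t ^ n] and [t ^ (n + 1)]. *)
Definition picard (y : fps int) : fps int :=
  D (D y) - 4%:R * thetae * D y - 4%:R * thetaF * thetab * y.

Lemma picardD y z : picard (y + z) = picard y + picard z.
Proof. by rewrite /picard !DD; ring. Qed.

Lemma picard_nat k y : picard (k%:R * y) = k%:R * picard y.
Proof. by rewrite /picard !(DM, DD, D_nat, D0); ring. Qed.

Lemma picard_theta2 : picard (theta ^+ 2) = 0.
Proof. by rewrite /picard !(DX, DM, D_theta, D_thetae, D_nat) /=; ring. Qed.

Lemma picard_t n : picard (thetat ^+ n) =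
  thetab * theta ^+ 4 * thetat ^+ n * ((n ^ 2)%N%:R - (4 * (2 * n + 1) ^ 2)%N%:R * thetat).
Proof.
have Dt : D (thetat ^+ n) = n%:R * thetab * thetat ^+ n.
  rewrite DX D_thetat; case: n => [|n]; first by rewrite !mul0r.
  by rewrite /= [thetat ^+ n.+1]exprS; ring.
have -> : (n ^ 2)%N%:R = n%:R ^+ 2 :> fps int by rewrite natrX.
have -> : (4 * (2 * n + 1) ^ 2)%N%:R = 4%:R * (2%:R * n%:R + 1) ^+ 2 :> fps int.
  by rewrite natrM natrX natrD natrM.
rewrite /picard Dt !DM D_nat Dt D_thetab.
have -> : neg thetae = thetae - 4%:R * thetaF by rewrite -thetae_diff; ring.
rewrite -theta4_t.
have -> : thetab * theta ^+ 4 * thetat ^+ n * (n%:R ^+ 2 - 4%:R * (2%:R * n%:R + 1) ^+ 2 * thetat)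
  = thetab * thetat ^+ n * (n%:R ^+ 2 * (theta ^+ 4 * (1 - 16%:R * thetat)) - 4%:R * (4%:R * n%:R + 1) * (theta ^+ 4 * thetat)).
  by ring.
rewrite -thetab_t; ring.
Qed.

Lemma hyperS N : hyper N.+1 = hyper N + (cbin2 N)%:R * thetat ^+ N.
Proof. by rewrite /hyper big_ord_recr. Qed.

Lemma picard_hyper N :
  picard (hyper N) = - (thetab * theta ^+ 4 * (N ^ 2 * cbin2 N)%N%:R * thetat ^+ N).
Proof.
elim: N => [|N IHN].
  by rewrite /hyper big_ord0 /picard !D0 mul0n; rewrite (_ : 0%N%:R = 0) // !(mulr0, mul0r, subr0, oppr0).
rewrite hyperS picardD picard_nat picard_t IHN cbin2S [thetat ^+ N.+1]exprS.
move: (4 * _ ^ 2)%N (N ^ 2)%N (cbin2 N) => a b c; rewrite [(a * c)%N%:R]natrM [(b * c)%N%:R]natrM; ring.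
Qed.

(** The difference of [theta ^ 2] and the truncated series is mapped by [picard] to a
    multiple of [t ^ N].  As the leading term [c q ^ n] of a series goes to
    [n ^ 2 c q ^ n], the difference vanishes up to that order. *)
Lemma theta2_hyper N : eqm N.+1 (theta ^+ 2) (hyper N.+1).
Proof.
pose R := theta ^+ 2 - hyper N.+1.
suff R0 n : (n <= N.+1)%N -> eqm n R 0.
  by move=> i iN; have := R0 _ (leqnn _) i iN; rewrite fcoefB fcoef0 => /eqP; rewrite subr_eq0 => /eqP.
elim: n => [|n IHn] nN; first by [].
have Rn := IHn (ltnW nN).
move=> i; rewrite ltnS leq_eqVlt => /orP[/eqP ->|]; last exact: Rn.
case: n IHn nN Rn {i} => [|n] _ nN Rn.
  rewrite fcoefB fcoef0X theta0 expr1n /hyper big_ord_recl fcoefD mulr1 -[cbin2 0]/1%N fcoef1 /=.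
  rewrite fcoef_sum big1 ?addr0 ?subrr // => j _.
  by rewrite fcoef0M fcoef0X thetat0 expr0n mulr0.
have [g gE] := eqm0P Rn.
have eE : exists e', thetae = q ^+ 1 * e' by apply: eqm0P => -[|//] _; rewrite thetae0.
have fE : exists f', thetaF = q ^+ 1 * f' by apply: eqm0P => -[|//] _; rewrite thetaF0.
have DRn : eqm n.+1 (D R) 0 by rewrite -(D0 _); apply: eqm_D.
have [h hE] := eqm0P DRn.
have : picard R = thetab * theta ^+ 4 * (N.+1 ^ 2 * cbin2 N.+1)%N%:R * thetat ^+ N.+1.
  rewrite /R -[- hyper N.+1]mulN1r -[-1]opprK (_ : - - -1 = - 1%:R); last by rewrite opprK.
  rewrite mulNr mul1r.
  have -> : picard (theta ^+ 2 - hyper N.+1) = picard (theta ^+ 2) - picard (hyper N.+1).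
    by rewrite /picard !(DD, DN); ring.
  by rewrite picard_theta2 picard_hyper sub0r opprK.
have tN : eqm N.+1 (thetab * theta ^+ 4 * (N.+1 ^ 2 * cbin2 N.+1)%N%:R * thetat ^+ N.+1) 0.
  rewrite -[X in eqm _ _ X](mulr0 (thetab * theta ^+ 4 * (N.+1 ^ 2 * cbin2 N.+1)%N%:R)).
  by apply: eqmM => //; apply: eqm0X; exact: thetat0.
move=> /(congr1 (fun f : fps int => f n.+1)); rewrite tN // /picard !fcoefB !fcoef_D.
have [e' eE'] := eE; have [f' fE'] := fE.
have -> : (4%:R * thetae * D R) n.+1 = 0.
  rewrite hE eE' (_ : _ * _ = q ^+ n.+2 * (4%:R * e' * h)); last by rewrite [in RHS]exprS; ring.
  by rewrite fcoefqXM ltnn.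
have -> : (4%:R * thetaF * thetab * R) n.+1 = 0.
  rewrite gE fE' (_ : _ * _ = q ^+ n.+2 * (4%:R * f' * thetab * g)); last by rewrite [in RHS]exprS; ring.
  by rewrite fcoefqXM ltnn.
(* what remains is [(n + 1) ^ 2] times the coefficient of [R] at [n + 1] *)
rewrite !subr0 mulrA => /eqP; rewrite mulf_eq0 mulf_eq0 orbb => /orP[|/eqP //].
by rewrite pnatr_eq0.
Qed.

(** * Reduction modulo a prime *)

Section Reduction.
Variable R : comNzRingType.

Definition fmap (f : fps int) : fps R := Fps (fun n => (f n)%:~R).

Lemma fcoef_fmap f n : fmap f n = (f n)%:~R. Proof. by []. Qed.

Fact fmap_is_zmod_morphism : zmod_morphism fmap.
Proof. by move=> f g; apply: fpsP => n; rewrite fcoef_fmap fcoefB rmorphB. Qed.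
Fact fmap_is_monoid_morphism : monoid_morphism fmap.
Proof.
split=> [|f g]; first by apply: fpsP => -[|n].
by apply: fpsP => n; rewrite /= rmorph_sum /=; apply: eq_bigr => i _; rewrite rmorphM.
Qed.
HB.instance Definition _ := GRing.isZmodMorphism.Build (fps int) (fps R) fmap fmap_is_zmod_morphism.
HB.instance Definition _ := GRing.isMonoidMorphism.Build (fps int) (fps R) fmap fmap_is_monoid_morphism.

Lemma fmap_V r f : fmap (V r f) = V r (fmap f).
Proof. by apply: fpsP => n /=; case: ifP; rewrite ?rmorph0. Qed.

Lemma fmap_D f : fmap (D f) = D (fmap f).
Proof. by apply: fpsP => n /=; rewrite rmorphM rmorph_nat. Qed.


Lemma fmap_eqm N f g : eqm N f g -> eqm N (fmap f) (fmap g).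
Proof. by move=> fg i iN; rewrite !fcoef_fmap fg. Qed.

Lemma fcoef_1qX n k : ((1 + q : fps R) ^+ n) k = 'C(n, k)%:R.
Proof.
elim: n k => [|n IHn] k; first by rewrite expr0 fcoef1 bin0n eq_sym; case: eqP.
rewrite exprS mulrDl mul1r fcoefD fcoefqM IHn; case: k => [|k]; first by rewrite !bin0 addr0.
by rewrite IHn binS natrD.
Qed.

End Reduction.

Section ModP.
Variable p : nat.
Hypothesis p_pr : prime p.
Local Notation red := (fmap 'F_p).

Let p_gt0 : (0 < p)%N. Proof. exact: prime_gt0. Qed.
Let pF := pchar_Fp p_pr.

Lemma pchar_fps : p \in [pchar fps 'F_p].
Proof.
rewrite inE p_pr /=; apply/eqP/fpsP => n.
by rewrite fcoef_nat fcoef0 -[p%:R]/(p%:R : 'F_p) (pcharf0 pF) mulr0.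
Qed.


Lemma fermat (c : 'F_p) : c ^+ p = c.
Proof. by rewrite -[c]natr_Zp; exact: (pFrobenius_aut_nat pF). Qed.

Lemma frobenius_sum I (r : seq I) (P : pred I) (F : I -> fps 'F_p) :
  (\sum_(i <- r | P i) F i) ^+ p = \sum_(i <- r | P i) F i ^+ p.
Proof. exact: (rmorph_sum (pFrobenius_aut pchar_fps)). Qed.

Lemma fps_trunc (R : comNzRingType) (f : fps R) N :
  eqm N f (\sum_(n < N) fpsC (f n) * q ^+ n).
Proof.
move=> i iN; rewrite fcoef_sum.
have E (j : nat) : (fpsC (f j) * q ^+ j) i = f j * (i == j)%:R by rewrite fcoefCM fcoef_qX.
under eq_bigr do rewrite E.
rewrite (bigD1 (Ordinal iN)) //= eqxx mulr1 big1 ?addr0 // => j ji.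
rewrite (_ : (i == j) = false) ?mulr0 //; apply: contraNF ji => /eqP ij.
by apply/eqP/val_inj.
Qed.

(** Raising to the [p]-th power is substituting [q ^ p] for [q], because it is
    additive, fixes the constants and maps [q] to [q ^ p]. *)
Lemma frobenius (f : fps 'F_p) : f ^+ p = V p f.
Proof.
apply: eqm_eq => N.
apply: (eqm_trans (eqmX p (fps_trunc f (N := N)))).
rewrite frobenius_sum => i iN; rewrite fcoef_sum fcoefV.
have E (n : 'I_N) : ((fpsC (f n) * q ^+ n) ^+ p) i = (i == n * p)%N%:R * f n.
  by rewrite exprMn -rmorphXn fermat -exprM fcoefCM fcoef_qX mulrC.
under eq_bigr do rewrite E.
case: ifP => [/dvdnP[m im]|pi].
  have mN : (m < N)%N by apply: leq_ltn_trans iN; rewrite im leq_pmulr.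
  rewrite (bigD1 (Ordinal mN)) //= im eqxx mul1r mulnK // big1 ?addr0 // => j jm.
  rewrite eqn_pmul2r // (negPf (_ : m != j)) ?mul0r //.
  by apply: contraNneq jm => mj; apply/eqP/val_inj.
rewrite big1 // => j _; case: eqP => [ij|]; last by rewrite mul0r.
by rewrite ij dvdn_mull in pi.
Qed.


(** Compare coefficients in [(1 + q) ^ (2 (p m + b)) = (1 + q ^ p) ^ (2 m) (1 + q) ^ (2 b)]:
    as [b < p], a single term on the right contributes. *)
Lemma bin_lucas m b : (b < p)%N ->
  'C(2 * (p * m + b), p * m + b)%:R = 'C(2 * m, m)%:R * 'C(2 * b, b)%:R :> 'F_p.
Proof.
move=> bp; set n := (p * m + b)%N.
rewrite -(fcoef_1qX 'F_p) (_ : 2 * n = 2 * m * p + 2 * b)%N; last by rewrite /n; ring.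
rewrite exprD exprM frobenius fcoefM.
have lt : (p * m < n.+1)%N by rewrite ltnS leq_addr.
rewrite (bigD1 (Ordinal lt)) // [nat_of_ord _]/= fcoefVM // fcoef_1qX fcoef_1qX {1}/n addKn.
rewrite -[RHS]addr0; congr (_ + _); apply: big1 => -[i /= il] iN.
case: ifP => [/dvdnP[j ij]|]; last by rewrite mul0r.
rewrite fcoef_1qX [X in _ * X]fcoef_1qX.
rewrite [X in _ * X%:R]bin_small ?mulr0 //.
have jm : (j < m)%N.
  rewrite ltn_neqAle; apply/andP; split.
    by apply: contraNneq iN => jm; apply/eqP/val_inj; rewrite /= ij jm mulnC.
  rewrite leqNgt; apply/negP => mj; move: (il); rewrite ij /n; nia.
by rewrite ij /n; nia.
Qed.

Lemma cbin2_lucas m b : (b < p)%N ->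
  (cbin2 (p * m + b))%:R = (cbin2 m)%:R * (cbin2 b)%:R :> 'F_p.
Proof. by move=> bp; rewrite /cbin2 !natrX bin_lucas // exprMn. Qed.

Lemma nat_fpsC (R : comNzRingType) n : n%:R = fpsC (n%:R : R). 
Proof. by rewrite rmorph_nat. Qed.

Local Notation t := (red thetat).
(** The hypergeometric polynomial that is the Hasse invariant modulo [p]. *)
Definition hyperp := \sum_(b < p) (cbin2 b)%:R * t ^+ b.

(** By the Lucas congruence each coefficient at [p m + b] is the product of those
    at [m] and [b]. *)
Lemma hyper_lucas N : red (hyper (N * p)) = hyperp * red (hyper N) ^+ p.
Proof.
have redh M : red (hyper M) = \sum_(n < M) (cbin2 n)%:R * t ^+ n.
  by rewrite rmorph_sum /=; apply: eq_bigr => i _; rewrite rmorphM rmorph_nat rmorphXn.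
rewrite !redh frobenius_sum mulrC mulr_suml.
rewrite -(big_mkord xpredT (fun n => (cbin2 n)%:R * t ^+ n)) big_nat_mul big_mkord.
apply: eq_bigr => m _.
rewrite -{1}[(m * p)%N]add0n mulSn big_addn addnK big_mkord mulr_sumr; apply: eq_bigr => b _.
have L : (cbin2 (p * m + b))%:R = (cbin2 m)%:R * (cbin2 b)%:R :> fps 'F_p.
  by rewrite !(nat_fpsC 'F_p) cbin2_lucas // rmorphM.
have F (c : nat) : c%:R ^+ p = c%:R :> fps 'F_p := pFrobenius_aut_nat pchar_fps c.
rewrite addnC [(m * p)%N]mulnC L exprD exprMn F -exprM [(m * p)%N]mulnC; ring.
Qed.

Local Notation th := (red theta).
Local Notation ith := (red itheta).

Lemma th_ith : th * ith = 1.
Proof. by rewrite -rmorphM thetaV rmorph1. Qed.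

(** In the limit [hyper_lucas] reads
    [theta ^ 2 = hyperp theta ^ (2 p)]. *)
Lemma hyperp_ith : ith ^+ (2 * p.-1) = hyperp.
Proof.
have E : th ^+ 2 = hyperp * th ^+ (2 * p).
  apply: eqm_eq => -[|N]; first by [].
  have H M : eqm M.+1 (th ^+ 2) (red (hyper M.+1)).
    by rewrite -rmorphXn; apply: fmap_eqm; apply: theta2_hyper.
  have pN : (N.+1 * p = (N.+1 * p).-1.+1)%N by rewrite prednK // muln_gt0.
  have H1 : eqm N.+1 (th ^+ 2) (red (hyper (N.+1 * p))).
    by rewrite pN; apply: eqm_leq (H _); rewrite -pN leq_pmulr.
  apply: (eqm_trans H1); rewrite hyper_lucas [th ^+ (2 * p)]exprM; apply: eqmM; first exact: eqm_refl.
  by apply: eqmX; apply/eqm_sym/H.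
have p1 : (2 * p = 2 + 2 * p.-1)%N by rewrite -{1}(prednK p_gt0) mulnS.
have := congr1 (fun f => f * ith ^+ (2 * p)) E.
rewrite -mulrA -exprMn th_ith expr1n mulr1 => <-.
by rewrite p1 exprD mulrA -exprMn th_ith expr1n mul1r.
Qed.

Local Notation b := (red thetab).

Lemma b_t : b = th ^+ 4 * (1 - 16%:R * t).
Proof. by rewrite thetab_t rmorphM rmorphXn rmorphB rmorph1 rmorphM rmorph_nat. Qed.

Lemma sigma_widen k n N : (0 < n <= N)%N ->
  sigma k n = \sum_(i < N) (i.+1 %| n)%N%:R * i.+1%:R ^+ k.
Proof.
case/andP=> n0 /subnKC <-; rewrite big_split_ord /= [X in _ = _ + X]big1 ?addr0 // => i _.
by rewrite gtnNdvd ?mul0r // ltnS leq_addr.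
Qed.

(** A divisor of [p n] that is not divisible by [p] divides [n]. *)
Lemma sigma_pM n : (sigma 1 (p * n))%:~R = (sigma 1 n)%:~R :> 'F_p.
Proof.
case: n => [|n]; first by rewrite muln0.
rewrite (@sigma_widen 1 n.+1 (p * n.+1)) ?leq_pmull // /sigma !rmorph_sum /=.
apply: eq_bigr => i _; rewrite !rmorphM !rmorph_nat /=.
have [pi|pi] := boolP (p %| i.+1)%N; last by rewrite Gauss_dvdr // coprime_sym prime_coprime.
by move: pi; rewrite (dvdn_pcharf pF) => /eqP ->; rewrite !mulr0.
Qed.

Lemma U_lambert : U p (red lambert) = red lambert.
Proof. by apply: fpsP => n; rewrite fcoefU !fcoef_fmap sigma_pM. Qed.

Lemma U_V_coprime (R : comNzRingType) r s (f : fps R) : coprime r s -> (0 < s)%N ->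
  U r (V s f) = V s (U r f).
Proof.
move=> rs s0; apply: fpsP => n; rewrite fcoefU !fcoefV Gauss_dvdr 1?coprime_sym //.
by case: ifP => // /dvdnP[k ->]; rewrite mulnA !mulnK.
Qed.

Lemma U_nat (R : comNzRingType) r k : (0 < r)%N -> U r (k%:R : fps R) = k%:R.
Proof. by move=> r0; apply: fpsP => n; rewrite fcoefU !fcoef_nat muln_eq0 gtn_eqF. Qed.

Lemma U_Zn (R : comNzRingType) r k (f : fps R) : U r (k%:R * f) = k%:R * U r f.
Proof. by apply: fpsP => n; rewrite fcoefU !fcoefZn. Qed.

Lemma U_N (R : comNzRingType) r (f : fps R) : U r (- f) = - U r f.
Proof. by apply: fpsP. Qed.

(** By Jacobi's theorem, and [sigma_pM]. *)
Lemma U_b : odd p -> U p b = b.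
Proof.
move=> p_odd; have c2 : coprime p 2 by rewrite coprimen2.
have c4 : coprime p 4 by rewrite -[4%N]/(2 * 2)%N coprimeMr c2.
have -> : b = 1%:R - 8%:R * (red lambert - 6%:R * V 2 (red lambert) + 8%:R * V 4 (red lambert)).
  by rewrite thetab_lambert /osum rmorphB rmorph1 rmorphM rmorph_nat rmorphD rmorphB rmorphM rmorph_nat rmorphM rmorph_nat /= !fmap_V.
by rewrite !(UD, U_N, U_Zn, U_V_coprime) // U_lambert U_nat.
Qed.

(** For [i] prime to [p] the series [b t ^ i] is a derivative divided by [i], so its
    coefficients at multiples of [p] vanish; for [i = p j] the factor
    [t ^ i = V p (t ^ j)] can be taken out. *)
Lemma U_bt i : odd p -> U p (b * t ^+ i) = if (p %| i)%N then b * t ^+ (i %/ p) else 0.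
Proof.
move=> p_odd; case: ifP => [/dvdnP[j ->]|pi].
  by rewrite exprM frobenius UM_V // U_b // mulnK.
have E : D (t ^+ i) = i%:R * b * t ^+ i.
  rewrite -rmorphXn -fmap_D DX D_thetat; case: i pi => [|i] _.
    by rewrite !mul0r rmorph0.
  by rewrite /= !rmorphM !rmorphXn rmorph_nat exprSr; ring.
apply: fpsP => n; rewrite fcoefU fcoef0.
have := congr1 (fun f : fps 'F_p => f (p * n)%N) E.
rewrite fcoef_D natrM (pcharf0 pF) !mul0r -mulrA fcoefZn => /esym/eqP.
by rewrite mulf_eq0 -(dvdn_pcharf pF) pi => /eqP.
Qed.

Lemma U_sum (R : comNzRingType) r n (F : 'I_n -> fps R) :
  U r (\sum_(i < n) F i) = \sum_(i < n) U r (F i).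
Proof. by apply: fpsP => k; rewrite fcoefU !fcoef_sum. Qed.

(** A polynomial in [t] by its coefficients, in Horner form so that identities
    between explicit polynomials unfold to ring equations. *)
Definition tpoly (s : seq nat) : fps 'F_p := foldr (fun a f => a%:R + t * f) 0 s.

Lemma tpoly_sum s : tpoly s = \sum_(i < size s) (nth 0%N s i)%:R * t ^+ i.
Proof.
elim: s => [|a s IHs]; first by rewrite big_ord0.
rewrite big_ord_recl /= IHs expr0 mulr1 mulr_sumr; congr (_ + _).
by apply: eq_bigr => i _; rewrite /bump /= exprS mulrCA.
Qed.

Lemma hyperp_tpoly :
  hyperp = tpoly [seq (('C(2 * b, b) %% p) ^ 2 %% p)%N | b <- iota 0 p].
Proof.
rewrite tpoly_sum size_map size_iota; apply: eq_bigr => i _.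
rewrite (nth_map 0%N) ?size_iota // nth_iota // add0n !(nat_fpsC 'F_p) Fp_nat_mod // natrX.
by rewrite Fp_nat_mod // -natrX.
Qed.

Lemma pchar_eq (f g h : fps 'F_p) : f = g + p%:R * h -> f = g.
Proof. by rewrite (pcharf0 pchar_fps) mul0r addr0. Qed.

(** The hypothesis on exponents says that
    [1 / theta = thetab (1 - 16 t) ^ (p - 1) hyperp ^ r c ^ p] with
    [c = theta ^ (k - 4) / (1 - 16 t)]; here [A] plays the role of
    [(1 - 16 t) ^ (p - 1)].  Then [c ^ p = V p c] is taken out of [U p], and
    [U_bt] computes what is left. *)
Lemma U_itheta k r A s : odd p ->
    (5 + k * p = 2 * r * p.-1 + 4 * p)%N ->
    A * (1 - 16%:R * t) = 1 - 16%:R * t ^+ p -> A * hyperp ^+ r = tpoly s ->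
  U p ith = th ^+ k * \sum_(i < size s | (p %| i)%N) (nth 0%N s i)%:R * t ^+ (i %/ p).
Proof.
move=> p_odd kr A_geom As.
have u0 : (1 - 16%:R * t) 0%N = 1.
  by rewrite fcoefB fcoef1 fcoefZn fcoef_fmap thetat0 mulr0 subr0.
have [u [uE _]] := fps_inv u0.
have F16 : 16%:R ^+ p = 16%:R :> fps 'F_p := pFrobenius_aut_nat pchar_fps 16.
have Ap : A * (1 - 16%:R * t) = (1 - 16%:R * t) ^+ p.
  rewrite A_geom; have := rmorphB (pFrobenius_aut pchar_fps) 1 (16%:R * t).
  by rewrite /= !pFrobenius_autE expr1n exprMn F16 => ->.
set c := th ^+ k * ith ^+ 4 * u.
have iE : ith = b * tpoly s * V p c.
  rewrite -frobenius -As b_t -hyperp_ith.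
  have -> : th ^+ 4 * (1 - 16%:R * t) * (A * (ith ^+ (2 * p.-1)) ^+ r) * c ^+ p =
     (A * (1 - 16%:R * t)) * u ^+ p * (th ^+ 4 * (ith ^+ (2 * p.-1)) ^+ r * (th ^+ k * ith ^+ 4) ^+ p).
    by rewrite /c exprMn; ring.
  rewrite Ap -exprMn uE expr1n mul1r.
  have thn n : th ^+ n * ith ^+ n = 1 by rewrite -exprMn th_ith expr1n.
  have -> : th ^+ 4 * (ith ^+ (2 * p.-1)) ^+ r * (th ^+ k * ith ^+ 4) ^+ p
    = th ^+ (4 + k * p) * ith ^+ (2 * r * p.-1 + 4 * p).
    rewrite exprMn -!exprM !exprD (_ : 2 * p.-1 * r = 2 * r * p.-1)%N; first by ring.
    by ring.
  by rewrite -kr -addn1 -[(5 + _)%N]/(4 + k * p).+1 exprSr mulrA thn mul1r.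
rewrite {1}iE UM_V // tpoly_sum mulr_sumr U_sum.
have -> : \sum_(i < size s) U p (b * ((nth 0%N s i)%:R * t ^+ i)) =
   b * \sum_(i < size s | (p %| i)%N) (nth 0%N s i)%:R * t ^+ (i %/ p).
  rewrite mulr_sumr [RHS]big_mkcond; apply: eq_bigr => i _.
  by rewrite mulrCA U_Zn U_bt //; case: ifP => _; rewrite ?mulr0 // mulrCA.
rewrite b_t /c.
transitivity ((th * ith) ^+ 4 * ((1 - 16%:R * t) * u) * th ^+ k * \sum_(i < size s | (p %| i)%N) (nth 0%N s i)%:R * t ^+ (i %/ p)); first by ring.
by rewrite th_ith uE expr1n !mul1r.
Qed.

End ModP.

Lemma mulr_cube (R : pzRingType) (a h b c d : R) :
  a * h = b -> b * h = c -> c * h = d -> a * h ^+ 3 = d.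
Proof. by move=> ab bc cd; rewrite exprS expr2 !mulrA ab bc cd. Qed.

(** In this and the following three lemmas the first list is the expansion of
    [(1 - 16 t) ^ (p - 1)], the geometric series in [16 t]; the next ones are its
    products with powers of [hyperp], with coefficients reduced modulo [p]. *)
Lemma U_itheta3 : U 3 (fmap 'F_3 itheta) = fmap 'F_3 (theta ^+ 5).
Proof.
have A_geom : tpoly 3 [:: 1; 1; 1] * (1 - 16%:R * fmap 'F_3 thetat) = 1 - 16%:R * fmap 'F_3 thetat ^+ 3.
  apply: (@pchar_eq 3 isT _ _ (- tpoly 3 [:: 0; 5; 5; 0])); rewrite /tpoly /=; ring.
have HE : hyperp 3 = tpoly 3 [:: 1; 1].
  by rewrite (@hyperp_tpoly 3 isT) (_ : map _ _ = [:: 1; 1; 0]) //; rewrite /tpoly /=; ring.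
have E1 : tpoly 3 [:: 1; 1; 1] * hyperp 3 = tpoly 3 [:: 1; 2; 2; 1].
  by rewrite HE; apply: (@pchar_eq 3 isT _ _ (tpoly 3 [:: 0; 0; 0; 0])); rewrite /tpoly /=; ring.
have E2 : tpoly 3 [:: 1; 2; 2; 1] * hyperp 3 = tpoly 3 [:: 1; 0; 1; 0; 1].
  by rewrite HE; apply: (@pchar_eq 3 isT _ _ (tpoly 3 [:: 0; 1; 1; 1; 0])); rewrite /tpoly /=; ring.
have As : tpoly 3 [:: 1; 1; 1] * hyperp 3 ^+ 2 = tpoly 3 [:: 1; 0; 1; 0; 1] by rewrite expr2 mulrA E1 E2.
rewrite (@U_itheta 3 isT 5 2 _ _ isT _ A_geom As) //.
rewrite -(big_mkord (fun i => 3 %| i)%N (fun i => (nth 0%N _ i)%:R * _ ^+ (i %/ 3))) -big_filter.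
rewrite (_ : filter _ _ = [:: 0; 3]%N) // !big_cons big_nil !divnn ?div0n /=.
rewrite rmorphXn /=; ring.
Qed.

Lemma U_itheta5 : U 5 (fmap 'F_5 itheta) = fmap 'F_5 (theta ^+ 3).
Proof.
have A_geom : tpoly 5 [:: 1; 1; 1; 1; 1] * (1 - 16%:R * fmap 'F_5 thetat) = 1 - 16%:R * fmap 'F_5 thetat ^+ 5.
  apply: (@pchar_eq 5 isT _ _ (- tpoly 5 [:: 0; 3; 3; 3; 3; 0])); rewrite /tpoly /=; ring.
have As : tpoly 5 [:: 1; 1; 1; 1; 1] * hyperp 5 ^+ 0 = tpoly 5 [:: 1; 1; 1; 1; 1] by rewrite expr0 mulr1.
rewrite (@U_itheta 5 isT 3 0 _ _ isT _ A_geom As) //.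
rewrite -(big_mkord (fun i => 5 %| i)%N (fun i => (nth 0%N _ i)%:R * _ ^+ (i %/ 5))) -big_filter.
rewrite (_ : filter _ _ = [:: 0]%N) // !big_cons big_nil ?divnn ?div0n /=.
rewrite rmorphXn /=; ring.
Qed.

Lemma U_itheta7 : U 7 (fmap 'F_7 itheta) = fmap 'F_7 (theta ^+ 5 + 3%:R * theta * thetaF).
Proof.
have A_geom : tpoly 7 [:: 1; 2; 4; 1; 2; 4; 1] * (1 - 16%:R * fmap 'F_7 thetat) = 1 - 16%:R * fmap 'F_7 thetat ^+ 7.
  apply: (@pchar_eq 7 isT _ _ (- tpoly 7 [:: 0; 2; 4; 9; 2; 4; 9; 0])); rewrite /tpoly /=; ring.
have HE : hyperp 7 = tpoly 7 [:: 1; 4; 1; 1].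
  by rewrite (@hyperp_tpoly 7 isT) (_ : map _ _ = [:: 1; 4; 1; 1; 0; 0; 0]) //; rewrite /tpoly /=; ring.
have E1 : tpoly 7 [:: 1; 2; 4; 1; 2; 4; 1] * hyperp 7 = tpoly 7 [:: 1; 6; 6; 6; 5; 3; 6; 3; 5; 1].
  by rewrite HE; apply: (@pchar_eq 7 isT _ _ (tpoly 7 [:: 0; 0; 1; 2; 1; 2; 2; 1; 0; 0])); rewrite /tpoly /=; ring.
have As : tpoly 7 [:: 1; 2; 4; 1; 2; 4; 1] * hyperp 7 ^+ 1 = tpoly 7 [:: 1; 6; 6; 6; 5; 3; 6; 3; 5; 1] by rewrite expr1 E1.
rewrite (@U_itheta 7 isT 5 1 _ _ isT _ A_geom As) //.
rewrite -(big_mkord (fun i => 7 %| i)%N (fun i => (nth 0%N _ i)%:R * _ ^+ (i %/ 7))) -big_filter.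
rewrite (_ : filter _ _ = [:: 0; 7]%N) // !big_cons big_nil !divnn ?div0n /=.
rewrite -theta4_t !(rmorphD, rmorphM, rmorphXn, rmorph_nat) /=; ring.
Qed.

Lemma U_itheta11 : U 11 (fmap 'F_11 itheta) = fmap 'F_11 (theta ^+ 9 + theta ^+ 5 * thetaF).
Proof.
have A_geom : tpoly 11 [:: 1; 5; 3; 4; 9; 1; 5; 3; 4; 9; 1] * (1 - 16%:R * fmap 'F_11 thetat) = 1 - 16%:R * fmap 'F_11 thetat ^+ 11.
  apply: (@pchar_eq 11 isT _ _ (- tpoly 11 [:: 0; 1; 7; 4; 5; 13; 1; 7; 4; 5; 13; 0])); rewrite /tpoly /=; ring.
have HE : hyperp 11 = tpoly 11 [:: 1; 4; 3; 4; 5; 1].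
  by rewrite (@hyperp_tpoly 11 isT) (_ : map _ _ = [:: 1; 4; 3; 4; 5; 1; 0; 0; 0; 0; 0]) //; rewrite /tpoly /=; ring.
have E1 : tpoly 11 [:: 1; 5; 3; 4; 9; 1; 5; 3; 4; 9; 1] * hyperp 11 = tpoly 11 [:: 1; 9; 4; 2; 4; 10; 6; 8; 7; 2; 10; 1; 7; 9; 3; 1].
  by rewrite HE; apply: (@pchar_eq 11 isT _ _ (tpoly 11 [:: 0; 0; 2; 3; 5; 7; 6; 7; 7; 6; 7; 6; 5; 4; 1; 0])); rewrite /tpoly /=; ring.
have E2 : tpoly 11 [:: 1; 9; 4; 2; 4; 10; 6; 8; 7; 2; 10; 1; 7; 9; 3; 1] * hyperp 11 = tpoly 11 [:: 1; 2; 10; 5; 10; 6; 7; 4; 9; 0; 1; 0; 4; 9; 6; 6; 8; 1; 6; 8; 1].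
  by rewrite HE; apply: (@pchar_eq 11 isT _ _ (tpoly 11 [:: 0; 1; 3; 4; 5; 8; 8; 8; 10; 12; 10; 11; 8; 8; 10; 7; 7; 6; 2; 0; 0])); rewrite /tpoly /=; ring.
have E3 : tpoly 11 [:: 1; 2; 10; 5; 10; 6; 7; 4; 9; 0; 1; 0; 4; 9; 6; 6; 8; 1; 6; 8; 1] * hyperp 11 = tpoly 11 [:: 1; 6; 10; 0; 7; 2; 1; 4; 4; 6; 8; 1; 1; 5; 4; 8; 7; 3; 9; 4; 2; 10; 0; 6; 2; 1].
  by rewrite HE; apply: (@pchar_eq 11 isT _ _ (tpoly 11 [:: 0; 0; 1; 5; 6; 10; 12; 11; 11; 10; 7; 6; 5; 3; 5; 6; 9; 11; 8; 9; 9; 5; 6; 4; 1; 0])); rewrite /tpoly /=; ring.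
have As : tpoly 11 [:: 1; 5; 3; 4; 9; 1; 5; 3; 4; 9; 1] * hyperp 11 ^+ 3 = tpoly 11 [:: 1; 6; 10; 0; 7; 2; 1; 4; 4; 6; 8; 1; 1; 5; 4; 8; 7; 3; 9; 4; 2; 10; 0; 6; 2; 1] by exact: mulr_cube E1 E2 E3.
rewrite (@U_itheta 11 isT 9 3 _ _ isT _ A_geom As) //.
rewrite -(big_mkord (fun i => 11 %| i)%N (fun i => (nth 0%N _ i)%:R * _ ^+ (i %/ 11))) -big_filter.
rewrite (_ : filter _ _ = [:: 0; 11; 22]%N) // !big_cons big_nil !divnn ?div0n /=.
rewrite -theta4_t rmorphD rmorphXn rmorphM rmorphXn rmorphM rmorphXn /=.
move: (fmap 'F_11 theta) (fmap 'F_11 thetat) => x y; ring.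
Qed.

(** * Divisor sums *)

Lemma big_ord_parity (A : nmodType) (F : nat -> A) K :
  \sum_(k < 2 * K) F k = \sum_(i < K) F (2 * i)%N + \sum_(i < K) F (2 * i).+1.
Proof.
elim: K => [|K IHK]; first by rewrite muln0 !big_ord0 addr0.
have -> : (2 * K.+1 = (2 * K).+2)%N by lia.
rewrite 2!big_ord_recr /= IHK [in RHS]big_ord_recr [X in _ = _ + X]big_ord_recr /=.
by rewrite -!addrA; congr (_ + _); rewrite addrCA; congr (_ + _); rewrite addrCA.
Qed.

(** Summation along the parallels to the diagonal. *)
Lemma big_ord_triangle (A : nmodType) (G : nat -> nat -> A) K :
  \sum_(i < K) \sum_(j < i) G i j = \sum_(k < K) \sum_(j < K - k.+1) G (j + k.+1)%N j.
Proof.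
elim: K => [|K IHK]; first by rewrite !big_ord0.
rewrite big_ord_recr /= IHK [in RHS]big_ord_recr /= subnn big_ord0 addr0.
rewrite [X in _ + X = _](reindex_inj rev_ord_inj) /= -big_split /=; apply: eq_bigr => k _.
have -> : (K.+1 - k.+1 = (K - k.+1).+1)%N by have := ltn_ord k; lia.
rewrite big_ord_recr /=; congr (_ + G _ _); have := ltn_ord k; lia.
Qed.

Lemma big_ord_sym (A : comNzRingType) (H : nat -> nat -> A) K :
  (forall i j, H i j = H j i) ->
  \sum_(i < K) \sum_(j < K) H i j = \sum_(i < K) H i i + 2%:R * \sum_(i < K) \sum_(j < i) H i j.
Proof.
move=> symH; elim: K => [|K IHK]; first by rewrite !big_ord0 mulr0 addr0.
rewrite !big_ord_recr /=; under eq_bigr do rewrite big_ord_recr /=.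
rewrite big_split /= IHK; under [X in _ + X + _ = _]eq_bigr do rewrite symH.
ring.
Qed.

(** The Lambert series [\sum_d c(d) q ^ d / (1 - q ^ d)]. *)
Definition lamb (c : nat -> int) : fps int :=
  Fps (fun n => \sum_(i < n) (i.+1 %| n)%N%:R * c i.+1).

Definition lamb_trunc (c : nat -> int) K : fps int :=
  \sum_(k < K) fpsC (c k.+1) * V k.+1 geom.

Lemma lamb_eqm c K : eqm K.+1 (lamb_trunc c K) (lamb c).
Proof.
have step m k : (m <= k)%N -> eqm m.+1 (lamb_trunc c k) (lamb_trunc c m).
  move=> mk; rewrite -(subnKC mk); elim: (k - m)%N => [|d IHd]; first by rewrite addn0.
  rewrite addnS /lamb_trunc big_ord_recr /= -[X in eqm _ _ X]addr0; apply: eqmD => //.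
  by move=> i im; rewrite fcoefCM (@V_geom_eqm (m + d) m) ?mulr0 //; lia.
move=> n nK; rewrite (@step n K) // /lamb_trunc /= fcoef_sum; apply: eq_bigr => k _.
rewrite fcoefCM fcoef_V_geom mulrC; congr (_%:R * _).
by case: n nK k => [|n] nK k; [case: k | rewrite ltn0Sn].
Qed.

Lemma sigma_lamb k n : sigma k n = lamb (fun d => d%:R ^+ k) n.
Proof. by []. Qed.

(** The divisors of [2 n] are the odd divisors of [n] and the doubles of the
    divisors of [n]. *)
Lemma sigma_double n : sigma 1 (2 * n) = 3 * sigma 1 n - 2 * V 2 lambert n.
Proof.
case: n => [|n]; first by rewrite muln0 fcoefV /= /sigma !big_ord0.
pose F (m : nat) k : int := (k.+1 %| m)%N%:R * k.+1%:R ^+ 1.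
pose O := \sum_(i < n.+1) F n.+1 (2 * i)%N.
have E1 : sigma 1 (2 * n.+1) = O + 2 * sigma 1 n.+1.
  rewrite /sigma -/(F _) (big_ord_parity (F (2 * n.+1)%N)); congr (_ + _).
    apply: eq_bigr => i _; rewrite /F Gauss_dvdr // coprimen2 /=; lia.
  rewrite mulr_sumr; apply: eq_bigr => i _; rewrite /F (_ : (2 * i).+2 = 2 * i.+1)%N; last by lia.
  by rewrite dvdn_pmul2l // !expr1 natrM mulrCA.
have E2 : sigma 1 n.+1 = O + 2 * V 2 lambert n.+1.
  rewrite (@sigma_widen 1 n.+1 (2 * n.+1)); last by lia.
  rewrite (big_ord_parity (F n.+1)); congr (_ + _); rewrite fcoefV.
  case: ifP => [/dvdnP[m nm]|n2].
    rewrite (_ : (n.+1 %/ 2)%N = m); last by rewrite nm mulnK.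
    rewrite /lambert /= (@sigma_widen 1 m n.+1); last by lia.
    have D2 d : (d * 2 %| n.+1)%N = (d %| m)%N by rewrite nm dvdn_pmul2r.
    rewrite mulr_sumr; apply: eq_bigr => i _; rewrite /F (_ : (2 * i).+2 = i.+1 * 2)%N; last by lia.
    by rewrite D2 !expr1 natrM; ring.
  rewrite mulr0 big1 // => i _; rewrite /F (_ : (2 * i).+2 = i.+1 * 2)%N; last by lia.
  case: (boolP (i.+1 * 2 %| _)%N) => [H|]; last by rewrite mul0r.
  by have := dvdn_trans (dvdn_mull i.+1 (dvdnn 2)) H; rewrite n2.
by rewrite E1; lia.
Qed.

Lemma V2_odd (f : fps int) n : odd n -> V 2 f n = 0.
Proof. by move=> n1; rewrite fcoefV dvdn2 n1. Qed.

Lemma V4_odd (f : fps int) n : odd n -> V 4 f n = 0.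
Proof.
by move=> n1; rewrite fcoefV; case: ifP => // /dvdnP[m nm]; rewrite nm oddM andbF in n1.
Qed.

Lemma V2_double (f : fps int) n : V 2 f (2 * n)%N = f n.
Proof. by rewrite fcoefVM. Qed.

Lemma V4_double (f : fps int) n : V 4 f (2 * n)%N = V 2 f n.
Proof. by rewrite -(V_comp (r := 2) (s := 2)) // V2_double. Qed.

Lemma nat_parity n : exists m, n = (2 * m)%N \/ n = (2 * m).+1.
Proof. by exists n./2; have := odd_double_half n; case: (odd n) => /= <-; [right|left]; lia. Qed.

Lemma thetaF_lambert : thetaF = lambert - 3%:R * V 2 lambert + 2%:R * V 4 lambert.
Proof.
apply: fpsP => n; rewrite fcoefD fcoefB !fcoefZn.
have [m [->|->]] := nat_parity n.
  have SD : lambert (2 * m)%N = 3 * lambert m - 2 * V 2 lambert m := sigma_double m.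
  rewrite V2_double V4_double SD.
  have := congr1 (fun f : fps int => f (2 * m)%N) neg_thetaF.
  rewrite fcoef_neg fcoefN -signr_odd oddM /= mul1r; lia.
have m1 : odd (2 * m).+1 by rewrite /= oddM.
by rewrite V2_odd // V4_odd // thetaF_sigma //= !mulr0 subr0 addr0.
Qed.

(** Jacobi's four-square theorem. *)
Lemma theta4_lambert : theta ^+ 4 = 1 + 8%:R * lambert - 32%:R * V 4 lambert.
Proof.
have -> : theta ^+ 4 = thetab + 16%:R * thetaF by rewrite thetabE; ring.
by rewrite thetab_lambert thetaF_lambert /osum; ring.
Qed.

(** * Liouville's identity *)

Section Liouville.

Definition odd_geom i := V (2 * i).+1 geom.
Definition even_geom k := V (2 * k).+2 geom.
Local Notation a := odd_geom.
Local Notation e := even_geom.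

(** The identity [x_m x_n = x_(m+n) (1 + x_m + x_n)] for
    [x_m = q ^ m / (1 - q ^ m)], on which Liouville's identity rests. *)
Lemma V_geomM m n :
  V m.+1 geom * V n.+1 geom = V (m + n).+2 geom * (1 + V m.+1 geom + V n.+1 geom).
Proof.
have nz k : (1 - q ^+ k.+1 : fps int) <> 0.
  by apply: (@fps_neq0 _ _ 0); rewrite fcoefB fcoef1 fcoef_qX.
have Em := V_geomE m; have En := V_geomE n; have Emn := V_geomE (m + n).+1.
set x := V m.+1 geom in Em *; set y := V n.+1 geom in En *; set z := V (m + n).+2 geom in Emn *.
have qE : q ^+ (m + n).+2 = q ^+ m.+1 * q ^+ n.+1 :> fps int by rewrite -exprD addnS addSn.
move: Em En Emn (nz m) (nz n) (nz (m + n).+1); rewrite qE.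
move: (q ^+ m.+1) (q ^+ n.+1) => u v Em En Ez Nu Nv Nuv.
apply: (fps_mulI Nu); apply: (fps_mulI Nv); apply: (fps_mulI Nuv).
transitivity ((1 - u * v) * ((x * (1 - u)) * (y * (1 - v)))); first by ring.
rewrite Em En.
transitivity ((z * (1 - u * v)) * ((1 - u) * (1 - v) + (x * (1 - u)) * (1 - v) + (y * (1 - v)) * (1 - u))); last by ring.
by rewrite Ez Em En; ring.
Qed.

Lemma aaE i j : a i * a j = e (i + j) * (1 + a i + a j).
Proof.
rewrite /a V_geomM /e; have -> : ((2 * i + 2 * j).+2 = (2 * (i + j)).+2)%N by lia.
by [].
Qed.

Lemma eaE k j : a (j + k.+1) * a j = e k * a j - a (j + k.+1) - a (j + k.+1) * e k.
Proof.
have := V_geomM (2 * k).+1 (2 * j); rewrite -/(e k) -/(a j).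
have -> : (((2 * k).+1 + 2 * j).+2 = (2 * (j + k.+1)).+1)%N by lia.
by rewrite -/(a (j + k.+1)) => ->; ring.
Qed.

(** In the double sum over odd indices [2 i + 1] and [2 j + 1], the terms with the sum
    of the indices fixed are collected by [aaE], those with their difference fixed
    by [eaE]; in the second case the sum telescopes.  The truncation at [K] only
    affects coefficients from [2 K] on. *)
Lemma liouville (g : nat -> fps int) K :
  eqm (2 * K) (\sum_(i < K) \sum_(j < K) (g `|i - j|%N - g (i + j).+1) * (a i * a j))
    (g 0 * \sum_(i < K) a i ^+ 2
     - \sum_(k < K) g k.+1 * (k.+1%:R * e k + 2%:R * \sum_(k.+1 <= j < K) a j)).
Proof.
have e0 k N : (N <= (2 * k).+1)%N -> eqm N.+1 (e k) 0 by move=> ?; apply: V_geom_eqm.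
have a0 k N : (N <= 2 * k)%N -> eqm N.+1 (a k) 0 by move=> ?; apply: V_geom_eqm.
have eqm0M N f h : eqm N f 0 -> eqm N (f * h) 0.
  by move=> f0; rewrite -(mul0r h); apply: eqmM.
pose T k := \sum_(j < k) a j.
have tail k : (k <= K)%N -> \sum_(k <= j < K) a j = T K - T k.
  move=> kK; have := big_cat_nat (op := +%R) (idx := 0) (F := a) (P := xpredT) (leq0n k) kK.
  rewrite !big_mkord => E; apply/eqP; rewrite eq_sym subr_eq addrC; apply/eqP; exact: E.
have tail' k : (k <= K)%N -> \sum_(j < K - k) a (j + k)%N = T K - T k.
  by move=> kK; rewrite -tail // -[X in \sum_(X <= _ < _) _]add0n big_addn big_mkord.
have eqm0MM N M f h : eqm N f 0 -> eqm M h 0 -> eqm (N + M) (f * h : fps int) 0.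
  by move=> /eqm0P[f' ->] /eqm0P[h' ->]; rewrite mulrACA -exprD; apply: eqm0_qX.
have S1 : \sum_(i < K) \sum_(j < K) g `|i - j|%N * (a i * a j) =
   g 0 * \sum_(i < K) a i ^+ 2 + 2%:R * \sum_(k < K) g k.+1 * \sum_(j < K - k.+1) a (j + k.+1)%N * a j.
  rewrite (@big_ord_sym _ (fun i j : nat => g `|i - j|%N * (a i * a j))); last by move=> i j; rewrite distnC [a j * _]mulrC.
  congr (_ + 2%:R * _).
    by rewrite mulr_sumr; apply: eq_bigr => i _; rewrite distnn expr2.
  rewrite (big_ord_triangle (fun i j : nat => g `|i - j|%N * (a i * a j))); apply: eq_bigr => k _.
  rewrite mulr_sumr; apply: eq_bigr => j _; congr (g _ * _); lia.
(* a fixed difference: apart from the two ends the sum telescopes *)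
have S1k k : (k < K)%N -> eqm (2 * K) (\sum_(j < K - k.+1) a (j + k.+1)%N * a j)
   (e k * T k.+1 - \sum_(k.+1 <= j < K) a j).
  move=> kK; under eq_bigr do rewrite eaE.
  rewrite 2!sumrB -mulr_sumr -mulr_suml tail // tail' // -/(T _).
  have -> : e k * T (K - k.+1)%N - (T K - T k.+1) - (T K - T k.+1) * e k =
    (e k * T k.+1 - (T K - T k.+1)) - e k * (T K - T (K - k.+1)%N) by ring.
  suff E : eqm (2 * K) (e k * (T K - T (K - k.+1)%N)) 0.
    by have := eqmB (eqm_refl (e k * T k.+1 - (T K - T k.+1)) (N := (2 * K)%N)) E; rewrite subr0.
  have -> : (2 * K = (2 * k).+2 + 2 * (K - k.+1))%N by lia.
  apply: eqm0MM; first exact: e0.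
  rewrite -tail; last by lia.
  rewrite big_seq_cond; apply: (big_ind (fun f => eqm _ f 0)); first exact: eqm_refl.
    by move=> x y x0 y0; rewrite -(addr0 0); apply: eqmD.
  by move=> j; rewrite andbT mem_index_iota => /andP[jK _]; apply: (@eqm_leq _ _ (2 * j).+1); [lia | exact: a0].
(* a fixed sum of the indices: [e (i + j)] can be taken out *)
have S2 : eqm (2 * K) (\sum_(i < K) \sum_(j < K) g (i + j).+1 * (a i * a j))
   (\sum_(k < K) g k.+1 * (e k * (k.+1%:R + 2%:R * T k.+1))).
  have -> : \sum_(k < K) g k.+1 * (e k * (k.+1%:R + 2%:R * T k.+1)) =
     \sum_(i < K) \sum_(j < K - i) g (i + j).+1 * (a i * a j).
    have := big_ord_triangle (fun p j => g p * (a (p - j.+1)%N * a j)) K.+1.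
    rewrite big_ord_recl big_ord0 add0r [X in _ = X]big_ord_recr /= subnn big_ord0 addr0.
    under [X in _ = X]eq_bigr => i _ do rewrite subSS.
    rewrite (_ : \sum_(i < K) \sum_(j < K - i) _ = \sum_(i < K) \sum_(j < K - i) g (i + j).+1 * (a i * a j)); last first.
      by apply: eq_bigr => i _; apply: eq_bigr => j _; congr (g _ * (a _ * _)); lia.
    move=> <-; apply: eq_bigr => k _.
    rewrite /bump /= add1n -mulr_sumr; congr (_ * _).
    transitivity (e k * \sum_(j < k.+1) (1 + a (k - j)%N + a j)); last first.
      rewrite mulr_sumr; apply: eq_bigr => j _; have jk := ltn_ord j.
      by rewrite aaE (_ : k - j + j = k)%N //; lia.
    congr (_ * _); rewrite !big_split /= sumr_const card_ord -/(T k.+1) (_ : \sum_(i < k.+1) a (k - i)%N = T k.+1); first by ring.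
    by rewrite /T [RHS](reindex_inj rev_ord_inj).
  apply: eqm_sum => i _; have iK := ltn_ord i.
  rewrite -(big_mkord xpredT (fun j => g (i + j).+1 * (a i * a j))).
  rewrite (big_cat_nat (n := (K - i)%N)) //=; last by lia.
  rewrite big_mkord -[X in eqm _ _ X]addr0; apply: eqmD; first exact: eqm_refl.
  rewrite big_seq_cond; apply: (big_ind (fun f => eqm _ f 0)); first exact: eqm_refl.
    by move=> x y x0 y0; rewrite -(addr0 0); apply: eqmD.
  move=> j; rewrite andbT mem_index_iota => /andP[jK _].
  rewrite -(mulr0 (g (i + j).+1)); apply: eqmM; first exact: eqm_refl.
  by rewrite aaE; apply: eqm0M; apply: (@eqm_leq _ _ (2 * (i + j)).+2); [lia | exact: e0].
have -> : \sum_(i < K) \sum_(j < K) (g `|i - j|%N - g (i + j).+1) * (a i * a j) =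
  \sum_(i < K) \sum_(j < K) g `|i - j|%N * (a i * a j) - \sum_(i < K) \sum_(j < K) g (i + j).+1 * (a i * a j).
  by rewrite -sumrB; apply: eq_bigr => i _; rewrite -sumrB; apply: eq_bigr => j _; rewrite mulrBl.
apply: eqm_trans (eqmB (eqm_refl _) S2) _; rewrite S1.
have S1' : eqm (2 * K) (\sum_(k < K) g k.+1 * \sum_(j < K - k.+1) a (j + k.+1)%N * a j)
   (\sum_(k < K) g k.+1 * (e k * T k.+1 - \sum_(k.+1 <= j < K) a j)).
  by apply: eqm_sum => k _; apply: eqmM => //; apply: S1k.
apply: eqm_trans (eqmB (eqmD (eqm_refl _) (eqmM (eqm_refl _) S1')) (eqm_refl _)) _.
suff E : 2%:R * \sum_(k < K) g k.+1 * (e k * T k.+1 - \sum_(k.+1 <= j < K) a j)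
    - \sum_(k < K) g k.+1 * (e k * (k.+1%:R + 2%:R * T k.+1))
  = - \sum_(k < K) g k.+1 * (k.+1%:R * e k + 2%:R * \sum_(k.+1 <= j < K) a j).
  by rewrite -addrA E; exact: eqm_refl.
by rewrite mulr_sumr -sumrB -sumrN; apply: eq_bigr => k _; ring.
Qed.


Lemma sum_tail (A : pzSemiRingType) (h F : nat -> A) K :
  \sum_(k < K) h k * \sum_(k.+1 <= j < K) F j = \sum_(j < K) (\sum_(k < j) h k) * F j.
Proof.
elim: K => [|K IHK]; first by rewrite !big_ord0.
rewrite !big_ord_recr /= -IHK [X in _ + _ * X]big_geq // mulr0 addr0.
rewrite mulr_suml -big_split /=; apply: eq_bigr => k _.
by rewrite big_nat_recr ?mulrDr //= ltn_ord.
Qed.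

Lemma V_eqm2 r N f g : eqm N.+1 f g -> eqm (r.+1 * N.+1) (V r.+1 f : fps int) (V r.+1 g).
Proof.
move=> fg n nN; rewrite !fcoefV; case: ifP => // _; apply: fg.
by rewrite ltn_divLR // mulnC.
Qed.

Lemma D_geom : D geom = geom + geom ^+ 2.
Proof.
have nz : (1 - q : fps int) <> 0 by apply: (@fps_neq0 _ _ 0); rewrite fcoefB fcoef1.
apply: (fps_mulI nz); have := congr1 (@D _) geomE; rewrite DM DB D1 D_q sub0r => H.
transitivity (D geom * (1 - q) + geom * - q + geom * q); first by ring.
transitivity (geom * (1 - q) + geom * (geom * (1 - q))); last by ring.
by rewrite H geomE.
Qed.

(** Both sides are the double sum of [m q ^ (d m)]; exchanging a divisor with its
    complement identifies the coefficients. *)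
Lemma D_geom_eqm N : eqm N.+1 (\sum_(k < N) V k.+1 (D geom)) lambert.
Proof.
move=> n nN; rewrite fcoef_sum /lambert /=.
case: n nN => [|n] nN.
  by rewrite /sigma big_ord0 big1 // => i _; rewrite fcoefV dvdn0 div0n /= mul0r.
rewrite (@sigma_widen 1 n.+1 N) //.
pose h (k : 'I_N) : 'I_N := insubd k (n.+1 %/ k.+1).-1.
have hE (k : 'I_N) : (k.+1 %| n.+1)%N -> (h k).+1 = (n.+1 %/ k.+1)%N.
  move=> kn; have d0 : (0 < n.+1 %/ k.+1)%N by rewrite divn_gt0 // dvdn_leq.
  rewrite /h val_insubd ifT ?prednK //.
  exact: leq_trans (leq_div _ _) (nN : (n.+1 <= N)%N).
rewrite (bigID (fun k : 'I_N => k.+1 %| n.+1)%N) /= [X in _ + X]big1 ?addr0; last first.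
  by move=> k kn; rewrite (negPf kn).
rewrite [RHS](bigID (fun k : 'I_N => k.+1 %| n.+1)%N) /= [X in _ = _ + X]big1 ?addr0; last first.
  by move=> k /negPf ->; rewrite mul0r.
have hd (k : 'I_N) : (k.+1 %| n.+1)%N -> ((h k).+1 %| n.+1)%N by move=> kn; rewrite hE // dvdn_div.
rewrite (reindex_onto h h) /=; last first.
  by move=> k kn; apply/val_inj/succn_inj; rewrite hE ?hd // hE // divnA // mulKn.
apply: eq_big => k.
  apply/andP/idP => [[hk /eqP kE]|kn]; first by rewrite -kE hd.
  by rewrite hd //; split=> //; apply/eqP/val_inj/succn_inj; rewrite hE ?hd // hE // divnA // mulKn.
case/andP=> hk /eqP kE; have kn : (k.+1 %| n.+1)%N by rewrite -kE hd.
rewrite hk kn mul1r expr1 hE // divnA // mulKn //= mulr1 //.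
Qed.

Lemma sum_even_geom K : \sum_(k < K) (2 * k).+2%:R * e k = 2%:R * V 2 (lambert_trunc K).
Proof.
rewrite /lambert_trunc rmorph_sum mulr_sumr; apply: eq_bigr => k _.
rewrite rmorphM rmorph_nat /= V_comp // /e (_ : 2 * k.+1 = (2 * k).+2)%N; last by lia.
by rewrite (_ : (2 * k).+2 = 2 * k.+1)%N 1?natrM; [ring | lia].
Qed.

Lemma sum_odd_geom K :
  eqm (2 * K) (\sum_(i < K) (2 * i).+1%:R * a i) (lambert - 2%:R * V 2 lambert).
Proof.
have E : lambert_trunc (2 * K) = \sum_(i < K) (2 * i).+1%:R * a i + \sum_(k < K) (2 * k).+2%:R * e k.
  by rewrite /lambert_trunc (big_ord_parity (fun k => k.+1%:R * V k.+1 geom)).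
have -> : \sum_(i < K) (2 * i).+1%:R * a i = lambert_trunc (2 * K) - 2%:R * V 2 (lambert_trunc K).
  by rewrite E sum_even_geom addrK.
apply: eqmB; first by apply: eqm_leq (@lambert_eqm _).
apply: eqmM; first exact: eqm_refl.
by apply: (@eqm_leq _ _ (2 * K.+1)); [lia | exact/V_eqm2/lambert_eqm].
Qed.

Lemma sum_odd_geomD K :
  eqm (2 * K) (\sum_(i < K) (a i + a i ^+ 2)) (lambert - V 2 lambert).
Proof.
have aD i : a i + a i ^+ 2 = V (2 * i).+1 (D geom) by rewrite D_geom rmorphD rmorphXn.
under eq_bigr do rewrite aD.
have -> : \sum_(i < K) V (2 * i).+1 (D geom) =
   \sum_(k < 2 * K) V k.+1 (D geom) - V 2 (\sum_(k < K) V k.+1 (D geom)).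
  rewrite (big_ord_parity (fun k => V k.+1 (D geom))) rmorph_sum /= -addrA -sumrB.
  rewrite [X in _ + X]big1 ?addr0 // => i _; rewrite V_comp // (_ : 2 * i.+1 = (2 * i).+2)%N ?subrr //; lia.
apply: eqmB; first by apply: eqm_leq (@D_geom_eqm _).
by apply: (@eqm_leq _ _ (2 * K.+1)); [lia | exact/V_eqm2/D_geom_eqm].
Qed.

(** Jacobi's two-square theorem.  Liouville's identity for the indicator of even [k]
    evaluates the square of the right hand side; the result is [theta ^ 4] by the
    four-square theorem, and a power series has at most one square root with
    constant term [1]. *)
Lemma theta2_chi4 : theta ^+ 2 = 1 + 4%:R * lamb (fun d => chi4 d%:Z).
Proof.
set L := lamb _.
have LK K : eqm (2 * K) (\sum_(i < K) (-1) ^+ i * a i) L.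
  have E : lamb_trunc (fun d => chi4 d%:Z) (2 * K) = \sum_(i < K) (-1) ^+ i * a i.
    rewrite /lamb_trunc (big_ord_parity (fun k => fpsC (chi4 k.+1) * V k.+1 geom)).
    rewrite [X in _ + X]big1 ?addr0 => [|i _]; last first.
      by rewrite (_ : chi4 _ = 0) ?rmorph0 ?mul0r // /chi4; do !case: eqP; lia.
    apply: eq_bigr => i _; congr (_ * _).
    have -> : chi4 (2 * i).+1 = (-1) ^+ i.
      rewrite -signr_odd; have := odd_double_half i.
      have -> : ((2 * i).+1 : int) = (if odd i then 3 else 1) + 4 * (i./2)%:Z.
        by have := odd_double_half i; case: (odd i); lia.
      by rewrite chi4D4; case: (odd i).
    by rewrite rmorphXn rmorphN rmorph1.
  by rewrite -E; apply: eqm_leq (@lamb_eqm _ _).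
pose g k : fps int := (~~ odd k)%:R.
have sgn (i j : nat) : g `|i - j|%N - g (i + j).+1 = (-1) ^+ i * (-1) ^+ j.
  rewrite -exprD -signr_odd /g.
  have -> : odd `|i - j|%N = odd (i + j) by lia.
  by rewrite /=; case: (odd _); rewrite /= ?mulr1n ?mulr0n ?expr0 ?expr1; ring.
have main M : eqm (4 * M) (16%:R * L ^+ 2 + 8%:R * L) (8%:R * lambert - 32%:R * V 4 lambert).
  set K := (2 * M)%N; have -> : (4 * M = 2 * K)%N by rewrite /K; lia.
  have L2 : eqm (2 * K) (L ^+ 2) (\sum_(i < K) a i ^+ 2 - (2%:R * V 4 (lambert_trunc M) + \sum_(j < K) (j%:R - (odd j)%:R) * a j)).
    apply: (eqm_trans (eqm_sym (eqmX 2 (LK K)))).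
    have -> : (\sum_(i < K) (-1) ^+ i * a i) ^+ 2 = \sum_(i < K) \sum_(j < K) (g `|i - j|%N - g (i + j).+1) * (a i * a j).
      rewrite expr2 mulr_suml; apply: eq_bigr => i _; rewrite mulr_sumr; apply: eq_bigr => j _.
      by rewrite sgn; ring.
    apply: (eqm_trans (@liouville g K)); rewrite mul1r.
    suff -> : \sum_(k < K) g k.+1 * (k.+1%:R * e k + 2%:R * \sum_(k.+1 <= j < K) a j) =
      2%:R * V 4 (lambert_trunc M) + \sum_(j < K) (j%:R - (odd j)%:R) * a j by exact: eqm_refl.
    under eq_bigr do rewrite mulrDr [_ * (2%:R * _)]mulrA.
    rewrite big_split /= (sum_tail (fun k => g k.+1 * 2%:R) a); congr (_ + _).
      rewrite (big_ord_parity (fun k => g k.+1 * (k.+1%:R * e k))) big1 ?add0r => [|i _]; last first.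
        by rewrite /g /= oddM mul0r.
      rewrite /lambert_trunc rmorph_sum mulr_sumr; apply: eq_bigr => k _.
      rewrite rmorphM rmorph_nat /= V_comp // /e (_ : 4 * k.+1 = (2 * (2 * k).+1).+2)%N; last by lia.
      rewrite /g /= oddM mul1r (_ : (2 * k).+2 = 2 * k.+1)%N 1?natrM; [ring | lia].
    apply: eq_bigr => j _; congr (_ * _); elim: (nat_of_ord j) => [|n IHn]; first by rewrite big_ord0 subrr.
    rewrite big_ord_recr /= IHn /g /= -[n.+1]addn1 natrD.
    by case: (odd n); rewrite /= ?mulr1n ?mulr0n; ring.
  have L1 := LK K.
  apply: (eqm_trans (eqmD (eqmM (eqm_refl _) L2) (eqmM (eqm_refl _) (eqm_sym L1)))).
  have -> : 16%:R * (\sum_(i < K) a i ^+ 2 - (2%:R * V 4 (lambert_trunc M) + \sum_(j < K) (j%:R - (odd j)%:R) * a j))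
     + 8%:R * (\sum_(i < K) (-1) ^+ i * a i) =
     16%:R * \sum_(i < K) (a i + a i ^+ 2) - 8%:R * \sum_(i < K) (2 * i).+1%:R * a i - 32%:R * V 4 (lambert_trunc M).
    have F : 8%:R * (\sum_(i < K) (-1) ^+ i * a i) + 8%:R * (\sum_(i < K) (2 * i).+1%:R * a i) =
       16%:R * (\sum_(i < K) a i) + 16%:R * (\sum_(j < K) (j%:R - (odd j)%:R) * a j).
      rewrite !mulr_sumr -!big_split; apply: eq_bigr => i _ /=.
      have -> : (-1) ^+ i = 1 - 2%:R * (odd i)%:R :> fps int.
        by rewrite -signr_odd; case: (odd i) => /=; rewrite ?expr1 ?expr0; ring.
      ring.
    rewrite big_split /=.
    have -> : 8%:R * (\sum_(i < K) (-1) ^+ i * a i) = 16%:R * (\sum_(i < K) a i)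
       + 16%:R * (\sum_(j < K) (j%:R - (odd j)%:R) * a j) - 8%:R * (\sum_(i < K) (2 * i).+1%:R * a i).
      by rewrite -F addrK.
    ring.
  have -> : 8%:R * lambert - 32%:R * V 4 lambert = 16%:R * (lambert - V 2 lambert) - 8%:R * (lambert - 2%:R * V 2 lambert) - 32%:R * V 4 lambert by ring.
  apply: eqmB; first apply: eqmB.
  - by apply: eqmM; [exact: eqm_refl | exact: sum_odd_geomD].
  - by apply: eqmM; [exact: eqm_refl | exact: sum_odd_geom].
  apply: eqmM; first exact: eqm_refl.
  by apply: (@eqm_leq _ _ (4 * M.+1)); [rewrite /K; lia | exact/V_eqm2/lambert_eqm].
have E : 16%:R * L ^+ 2 + 8%:R * L = 8%:R * lambert - 32%:R * V 4 lambert.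
  by apply: eqm_eq_leq => N; exists (4 * N)%N; [lia | exact: main].
have sq : (theta ^+ 2 - (1 + 4%:R * L)) * (theta ^+ 2 + (1 + 4%:R * L)) = 0.
  have -> : (theta ^+ 2 - (1 + 4%:R * L)) * (theta ^+ 2 + (1 + 4%:R * L)) =
    theta ^+ 4 - (1 + (16%:R * L ^+ 2 + 8%:R * L)) by ring.
  by rewrite E theta4_lambert; ring.
case: (fps_mul_eq0 sq) => [/eqP|]; first by rewrite subr_eq0 => /eqP.
move/(congr1 (fun f : fps int => f 0%N)); rewrite !fcoefD fcoef0X theta0 fcoefZn fcoef1.
by rewrite /= big_ord0.
Qed.

Lemma sum_squares6 j : 24 * \sum_(k < j) k.+1%:R ^+ 2 = (2 * j).+1%:R ^+ 3 - (2 * j).+1%:R :> fps int.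
Proof.
elim: j => [|j IHj]; first by rewrite big_ord0 mulr0 expr1n subrr.
rewrite big_ord_recr /= mulrDr IHj.
have -> : (2 * j.+1).+1 = (2 * j + 3)%N by lia.
ring.
Qed.

(** Liouville's identity for [g k = k ^ 2], where the left hand side is a square since
    [(i - j) ^ 2 - (i + j + 1) ^ 2 = - (2 i + 1) (2 j + 1)]. *)
Lemma lambert_sqr n : odd n ->
  12 * ((lambert - 2%:R * V 2 lambert) ^+ 2) n = sigma 3 n - sigma 1 n.
Proof.
move=> n1; pose K := n.
have nK : (n < 2 * K)%N by rewrite /K; lia.
pose T := \sum_(i < K) (2 * i).+1%:R * a i.
pose g k : fps int := k%:R ^+ 2.
have T2 : eqm (2 * K) (T ^+ 2) (\sum_(k < K) g k.+1 * (k.+1%:R * e k + 2%:R * \sum_(k.+1 <= j < K) a j)).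
  have := eqmN (@liouville g K); rewrite (_ : g 0%N = 0) ?mul0r ?sub0r ?opprK; last by rewrite /g mulr0n expr0n.
  suff -> : T ^+ 2 = - \sum_(i < K) \sum_(j < K) (g `|i - j|%N - g (i + j).+1) * (a i * a j) by [].
  rewrite expr2 /T mulr_suml -sumrN; apply: eq_bigr => i _; rewrite mulr_sumr -sumrN; apply: eq_bigr => j _.
  have -> : g `|i - j|%N = (i%:R - j%:R) ^+ 2.
    rewrite /g; have [ij|ij] := leqP i j; last by rewrite distnEl ?natrB // ltnW.
    by rewrite distnEr // natrB //; ring.
  by rewrite /g; ring.
have eo k : e k n = 0.
  by rewrite /e fcoefV (_ : _ %| n = false)%N //; apply/negP => /dvdnP[m nm]; move: n1; rewrite nm; lia.
have S3 : (\sum_(i < K) (2 * i).+1%:R ^+ 3 * a i) n = sigma 3 n.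
  rewrite sigma_lamb -(@lamb_eqm _ (2 * K)) ?ltnS 1?ltnW // /lamb_trunc.
  rewrite (big_ord_parity (fun k => fpsC (k.+1%:R ^+ 3) * V k.+1 geom)) fcoefD [X in _ + X]fcoef_sum [X in _ + X]big1 => [|k _].
    by rewrite addr0 !fcoef_sum; apply: eq_bigr => i _; rewrite rmorphXn rmorph_nat.
  by rewrite -/(e k) fcoefCM eo mulr0.
have S1 : T n = sigma 1 n.
  by rewrite (@sum_odd_geom K n nK) fcoefB fcoefZn V2_odd // mulr0 subr0.
have := T2 n nK; rewrite (eqmX 2 (@sum_odd_geom K)) // => ->.
have -> : \sum_(k < K) g k.+1 * (k.+1%:R * e k + 2%:R * \sum_(k.+1 <= j < K) a j) =
  \sum_(k < K) g k.+1 * (k.+1%:R * e k) + \sum_(j < K) (\sum_(k < j) g k.+1 * 2%:R) * a j.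
  rewrite -(sum_tail (fun k => g k.+1 * 2%:R) a) -big_split; apply: eq_bigr => k _ /=.
  by rewrite mulrDr [_ * (2%:R * _)]mulrA.
rewrite fcoefD [X in X + _]fcoef_sum [X in X + _]big1 ?add0r => [|k _]; last first.
  by rewrite /g mulrA -natrX -natrM fcoefZn eo mulr0.
rewrite -S1 -S3 -fcoefB -fcoefZn; congr (fcoef _ n).
rewrite /T -sumrB mulr_sumr; apply: eq_bigr => j _.
by rewrite -mulrBl -sum_squares6 -mulr_suml; ring.
Qed.

End Liouville.

(** [theta(- q) ^ 8 = thetab ^ 2] and [thetab = theta ^ 4 - 16 thetaF]; compare odd
    coefficients. *)
Lemma theta8_odd n : odd n -> (theta ^+ 8) n = 16 * (theta ^+ 4 * thetaF) n.
Proof.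
move=> n1.
have := congr1 (fun f : fps int => f n) (_ : neg (theta ^+ 8) = theta ^+ 8 - 32%:R * (theta ^+ 4 * thetaF) + 256%:R * V 2 (theta ^+ 4 * thetaF)).
rewrite fcoef_neg -signr_odd n1 expr1 fcoefD fcoefB !fcoefZn V2_odd // => H.
have /H : neg (theta ^+ 8) = theta ^+ 8 - 32%:R * (theta ^+ 4 * thetaF) + 256%:R * V 2 (theta ^+ 4 * thetaF).
  rewrite -thetaF_sqr (_ : theta ^+ 8 = (theta ^+ 4) ^+ 2); last by ring.
  rewrite rmorphXn /= rmorphXn /= -thetabX thetabE; ring.
by lia.
Qed.

(** The Eisenstein series [M] of weight 2 satisfies [M(q ^ 2) = theta ^ 4 - 8 thetaF];
    its square is known from [lambert_sqr] on one side, and in terms of [theta]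
    and [thetaF] on the other. *)
Lemma theta4F_sigma n : odd n -> (theta ^+ 4 * thetaF) n = sigma 3 n.
Proof.
move=> n1; pose M := 1 + 24%:R * (lambert - 2%:R * V 2 lambert).
have V2M : V 2 M = theta ^+ 4 - 8%:R * thetaF.
  rewrite theta4_lambert thetaF_lambert /M rmorphD rmorph1 rmorphM rmorph_nat rmorphB rmorphM rmorph_nat /= V_comp //.
  by ring.
have M2 : M ^+ 2 = thetab ^+ 2 + 64%:R * (theta ^+ 4 * thetaF).
  have E : V 2 (M ^+ 2) = V 2 (thetab ^+ 2 + 64%:R * (theta ^+ 4 * thetaF)).
    have Vb : V 2 thetab ^+ 2 = theta ^+ 4 * thetab.
      transitivity ((theta * neg theta) ^+ 4); last by rewrite thetabX; ring.
      by rewrite theta_neg thetabX rmorphXn /=; ring.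
    have -> : V 2 (thetab ^+ 2 + 64%:R * (theta ^+ 4 * thetaF)) = V 2 thetab ^+ 2 + 64%:R * V 2 (theta ^+ 4 * thetaF).
      by rewrite rmorphD rmorphXn [X in _ + X]rmorphM rmorph_nat.
    by rewrite rmorphXn /= V2M -thetaF_sqr Vb thetabE; ring.
  by apply: fpsP => m; have := congr1 (fun f : fps int => f (2 * m)%N) E; rewrite !V2_double.
have T8 := theta8_odd n1.
have := congr1 (fun f : fps int => f n) M2.
have -> : thetab ^+ 2 + 64%:R * (theta ^+ 4 * thetaF) = theta ^+ 8 + 32%:R * (theta ^+ 4 * thetaF) + 256%:R * V 2 (theta ^+ 4 * thetaF).
  by rewrite -thetaF_sqr thetabE; ring.
have -> : M ^+ 2 = 1%:R + 48%:R * (lambert - 2%:R * V 2 lambert) + 576%:R * (lambert - 2%:R * V 2 lambert) ^+ 2.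
  by rewrite /M; ring.
rewrite !fcoefD !fcoefZn fcoef_nat fcoefB fcoefZn !V2_odd // T8.
have -> : (n == 0%N) = false by case: n n1 {T8}.
have := lambert_sqr n1; have -> : lambert n = sigma 1 n by [].
move: (((lambert - 2%:R * V 2 lambert) ^+ 2) n) => x; lia.
Qed.

(** * Sums over forms as coefficients of theta series *)

(** Lambert series whose weight depends on both complementary divisors. *)
Definition lamb2 (W : nat -> nat -> int) : fps int :=
  Fps (fun n => \sum_(i < n) (i.+1 %| n)%N%:R * W i.+1 (n %/ i.+1)%N).

(** Sorting the solutions of [x ^ 2 + s u v = N] by [x] and then by the divisor [u]. *)
Lemma fsum_theta_lamb2 s (W : nat -> nat -> int) N : (0 < s)%N ->
  \sum_(t \in [set t : int * (nat * nat) |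
     [/\ (0 < t.2.1)%N, (0 < t.2.2)%N & (sqz t.1 + s * (t.2.1 * t.2.2))%N = N]]) W t.2.1 t.2.2
  = (theta * V s (lamb2 W)) N.
Proof.
move=> s0; rewrite theta.unlock fcoef_cgfM; last exact: ffib_sqz.
have fA := ffib_sqz N; have fI := finite_II N.
pose m (x : int) := ((N - sqz x) %/ s)%N.
pose C := [set p : int * nat | (sqz p.1 <= N)%N /\ [&& s %| N - sqz p.1, p.2 < m p.1 & p.2.+1 %| m p.1]%N].
have CE : C = ([set x | (sqz x <= N)%N] `*` `I_N) `&` C.
  apply/seteqP; split=> [[x i] [/= xN /and3P[sm im di]]|p []//]; split; last by split=> //=; apply/and3P.
  split=> //=; apply: leq_trans im _; apply: leq_trans (leq_div _ _) _; apply: leq_subr.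
transitivity (\sum_(p \in C) W p.2.+1 (m p.1 %/ p.2.+1)%N).
  apply: (@fsum_bij _ _ _ _ (fun p : int * nat => (p.1, (p.2.+1, m p.1 %/ p.2.+1)%N))
     (fun t : int * (nat * nat) => (t.1, t.2.1.-1))) => [[x i] [/= xN /and3P[sm im di]]|[x [u v]] [/= u0 v0 E]|//].
    split=> //; split=> //; first by rewrite divn_gt0 // dvdn_leq //; lia.
    by rewrite [(i.+1 * _)%N]mulnC divnK // mulnC divnK // subnKC.
  have mE : m x = (u * v)%N by rewrite /m -E addKn mulKn.
  rewrite /C /= prednK // mE; split; last by rewrite mulKn.
  split; first by rewrite -E leq_addr.
  apply/and3P; split; [|by nia|exact: dvdn_mulr].
  by rewrite -E addKn dvdn_mulr.
pose F x i : int := if (x, i) \in C then W i.+1 (m x %/ i.+1)%N else 0.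
transitivity (\sum_(p \in [set x | (sqz x <= N)%N] `*` `I_N) F p.1 p.2).
  by rewrite {1}CE fsbig_mkcondr; apply: eq_fsum => // -[x i].
rewrite -pair_fsbig // /F.
apply: eq_fsum => // x xN; rewrite fcoefV.
case: ifP => sm; last first.
  rewrite fsbig1 // => i _; rewrite ifF //; apply/negbTE/negP => /set_mem [/= _ /and3P[]].
  by rewrite sm.
rewrite -fsbig_ord [RHS](big_ord_widen N (fun i => (i.+1 %| m x)%N%:R * W i.+1 (m x %/ i.+1)%N)); last first.
  by apply: leq_trans (leq_div _ _) (leq_subr _ _).
rewrite [RHS]big_mkcond; apply: eq_bigr => i _.
have -> : ((x, i : nat) \in C) = [&& s %| N - sqz x, i < m x & i.+1 %| m x]%N.
  by apply/idP/idP => [/set_mem[]|H] //; apply: mem_set; split.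
rewrite sm /=; case: ifP => [/andP[-> ->]|]; first by rewrite mul1r.
by rewrite -/(m x); case: (i < m x)%N => //= ->; rewrite mul0r.
Qed.

(** A simple form [[- v, x, u]] of discriminant [N] is a solution of
    [x ^ 2 + 4 u v = N]. *)
Lemma simple_sum_lamb2 (w : qform -> int -> int) (W : nat -> nat -> int) (N : nat) :
  (forall b (u v : nat), w (- v%:Z, b, u%:Z) u%:Z = W u v) ->
  simple_sum w N 0 1 = (theta * V 4 (lamb2 W)) N.
Proof.
move=> wW; rewrite -fsum_theta_lamb2 // /simple_sum.
apply: (@fsum_bij _ _ _ _ (fun t : int * (nat * nat) => (- t.2.2%:Z, t.1, t.2.1%:Z))
   (fun Q : qform => (Q.1.2, (absz Q.2, absz Q.1.1)))).
- move=> [x [u v]] [/= u0 v0 E]; split; last by rewrite abszN !absz_nat.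
  by split; rewrite /disc /= -?E ?PoszD ?sqzE; lia.
- move=> [[a b] c] [/= dQ a0 c0]; have aE : (absz a)%:Z = - a by [lia]; have cE : (absz c)%:Z = c by lia.
  split; last by rewrite /= aE cE opprK.
  split; [lia|lia|]; apply/eqP; rewrite -eqz_nat PoszD sqzE !PoszM aE cE -dQ; apply/eqP.
  by rewrite /disc /=; ring.
by move=> [x [u v]] _; rewrite /ev /= -(wW x); congr (w _ _); ring.
Qed.


Lemma B2_theta (N : nat) : B2 N = (theta * V 4 lambert) N.
Proof.
rewrite /B2 (@simple_sum_lamb2 _ (fun u _ => u%:R ^+ 1)) //.
by move=> b u v; rewrite /w2 expr1 natz.
Qed.

Lemma B4_theta (N : nat) : B4 N = (theta * V 4 (lamb (fun d => d%:R ^+ 3))) N.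
Proof.
rewrite /B4 (@simple_sum_lamb2 _ (fun u _ => u%:R ^+ 3)) //.
by move=> b u v; rewrite /w4 natz.
Qed.

(** * Dissections modulo [4] *)

Section Dissections.

Local Notation Z := (2%:R * (q * V 8 psi)) (only parsing).

(** The dissection of [f] into residue classes modulo [4], in terms of the series
    [Z = 2 q psi(q ^ 8)] for which [theta = theta(q ^ 4) + Z]. *)
Definition dissected (f P0 P1 P2 P3 : fps int) :=
  f = V 4 P0 + V 4 P1 * Z + V 4 P2 * Z ^+ 2 + V 4 P3 * Z ^+ 3.

Lemma Z_exp r : exists H, Z ^+ r = q ^+ r * V 8 H.
Proof.
exists (2%:R ^+ r * psi ^+ r).
by rewrite rmorphM !rmorphXn rmorph_nat /= !exprMn; ring.
Qed.

Lemma V8_V4 (H : fps int) : V 8 H = V 4 (V 2 H).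
Proof. by rewrite V_comp. Qed.

(** [Z ^ r] is [q ^ r] times a series in [q ^ 8]. *)
Lemma VZ_coef G r n : (r < 4)%N -> (n %% 4)%N != r -> (V 4 G * Z ^+ r) n = 0.
Proof.
move=> r4 nr; have [H ->] := Z_exp r.
have -> : V 4 G * (q ^+ r * V 8 H) = q ^+ r * V 4 (G * V 2 H).
  by rewrite V8_V4 rmorphM /=; ring.
rewrite fcoefqXM; case: leqP => // rn; rewrite fcoefV; case: ifP => // /dvdnP[k kE].
by case/eqP: nr; have -> : (n = k * 4 + r)%N by [lia]; rewrite modnMDl modn_small.
Qed.

(** As [Z] is [q] times a series in [q ^ 8], at the residue [5] modulo [8] only the
    odd coefficients of [G] contribute, at the residue [1] only the even ones. *)
Lemma VZ_coef8 (G : fps int) n : (forall k, (k %% 2 == (n %/ 4) %% 2)%N -> G k = 0) -> (n %% 4 = 1)%N -> (V 4 G * Z) n = 0.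
Proof.
move=> G0 n1; have -> : V 4 G * Z = 2%:R * (q ^+ 1 * V 4 (G * V 2 psi)).
  by rewrite V8_V4 rmorphM /=; ring.
have n0 : (1 <= n)%N by lia.
rewrite fcoefZn fcoefqXM n0.
rewrite fcoefV; case: ifP => [/dvdnP[k kE]|_]; last by rewrite mulr0.
have nE : (n = k * 4 + 1)%N by lia.
rewrite kE mulnK // fcoefM big1 ?mulr0 // => i _; rewrite fcoefV; case: ifP => [/dvdnP[j jE]|]; last by rewrite mulr0.
rewrite G0 ?mul0r // nE divnMDl // divn_small // addn0.
have ik := ltn_ord i; have kE' : (j * 2 + i)%N = k by lia.
by rewrite -(modnMDl j i 2) kE'.
Qed.

Lemma dissected0 f P0 P1 P2 P3 n : dissected f P0 P1 P2 P3 -> f (4 * n)%N = P0 n.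
Proof.
move=> ->; rewrite !fcoefD fcoefVM // -[Z]expr1 !VZ_coef ?modnMr // !addr0 //.
Qed.

Lemma dissected1 f P0 P1 P2 P3 n : dissected f P0 P1 P2 P3 -> (n %% 4 = 1)%N ->
  f n = (V 4 P1 * Z) n.
Proof.
move=> -> n1; rewrite !fcoefD -{1}[V 4 P0]mulr1 -(expr0 Z) (@VZ_coef _ 0) ?n1 //.
by rewrite (@VZ_coef _ 2) ?n1 // (@VZ_coef _ 3) ?n1 // add0r !addr0.
Qed.

Lemma dissected3 f P0 P1 P2 P3 n : dissected f P0 P1 P2 P3 -> (n %% 4 = 3)%N ->
  f n = (V 4 P3 * Z ^+ 3) n.
Proof.
move=> -> n1; rewrite !fcoefD -{1}[V 4 P0]mulr1 -(expr0 Z) (@VZ_coef _ 0) ?n1 //.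
by rewrite -[X in V 4 P1 * X]expr1 (@VZ_coef _ 1) ?n1 // (@VZ_coef _ 2) ?n1 // !add0r.
Qed.

Let W := V 4 thetaF.
Let z : fps int := 2%:R * (q * V 8 psi).
Let x : fps int := V 4 theta.

Let zW : z ^+ 4 - 16%:R * W = 0.
Proof. by rewrite /z Z4 subrr. Qed.

Let tE : theta = x + z. Proof. exact: theta_XZ. Qed.
Let FE : 2%:R * thetaF = x * z * (x ^+ 2 + z ^+ 2). Proof. exact: thetaF_XZ. Qed.


Let V4_mono c a b : V 4 (c%:R * theta ^+ a * thetaF ^+ b) = c%:R * x ^+ a * W ^+ b.
Proof. by rewrite !rmorphM !rmorphXn rmorph_nat. Qed.


(** This and the next dissections come from expanding in [X + Z], with
    [2 thetaF = X Z (X ^ 2 + Z ^ 2)], and reducing by [Z ^ 4 = 16 thetaF(q ^ 4)]. *)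
Lemma dissect_theta2 : dissected (theta ^+ 2)
  (1%:R * theta ^+ 2 * thetaF ^+ 0)
(2%:R * theta ^+ 1 * thetaF ^+ 0)
(1%:R * theta ^+ 0 * thetaF ^+ 0)
(0%:R * theta ^+ 0 * thetaF ^+ 0).
Proof.
rewrite /dissected ?raddfD /= !V4_mono -/z.
have -> : theta ^+ 2 = (x + z) ^+ 2 by rewrite tE.
ring.
Qed.

Lemma dissect_theta3 : dissected (theta ^+ 3)
  (1%:R * theta ^+ 3 * thetaF ^+ 0)
(3%:R * theta ^+ 2 * thetaF ^+ 0)
(3%:R * theta ^+ 1 * thetaF ^+ 0)
(1%:R * theta ^+ 0 * thetaF ^+ 0).
Proof.
rewrite /dissected ?raddfD /= !V4_mono -/z.
have -> : theta ^+ 3 = (x + z) ^+ 3 by rewrite tE.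
ring.
Qed.

Lemma dissect_theta5 : dissected (theta ^+ 5)
  (1%:R * theta ^+ 5 * thetaF ^+ 0 + 80%:R * theta ^+ 1 * thetaF ^+ 1)
(5%:R * theta ^+ 4 * thetaF ^+ 0 + 16%:R * theta ^+ 0 * thetaF ^+ 1)
(10%:R * theta ^+ 3 * thetaF ^+ 0)
(10%:R * theta ^+ 2 * thetaF ^+ 0).
Proof.
rewrite /dissected ?raddfD /= !V4_mono -/z.
have -> : theta ^+ 5 = (x + z) ^+ 5 by rewrite tE.
apply/eqP; rewrite -subr_eq0; apply/eqP; rewrite -[RHS](mulr0 (5%:R * x + z)) -zW; ring.
Qed.

Lemma dissect_thetaF : dissected (2%:R * (theta * thetaF))
  (16%:R * theta ^+ 1 * thetaF ^+ 1)
(1%:R * theta ^+ 4 * thetaF ^+ 0)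
(1%:R * theta ^+ 3 * thetaF ^+ 0)
(1%:R * theta ^+ 2 * thetaF ^+ 0).
Proof.
rewrite /dissected ?raddfD /= !V4_mono -/z.
have -> : 2%:R * (theta * thetaF) = (x + z) * (x * z * (x ^+ 2 + z ^+ 2)) by rewrite -FE -tE; ring.
apply/eqP; rewrite -subr_eq0; apply/eqP; rewrite -[RHS](mulr0 (x)) -zW; ring.
Qed.

Lemma dissect_theta9 : dissected (theta ^+ 9)
  (1%:R * theta ^+ 9 * thetaF ^+ 0 + 2016%:R * theta ^+ 5 * thetaF ^+ 1 + 2304%:R * theta ^+ 1 * thetaF ^+ 2)
(9%:R * theta ^+ 8 * thetaF ^+ 0 + 2016%:R * theta ^+ 4 * thetaF ^+ 1 + 256%:R * theta ^+ 0 * thetaF ^+ 2)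
(36%:R * theta ^+ 7 * thetaF ^+ 0 + 1344%:R * theta ^+ 3 * thetaF ^+ 1)
(84%:R * theta ^+ 6 * thetaF ^+ 0 + 576%:R * theta ^+ 2 * thetaF ^+ 1).
Proof.
rewrite /dissected ?raddfD /= !V4_mono -/z.
have -> : theta ^+ 9 = (x + z) ^+ 9 by rewrite tE.
apply/eqP; rewrite -subr_eq0; apply/eqP; rewrite -[RHS](mulr0 (126%:R * x ^+ 5 + 9%:R * x * (z ^+ 4 + 16%:R * W) + 126%:R * x ^+ 4 * z + z * (z ^+ 4 + 16%:R * W) + 84%:R * x ^+ 3 * z ^+ 2 + 36%:R * x ^+ 2 * z ^+ 3)) -zW; ring.
Qed.

Lemma dissect_theta5F : dissected (2%:R * (theta ^+ 5 * thetaF))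
  (240%:R * theta ^+ 5 * thetaF ^+ 1 + 256%:R * theta ^+ 1 * thetaF ^+ 2)
(1%:R * theta ^+ 8 * thetaF ^+ 0 + 240%:R * theta ^+ 4 * thetaF ^+ 1)
(5%:R * theta ^+ 7 * thetaF ^+ 0 + 176%:R * theta ^+ 3 * thetaF ^+ 1)
(11%:R * theta ^+ 6 * thetaF ^+ 0 + 80%:R * theta ^+ 2 * thetaF ^+ 1).
Proof.
rewrite /dissected ?raddfD /= !V4_mono -/z.
have -> : 2%:R * (theta ^+ 5 * thetaF) = (x + z) ^+ 5 * (x * z * (x ^+ 2 + z ^+ 2)) by rewrite -FE -tE; ring.
apply/eqP; rewrite -subr_eq0; apply/eqP; rewrite -[RHS](mulr0 (15%:R * x ^+ 5 + x * (z ^+ 4 + 16%:R * W) + 15%:R * x ^+ 4 * z + 11%:R * x ^+ 3 * z ^+ 2 + 5%:R * x ^+ 2 * z ^+ 3)) -zW; ring.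
Qed.

Lemma dissect_thetaF2 : dissected (4%:R * (theta * thetaF ^+ 2))
  (32%:R * theta ^+ 5 * thetaF ^+ 1)
(32%:R * theta ^+ 4 * thetaF ^+ 1)
(1%:R * theta ^+ 7 * thetaF ^+ 0 + 16%:R * theta ^+ 3 * thetaF ^+ 1)
(1%:R * theta ^+ 6 * thetaF ^+ 0 + 16%:R * theta ^+ 2 * thetaF ^+ 1).
Proof.
rewrite /dissected ?raddfD /= !V4_mono -/z.
have -> : 4%:R * (theta * thetaF ^+ 2) = (x + z) * (x * z * (x ^+ 2 + z ^+ 2)) ^+ 2 by rewrite -FE -tE; ring.
apply/eqP; rewrite -subr_eq0; apply/eqP; rewrite -[RHS](mulr0 (2%:R * x ^+ 5 + 2%:R * x ^+ 4 * z + x ^+ 3 * z ^+ 2 + x ^+ 2 * z ^+ 3)) -zW; ring.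
Qed.

End Dissections.

(** * Supplementary laws for the Legendre symbol *)

Section Legendre.
Variable l : nat.
Hypotheses (l_prime : prime l) (l_odd : odd l).
Local Notation F := 'F_l.

Lemma fermat_unit (x : F) : x != 0 -> x ^+ l.-1 = 1.
Proof.
move=> x0; apply: (mulfI x0); rewrite -exprS prednK ?prime_gt0 // mulr1.
exact: fermat.
Qed.

Lemma legendre_mul_square (a : int) (s : nat) : coprime s l ->
  legendre (s%:Z ^+ 2 * a) l = legendre a l.
Proof.
move=> sl; have sF : (s%:R : F) != 0.
  by rewrite -(dvdn_pcharf (pchar_Fp l_prime)) -prime_coprime // coprime_sym.
have [la|la] := boolP (l %| a)%Z.
  by rewrite /legendre la dvdz_mull.
rewrite !(legendre_Fp l_prime) //; last first.
  by rewrite (dvdz_Fp l_prime) rmorphM rmorphXn /= mulf_neq0 ?expf_neq0 // -(dvdz_Fp l_prime).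
congr (if _ then _ else _); apply/existsP/existsP => -[x /eqP xE].
  exists (x / s%:R); rewrite expr_div_n xE rmorphM rmorphXn /=.
  by rewrite mulrC mulKf // expf_neq0.
by exists (s%:R * x); rewrite exprMn xE rmorphM rmorphXn.
Qed.

Lemma half_power (x : F) : x != 0 -> x ^+ (l.-1)./2 = 1 \/ x ^+ (l.-1)./2 = -1.
Proof.
move=> x0; have : (x ^+ (l.-1)./2) ^+ 2 == 1 ^+ 2.
  rewrite -exprM expr1n muln2 (_ : (l.-1)./2.*2 = l.-1) ?fermat_unit //.
  by have := odd_double_half l.-1; have := prime_gt0 l_prime; lia.
by rewrite eqf_sqr => /orP[/eqP|/eqP]; [left|right].
Qed.

(** The polynomial [X ^ ((l - 1) / 2) - 1] has fewer than [l - 1] roots. *)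
Lemma exists_half_powerN : exists2 x : F, x != 0 & x ^+ (l.-1)./2 = -1.
Proof.
have l2 := prime_gt1 l_prime.
have [//|H] := pselect (exists2 x : F, x != 0 & x ^+ (l.-1)./2 = -1).
pose P : {poly F} := 'X^((l.-1)./2) - 1%:P.
have h0 : (0 < (l.-1)./2)%N by have := odd_double_half l.-1; lia.
have sP : size P = ((l.-1)./2).+1 by rewrite /P size_XnsubC.
have := @max_poly_roots _ P (rem 0 (enum F)).
rewrite -size_poly_eq0 sP rem_uniq ?enum_uniq // => /(_ isT) M.
have /M /(_ isT) : all (root P) (rem 0 (enum F)).
  apply/allP => x; rewrite mem_rem_uniq ?enum_uniq // !inE => /andP[x0 _].
  rewrite rootE /P !hornerE subr_eq0; apply/eqP.
  by case: (half_power x0) => // xN; case: H; exists x.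
rewrite size_rem ?mem_enum // -cardE card_Fp // ltnS.
by have := odd_double_half l.-1; lia.
Qed.

(** If [l] is [1] modulo [4] then [-1] is a square.  If [l] is [3] modulo [4] it is
    not, and [x = a ^ ((l + 1) / 4)] satisfies [x ^ 2 = a] or [x ^ 2 = - a], so exactly
    one of [a], [- a] is a square. *)
Lemma legendreN (a : int) : ~~ (l %| a)%Z -> legendre (- a) l = chi4 l * legendre a l.
Proof.
move=> la; have lNa : ~~ (l %| - a)%Z by rewrite rpredN.
have a0 : (a%:~R : F) != 0 by rewrite -(dvdz_Fp l_prime).
have two0 : (-1 : F) != 1.
  by rewrite -subr_eq0 -opprD oppr_eq0 -[1 + 1]/(2%:R) (two_neq0_Fp l_prime).
rewrite !(legendre_Fp l_prime) // rmorphN /=.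
have [l1|l3] : (l %% 4 = 1 \/ l %% 4 = 3)%N by lia.
  have -> : chi4 l = 1 by rewrite /chi4; do !case: eqP; lia.
  have [x x0 xN] := exists_half_powerN.
  have [i iE] : exists i : F, i ^+ 2 = -1.
    exists (x ^+ (l.-1 %/ 4)); rewrite -exprM -xN; congr (_ ^+ _); lia.
  rewrite mul1r; congr (if _ then _ else _); apply/existsP/existsP => -[y /eqP yE].
    by exists (i * y); rewrite exprMn iE yE mulN1r opprK.
  by exists (i * y); rewrite exprMn iE yE mulN1r.
have -> : chi4 l = -1 by rewrite /chi4; do !case: eqP; lia.
have h : odd (l.-1)./2 by lia.
have sqN : ~ exists i : F, i ^+ 2 = -1.
  case=> i iE; have i0 : i != 0.
    by apply: contraTneq isT => i0; move/eqP: iE; rewrite i0 expr0n eq_sym oppr_eq0 oner_eq0.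
  have := fermat_unit i0; have -> : l.-1 = (2 * (l.-1)./2)%N by lia.
  by rewrite exprM iE -signr_odd h expr1 => /eqP; rewrite (negPf two0).
case: ifP => [/existsP[y /eqP yE]|/negbT yN]; case: ifP => [/existsP[z /eqP zE]|/negbT zN] //.
  case: sqN; exists (y / z); rewrite expr_div_n yE zE mulNr divff //.
exfalso; pose x : F := a%:~R ^+ (l.+1 %/ 4).
have xE : x ^+ 2 = a%:~R * a%:~R ^+ (l.-1)./2.
  by rewrite -exprM -exprS; congr (_ ^+ _); lia.
case: (half_power a0) => aE; rewrite aE in xE.
  by case/existsP: zN; exists x; rewrite xE mulr1.
by case/existsP: yN; exists x; rewrite xE mulrN1.
Qed.

End Legendre.

(** * Coefficients in residue classes *)

Lemma dissect_thetaV4 G : dissected (theta * V 4 G) (theta * G) G 0 0.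
Proof. rewrite /dissected !rmorph0 rmorphM /= {1}theta_XZ; ring. Qed.

Lemma B2_theta4 n : B2 (4 * n)%N = (theta * lambert) n.
Proof. by rewrite B2_theta (dissected0 _ (dissect_thetaV4 _)). Qed.

(** Multiply the four-square theorem by [theta]. *)
Lemma theta5_B2 n : (theta ^+ 5) n = theta n + 8 * B2 (4 * n)%N - 32 * B2 n.
Proof.
have -> : theta ^+ 5 = theta + 8%:R * (theta * lambert) - 32%:R * (theta * V 4 lambert).
  by rewrite [LHS]exprS theta4_lambert; ring.
by rewrite fcoefB fcoefD !fcoefZn B2_theta4 B2_theta.
Qed.

Lemma theta_nonsquare (n : nat) : (forall x : int, x ^+ 2 != n) -> theta n = 0.
Proof.
move=> nsq; rewrite theta.unlock /= fsbig1 // => x /= xn.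
by have := nsq x; rewrite -sqzE xn eqxx.
Qed.

Lemma theta_square s : (0 < s)%N -> theta (s ^ 2)%N = 2.
Proof.
move=> s0; rewrite theta.unlock /=.
rewrite (@fsum_split _ _ [set s%:Z] [set - s%:Z]).
- by rewrite !fsbig_set1.
- apply: (@sub_finite_set _ _ ([set s%:Z] `|` [set - s%:Z])).
    by move=> x /= xs; have : (x = s%:Z) \/ (x = - s%:Z); [move: xs; rewrite /sqz; nia | case; [left|right]].
  by rewrite finite_setU; split; exact: finite_set1.
- by move=> x /=; rewrite /sqz; split; [nia | case=> ->; nia].
- by move=> x /= ->; lia.
Qed.

(** For a square [N] the corrections in [hecke_w2_square] for [N] and [4 N] combine
    with the coefficients of [theta] to zero. *)
Lemma hecke_theta5 (l N : nat) : prime l -> odd l -> coprime N l -> (0 < N)%N ->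
  (theta ^+ 5) (l ^ 2 * N)%N + legendre N l * l%:Z * (theta ^+ 5) N
  = (1 + l%:Z ^+ 3) * (theta ^+ 5) N.
Proof.
move=> l_prime l_odd Nl N0.
have lN : ~~ (l %| N%:Z)%Z by rewrite dvdzE -prime_coprime // coprime_sym.
have l2 : coprime 2 l by rewrite coprime2n.
have lN4 : ~~ (l %| (4 * N)%N%:Z)%Z.
  by rewrite dvdzE -prime_coprime // coprimeMr coprime_sym -[4%N]/(2 * 2)%N coprimeMl l2 coprime_sym.
have leg4 : legendre (4 * N)%N l = legendre N l.
  by rewrite PoszM -[4%:Z]/(2%N%:Z ^+ 2) legendre_mul_square.
have E1 : (l ^ 2 * N)%N = l%:Z ^+ 2 * N%:Z :> int by rewrite PoszM -natz natrX natz.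
have E4 : (4 * (l ^ 2 * N))%N = l%:Z ^+ 2 * (4 * N)%N%:Z :> int by rewrite PoszM E1 [in RHS]PoszM; ring.
rewrite !theta5_B2 E4 E1.
have [[s sE]|nsq] := pselect (exists s, N = s ^ 2)%N.
  have s0 : (0 < s)%N by case: s sE N0 => [->|].
  have sl : coprime s l by move: Nl; rewrite sE coprime_pexpl.
  have sl2 : coprime (2 * s) l by rewrite coprimeMl l2 sl.
  have legN : legendre N l = 1.
    have -> : N%:Z = s%:Z ^+ 2 * 1 by rewrite sE mulr1 -natz natrX natz.
    rewrite legendre_mul_square // legendre_Fp ?dvdz1 //; last by have := prime_gt1 l_prime; lia.
    by rewrite ifT //; apply/existsP; exists 1; rewrite expr1n.
  have D1 : N%:Z = s%:Z ^+ 2 by rewrite sE -natz natrX natz.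
  have D4 : (4 * N)%N%:Z = (2 * s)%N%:Z ^+ 2 by rewrite PoszM D1 PoszM; ring.
  have s20 : (0 < 2 * s)%N by lia.
  have H1 := hecke_w2_square s0 l_prime l_odd sl.
  have H4 := hecke_w2_square s20 l_prime l_odd sl2.
  have tl : theta (l ^ 2 * N)%N = 2.
    by rewrite sE -expnMn theta_square // muln_gt0 prime_gt0.
  have tN : theta N = 2 by rewrite sE theta_square.
  rewrite legN tl tN; move: H1 H4; rewrite -D1 -D4.
  have -> : (4 * N)%N%:Z = 4 * N%:Z :> int by rewrite PoszM.
  move: (B2 (l%:Z ^+ 2 * N%:Z)) (B2 (l%:Z ^+ 2 * (4 * N%:Z))) (B2 N) (B2 (4 * N%:Z)) => a b c d H1 H4.
  move: (N%:Z) (l%:Z) H1 H4 => x y H1 H4.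
  lia.
have nsqN (x : int) : x ^+ 2 != N.
  by apply/eqP => xN; apply: nsq; exists (absz x); apply/eqP; rewrite -eqz_nat -xN -natz natrX natz real_normK ?num_real // ; apply/eqP; lia.
have nsq4 (x : int) : x ^+ 2 != (4 * N)%N.
  apply/eqP => xN; have [y yE] : exists y, x = 2 * y by exists (x %/ 2)%Z; move: xN; rewrite PoszM; nia.
  have /negP[] := nsqN y; apply/eqP; move: xN; rewrite yE PoszM; lia.
have H1 := hecke_w2 l_prime l_odd lN nsqN.
have H4 := hecke_w2 l_prime l_odd lN4 nsq4; rewrite leg4 in H4.
rewrite !theta_nonsquare //; last first.
  move=> x; rewrite E1; apply/eqP => xE.
  have : (l %| x)%Z.
    have : (l %| x ^+ 2)%Z by rewrite xE dvdz_mulr // dvdz_exp.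
    by rewrite !dvdzE abszX Euclid_dvdX // andbT.
  case/dvdzP=> y yE; have /negP[] := nsqN y; apply/eqP.
  have l0 : l%:Z ^+ 2 != 0 by rewrite expf_neq0 // -lt0n prime_gt0.
  by apply: (mulfI l0); rewrite -xE yE exprMn mulrC.
rewrite !add0r mulrBr !mulrA.
have -> : legendre N l * l%:Z * 8 * B2 (4 * N)%N = 8 * (legendre N l * l%:Z * B2 (4 * N)%N) by ring.
have -> : legendre N l * l%:Z * 32 * B2 N = 32 * (legendre N l * l%:Z * B2 N) by ring.
have -> : legendre N l * l%:Z * B2 (4 * N)%N = (1 + l%:Z ^+ 3) * B2 (4 * N)%N - B2 (l%:Z ^+ 2 * (4 * N)%N%:Z) by rewrite -H4; ring.
have -> : legendre N l * l%:Z * B2 N = (1 + l%:Z ^+ 3) * B2 N - B2 (l%:Z ^+ 2 * N%:Z) by rewrite -H1; ring.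
ring.
Qed.

Lemma V_Zn r c (f : fps int) : V r (c%:R * f) = c%:R * V r f.
Proof. by apply: fpsP => n; rewrite fcoefZn !fcoefV; case: ifP; rewrite ?fcoefZn ?mulr0. Qed.

Lemma VZ_scale (G H : fps int) c n : (forall k, odd k -> G k = c%:R * H k) -> (n %% 8 = 5)%N ->
  (V 4 G * (2%:R * (q * V 8 psi))) n = c%:R * (V 4 H * (2%:R * (q * V 8 psi))) n.
Proof.
move=> GH n5; apply/eqP; rewrite -subr_eq0 -fcoefZn -fcoefB.
have -> : V 4 G * (2%:R * (q * V 8 psi)) - c%:R * (V 4 H * (2%:R * (q * V 8 psi)))
   = V 4 (G - c%:R * H) * (2%:R * (q * V 8 psi)) by rewrite rmorphB /= V_Zn; ring.
apply/eqP; rewrite VZ_coef8 //; last by lia.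
move=> k kn; rewrite fcoefB fcoefZn GH ?subrr //.
by move: kn; have -> : ((n %/ 4) %% 2 = 1)%N by [lia]; rewrite modn2; case: odd.
Qed.

Lemma B2_VZ n : (n %% 8 = 5)%N -> B2 n = (V 4 lambert * (2%:R * (q * V 8 psi))) n.
Proof. by move=> n5; rewrite B2_theta (dissected1 (dissect_thetaV4 _)) //; lia. Qed.

Lemma B4_VZ n : (n %% 8 = 5)%N ->
  B4 n = (V 4 (lamb (fun d => d%:R ^+ 3)) * (2%:R * (q * V 8 psi))) n.
Proof. by move=> n5; rewrite B4_theta (dissected1 (dissect_thetaV4 _)) //; lia. Qed.

Lemma theta4_odd k : odd k -> (theta ^+ 4) k = 8 * lambert k.
Proof.
move=> k1; rewrite theta4_lambert fcoefB fcoefD !fcoefZn V4_odd // fcoef1.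
by case: k k1 => // k _; rewrite mulr0 subr0 add0r.
Qed.

Lemma thetaF2_odd k : odd k -> (thetaF ^+ 2) k = 0.
Proof. by move=> k1; rewrite thetaF_sqr V2_odd. Qed.

Lemma thetaF_B2 n : (n %% 8 = 5)%N -> (theta * thetaF) n = 4 * B2 n.
Proof.
move=> n5; have n1 : (n %% 4 = 1)%N by lia.
have := dissected1 dissect_thetaF n1; rewrite fcoefZn (@VZ_scale _ lambert 8) // -?B2_VZ //; first by lia.
by move=> k k1; rewrite mul1r expr0 mulr1 theta4_odd.
Qed.

Lemma theta5_B2_5mod8 n : (n %% 8 = 5)%N -> (theta ^+ 5) n = 56 * B2 n.
Proof.
move=> n5; have n1 : (n %% 4 = 1)%N by lia.
rewrite (dissected1 dissect_theta5 n1) (@VZ_scale _ lambert 56) // -?B2_VZ // => k k1.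
rewrite !expr0 !mulr1 expr1 fcoefD !fcoefZn theta4_odd // thetaF_sigma // -[sigma 1 k]/(lambert k); lia.
Qed.

(** At odd [k] the coefficients of [theta ^ 8], [theta ^ 4 thetaF], [thetaF ^ 2] are
    [16], [1], [0] times [sigma_3(k)], and [9 * 16 + 2016 = 2160].  The constants in
    the neighbouring lemmas arise in the same way. *)
Lemma theta9_B4 n : (n %% 8 = 5)%N -> (theta ^+ 9) n = 2160 * B4 n.
Proof.
move=> n5; have n1 : (n %% 4 = 1)%N by lia.
rewrite (dissected1 dissect_theta9 n1) (@VZ_scale _ (lamb (fun d => d%:R ^+ 3)) 2160) // -?B4_VZ // => k k1.
have -> : 9%:R * theta ^+ 8 * thetaF ^+ 0 + 2016%:R * theta ^+ 4 * thetaF ^+ 1 + 256%:R * theta ^+ 0 * thetaF ^+ 2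
  = 9%:R * theta ^+ 8 + 2016%:R * (theta ^+ 4 * thetaF) + 256%:R * thetaF ^+ 2 by ring.
rewrite 2!fcoefD 3!fcoefZn theta8_odd // thetaF2_odd // theta4F_sigma // -sigma_lamb.
move: (sigma 3 k) => x; lia.
Qed.

Lemma theta5F_B4 n : (n %% 8 = 5)%N -> (theta ^+ 5 * thetaF) n = 128 * B4 n.
Proof.
move=> n5; have n1 : (n %% 4 = 1)%N by lia.
have := dissected1 dissect_theta5F n1; rewrite fcoefZn (@VZ_scale _ (lamb (fun d => d%:R ^+ 3)) 256) // -?B4_VZ //; first by lia.
move=> k k1; rewrite !expr0 !mulr1 expr1 -mulrA !fcoefD !fcoefZn theta8_odd // theta4F_sigma //.
rewrite -sigma_lamb; lia.
Qed.

Lemma thetaF2_B4 n : (n %% 8 = 5)%N -> (theta * thetaF ^+ 2) n = 8 * B4 n.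
Proof.
move=> n5; have n1 : (n %% 4 = 1)%N by lia.
have := dissected1 dissect_thetaF2 n1; rewrite fcoefZn (@VZ_scale _ (lamb (fun d => d%:R ^+ 3)) 32) // -?B4_VZ //; first by lia.
by move=> k k1; rewrite expr1 -mulrA !fcoefZn theta4F_sigma // -sigma_lamb.
Qed.

(** The dissections differ by a multiple of [Z thetaF(q ^ 4)], whose coefficients at
    the residue [1] modulo [8] vanish as [thetaF] is odd. *)
Lemma theta5_thetaF n : (n %% 8 = 1)%N -> (theta ^+ 5) n = 10 * (theta * thetaF) n.
Proof.
move=> n8; have n1 : (n %% 4 = 1)%N by lia.
have EF := dissected1 dissect_thetaF n1; rewrite fcoefZn in EF.
rewrite (dissected1 dissect_theta5 n1).
have -> : V 4 (5%:R * theta ^+ 4 * thetaF ^+ 0 + 16%:R * theta ^+ 0 * thetaF ^+ 1) * (2%:R * (q * V 8 psi))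
   = 5%:R * (V 4 (1%:R * theta ^+ 4 * thetaF ^+ 0) * (2%:R * (q * V 8 psi))) + 16%:R * (V 4 thetaF * (2%:R * (q * V 8 psi))).
  have -> : 5%:R * theta ^+ 4 * thetaF ^+ 0 + 16%:R * theta ^+ 0 * thetaF ^+ 1 = 5%:R * (1%:R * theta ^+ 4 * thetaF ^+ 0) + 16%:R * thetaF by ring.
  rewrite rmorphD /= !V_Zn; ring.
rewrite fcoefD !fcoefZn -EF [X in _ + _ * X]VZ_coef8 //; first by lia.
move=> k kn; have k2 : (k = 2 * k./2)%N by lia.
have := congr1 (fun f : fps int => f k) neg_thetaF.
by rewrite fcoef_neg fcoefN k2 -signr_odd oddM /= mul1r; lia.
Qed.

(** * Sums of three squares *)

Lemma theta3_U4 n : (theta ^+ 3) (4 * n)%N = (theta ^+ 3) n.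
Proof. by rewrite (dissected0 _ dissect_theta3) expr0 mulr1 mul1r. Qed.

(** In the class of [3] modulo [4] only [Z ^ 3 = 8 q ^ 3 psi(q ^ 8) ^ 3] contributes. *)
Lemma theta3_7mod8 n : (n %% 8 = 7)%N -> (theta ^+ 3) n = 0.
Proof.
move=> n7; have n3 : (n %% 4 = 3)%N by lia.
rewrite (dissected3 dissect_theta3 n3); have [H ->] := Z_exp 3.
have -> : V 4 (1%:R * theta ^+ 0 * thetaF ^+ 0) * (q ^+ 3 * V 8 H) = q ^+ 3 * V 8 H.
  by rewrite !expr0 !mulr1 rmorph1 mul1r.
rewrite fcoefqXM; case: leqP => // _; rewrite fcoefV; case: ifP => // /dvdnP[k kE]; lia.
Qed.

Lemma nonsquare_mod8 (n : nat) : (n %% 8 = 3 \/ n %% 8 = 5)%N -> forall x : int, x ^+ 2 != n.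
Proof.
move=> n8 x; apply/eqP => xn.
have nE : n = (absz x ^ 2)%N by apply/eqP; rewrite -eqz_nat -xn -sqzE.
have : ((absz x %% 8) ^ 2 %% 8 = 3 \/ (absz x %% 8) ^ 2 %% 8 = 5)%N by rewrite modnXm -nE.
have : (absz x %% 8 < 8)%N by rewrite ltn_mod.
by move: (absz x %% 8)%N => -[|[|[|[|[|[|[|[|r]]]]]]]] // _ [] .
Qed.

Lemma lamb_chi4_3mod4 n : (n %% 4 = 3)%N -> lamb (fun d => chi4 d%:Z) n = 0.
Proof.
move=> n3; have n0 : (n == 0)%N = false by lia.
have Z0 : V 4 (0%:R * theta ^+ 0 * thetaF ^+ 0) * (2%:R * (q * V 8 psi)) ^+ 3 = 0.
  by rewrite (_ : 0%:R * _ * _ = 0) ?rmorph0 ?mul0r //; ring.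
have := dissected3 dissect_theta2 n3.
rewrite Z0 fcoef0 theta2_chi4 fcoefD fcoef1 n0 fcoefZn mulr0n add0r.
move: (fcoef (lamb _) n) => x; lia.
Qed.

Lemma fcoef_thetaM (G : fps int) n :
  (theta * G) n = \sum_(x \in [set x | (sqz x <= n)%N]) G (n - sqz x)%N.
Proof. by rewrite theta.unlock fcoef_cgfM //; exact: ffib_sqz. Qed.

(** A form of discriminant [4 n] has an even middle coefficient [2 x], and is then a
    solution [[- u, 2 x, v]] of [x ^ 2 + u v = n]. *)
Lemma R1_lamb2 n :
  R1 (4 * n)%N = (theta * V 1 (lamb2 (fun u v => if odd v then 0 else - chi4 u%:Z))) n.
Proof.
rewrite -fsum_theta_lamb2 // /R1 /simple_sum.
apply: (@fsum_bij _ _ _ _ (fun t : int * (nat * nat) => (- t.2.1%:Z, 2 * t.1, t.2.2%:Z))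
   (fun Q : qform => ((Q.1.2 %/ 2)%Z, (absz Q.1.1, absz Q.2)))).
- move=> [x [u v]] [/= u0 v0 E]; split; last by rewrite abszN !absz_nat mulKz.
  by split; rewrite /disc /= -?E ?PoszM ?PoszD ?sqzE; lia.
- move=> [[a b] c] [/= dQ a0 c0].
  have aE : (absz a)%:Z = - a by [lia]; have cE : (absz c)%:Z = c by lia.
  have bE : 2 * (b %/ 2)%Z = b.
    have : (2 %| b)%Z.
      have : (2 %| b ^+ 2)%Z.
        have -> : b ^+ 2 = 2 * (2 * (n%:Z + a * c)) by move: dQ; rewrite /disc /= PoszM; lia.
        exact: dvdz_mulr.
      by rewrite !dvdzE abszX Euclid_dvdX // andbT.
    by move=> b2; rewrite mulrC divzK.
  split; last by rewrite /= bE aE cE opprK.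
  split; [lia|lia|]; apply/eqP; rewrite -eqz_nat mul1n PoszD sqzE !PoszM aE cE; apply/eqP.
  by move: dQ; rewrite /disc /= -{1}bE PoszM; lia.
move=> [x [u v]] [/= u0 v0 E]; rewrite /w1 /chiQ /ev /=.
have -> : - u%:Z * 0 ^+ 2 + 2 * x * 0 * 1 + v%:Z * 1 ^+ 2 = v by ring.
have -> : (v%:Z != 0) by lia.
have e2 (k : nat) : (2 %| k%:Z)%Z = ~~ odd k by rewrite dvdzE /= dvdn2.
rewrite andbT rpredN !e2; case: (boolP (odd v)) => v2 /=; first by rewrite mulr0.
rewrite mulr1; case: (boolP (odd u)) => u2 /=; first by rewrite chi4N.
by rewrite /chi4; do !case: eqP; lia.
Qed.

(** By the two-square theorem, the coefficient of [theta ^ 3] is four times a sum of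
    [chi4] over the divisors of the numbers [n - x ^ 2].  For odd [x] these are [2]
    modulo [4], so that the odd divisors are those with an even complement; for
    even [x] they are [3] modulo [4] and contribute nothing. *)
Lemma theta3_R1 n : (n %% 8 = 3)%N -> (theta ^+ 3) n = - 4 * R1 (4 * n)%N.
Proof.
move=> n3; set L := lamb (fun d => chi4 d%:Z).
have nsq := nonsquare_mod8 (or_introl n3).
have -> : theta ^+ 3 = theta + 4%:R * (theta * L).
  by rewrite [LHS]exprS theta2_chi4 -/L; ring.
rewrite fcoefD theta_nonsquare // add0r fcoefZn R1_lamb2.
suff -> : (theta * V 1 (lamb2 (fun u v => if odd v then 0 else - chi4 u%:Z))) n = - (theta * L) n by ring.
rewrite -fcoefN -mulrN !fcoef_thetaM; apply: eq_fsum => // x xn.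
have {}xn : (sqz x <= n)%N by [].
rewrite fcoefN fcoefV dvd1n divn1; set m := (n - sqz x)%N.
have mq d k : (0 < d)%N -> m = (k * d)%N -> (m %/ d)%N = k by move=> d0 ->; rewrite mulnK.
have [y [yE|yE]] : exists y, x = 2 * y \/ x = 2 * y + 1 by exists (x %/ 2)%Z; lia.
  have mE : m%:Z = n%:Z - 4 * y ^+ 2 by rewrite /m -subzn // sqzE yE; ring.
  have m3 : (m %% 4 = 3)%N by lia.
  rewrite /L lamb_chi4_3mod4 // oppr0 /= big1 // => i _.
  case: (boolP (i.+1 %| m)%N) => [/dvdnP[k kE]|]; last by rewrite mul0r.
  have : odd (k * i.+1) by rewrite -kE; lia.
  by rewrite oddM (mq _ _ _ kE) // => /andP[-> _]; rewrite mulr0.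
have mE : m%:Z = n%:Z - 4 * (y ^+ 2 + y) - 1 by rewrite /m -subzn // sqzE yE; ring.
have [z zE] : exists z, y ^+ 2 + y = 2 * z.
  by have [z [zE|zE]] : exists z, y = 2 * z \/ y = 2 * z + 1; [exists (y %/ 2)%Z; lia | exists (z * (2 * z + 1)); rewrite zE; ring | exists ((2 * z + 1) * (z + 1)); rewrite zE; ring].
have m2 : (m %% 4 = 2)%N by lia.
rewrite /L /= -sumrN; apply: eq_bigr => i _.
case: (boolP (i.+1 %| m)%N) => [/dvdnP[k kE]|]; last by rewrite !mul0r oppr0.
rewrite (mq _ _ _ kE) // !mul1r; case: (boolP (odd k)) => // k1.
have i0 : ~~ odd i.+1 by apply/negP => i1; have : odd (k * i.+1) by [rewrite oddM k1]; rewrite -kE; lia.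
have -> : chi4 i.+1 = 0 by rewrite /chi4; move: i0; do !case: eqP; lia.
by rewrite oppr0.
Qed.

(** * Coefficients at [4 ^ j n] *)

Lemma theta3_4X j n : (theta ^+ 3) (4 ^ j * n)%N = (theta ^+ 3) n.
Proof. by elim: j => [|j IHj]; rewrite ?mul1n // expnS -mulnA theta3_U4. Qed.

Lemma theta5_U4 n : (theta ^+ 5) (4 * n)%N = (theta ^+ 5) n + 80 * (theta * thetaF) n.
Proof.
rewrite (dissected0 _ dissect_theta5) fcoefD !expr0 !mulr1 !expr1 mul1r.
by rewrite -mulrA fcoefZn.
Qed.

Lemma thetaF_U4 n : (theta * thetaF) (4 * n)%N = 8 * (theta * thetaF) n.
Proof.
have := dissected0 n dissect_thetaF; rewrite !expr1 -mulrA !fcoefZn; lia.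
Qed.

Lemma theta9_U4 n : (theta ^+ 9) (4 * n)%N = (theta ^+ 9) n + 2016 * (theta ^+ 5 * thetaF) n
  + 2304 * (theta * thetaF ^+ 2) n.
Proof.
rewrite (dissected0 _ dissect_theta9) 2!fcoefD expr0 mulr1 !expr1 mul1r.
by rewrite -2!mulrA 2!fcoefZn.
Qed.

Lemma theta5F_U4 n : (theta ^+ 5 * thetaF) (4 * n)%N = 120 * (theta ^+ 5 * thetaF) n
  + 128 * (theta * thetaF ^+ 2) n.
Proof.
have := dissected0 n dissect_theta5F; rewrite fcoefD !expr1 -2!mulrA 3!fcoefZn.
move: ((theta ^+ 5 * thetaF) n) ((theta * thetaF ^+ 2) n) => x y; lia.
Qed.

Lemma thetaF2_U4 n : (theta * thetaF ^+ 2) (4 * n)%N = 8 * (theta ^+ 5 * thetaF) n.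
Proof.
have := dissected0 n dissect_thetaF2; rewrite !expr1 -mulrA 2!fcoefZn; lia.
Qed.

(** The operator that keeps every fourth coefficient preserves the span of
    [theta ^ 5] and [theta thetaF], so one multiplier serves for all [n]. *)
Lemma theta5_4X (P : nat -> Prop) (B : nat -> int) a b j :
  (forall n, P n -> (theta ^+ 5) n = a * B n /\ (theta * thetaF) n = b * B n) ->
  exists c d, forall n, P n ->
    (theta ^+ 5) (4 ^ j * n)%N = c * B n /\ (theta * thetaF) (4 ^ j * n)%N = d * B n.
Proof.
move=> H; elim: j => [|j [c [d IHj]]].
  by exists a, b => n /H; rewrite mul1n.
exists (c + 80 * d), (8 * d) => n /IHj[E1 E2].
by rewrite expnS -mulnA theta5_U4 thetaF_U4 E1 E2; split; ring.
Qed.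

Lemma theta9_4X (P : nat -> Prop) (B : nat -> int) a b c j :
  (forall n, P n -> [/\ (theta ^+ 9) n = a * B n, (theta ^+ 5 * thetaF) n = b * B n
                      & (theta * thetaF ^+ 2) n = c * B n]) ->
  exists a' b' c', forall n, P n -> [/\ (theta ^+ 9) (4 ^ j * n)%N = a' * B n,
      (theta ^+ 5 * thetaF) (4 ^ j * n)%N = b' * B n
    & (theta * thetaF ^+ 2) (4 ^ j * n)%N = c' * B n].
Proof.
move=> H; elim: j => [|j [a' [b' [c' IHj]]]].
  by exists a, b, c => n /H; rewrite mul1n.
exists (a' + 2016 * b' + 2304 * c'), (120 * b' + 128 * c'), (8 * b') => n /IHj[E1 E2 E3].
by rewrite expnS -mulnA theta9_U4 theta5F_U4 thetaF2_U4 E1 E2 E3; split; ring.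
Qed.

(** * From [1 / theta] to overpartitions *)

Lemma OSOME_itheta n : 8 * OSOME n = (-1) ^+ n * (itheta n - (theta ^+ 3) n).
Proof.
have nt : neg theta * neg itheta = 1 by rewrite -rmorphM thetaV rmorph1.
have E : 8%:R * Fps OSOME = neg (itheta - theta ^+ 3).
  have := congr1 (fun f : fps int => f * neg itheta) OSOME_theta.
  rewrite -mulrA nt mulr1 => ->; rewrite rmorphB rmorphXn /= mulrBl mul1r.
  by rewrite exprSr -mulrA nt mulr1.
by have := congr1 (fun f : fps int => f n) E; rewrite fcoefZn fcoef_neg fcoefB.
Qed.

Lemma fmap_dvdz p (f g : fps int) n : prime p -> U p (fmap 'F_p f) = fmap 'F_p g ->
  (p %| f (p * n)%N - g n)%Z.
Proof.
move=> p_pr fg; rewrite (dvdz_Fp p_pr) rmorphB /= subr_eq0.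
by have := congr1 (fun h : fps 'F_p => h n) fg; rewrite fcoefU !fcoef_fmap => ->.
Qed.

(** [m] is odd, so the factor [8] in [OSOME_itheta] is harmless. *)
Lemma OSOME_dvdz m (g : fps int) n : prime m -> odd m ->
    U m (fmap 'F_m itheta) = fmap 'F_m g ->
    (theta ^+ 3) (m * n)%N = 0 -> (m %| g n)%Z -> (m %| OSOME (m * n))%Z.
Proof.
move=> m_pr m_odd /(@fmap_dvdz _ _ _ n m_pr) mg t0 gm.
have mi : (m %| itheta (m * n)%N)%Z.
  by rewrite -[itheta _](subrK (g n)) rpredD.
have : (m %| 8 * OSOME (m * n))%Z by rewrite OSOME_itheta t0 subr0 dvdz_mull.
rewrite !dvdzE abszM Gauss_dvdr // coprime_sym -[absz 8]/(2 ^ 3)%N coprimeXl //.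
by rewrite coprime2n.
Qed.

Theorem theorem1p9 (m : nat) (hm : m \in [:: 3; 5; 7; 11]%N)
  (l : nat) (l_prime : prime l) (l_odd : odd l)
  (eps : int) (heps : eps = 1 \/ eps = -1)
  (hl : (l%:Z ^+ (k_ m - 2) = -1 + eps * l%:Z ^+ ((k_ m - 3) %/ 2) %[mod m%:Z])%Z)
  (n : nat) (n_gt0 : (0 < n)%N) (n_l : coprime n l)
  (hn : legendre ((-1) ^+ ((k_ m - 1) %/ 2) * n%:Z) l = eps)
  (n_mod8 : (n = 7 * m %[mod 8])%N) (j : nat) :
  (OSOME (m * 4 ^ j * l ^ 2 * n)%N = 0 %[mod m%:Z])%Z.
Proof.
apply/eqP; rewrite eqz_mod_dvd subr0.
move/eqP: hl; rewrite eqz_mod_dvd => hl'.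
have l8 : ((l ^ 2) %% 8 = 1)%N.
  have [k [kE|kE]] : exists k, l = (4 * k + 1)%N \/ l = (4 * k + 3)%N by exists (l %/ 4)%N; lia.
    by rewrite kE (_ : _ ^ 2 = (2 * k ^ 2 + k) * 8 + 1)%N ?modnMDl //; ring.
  by rewrite kE (_ : _ ^ 2 = (2 * k ^ 2 + 3 * k + 1) * 8 + 1)%N ?modnMDl //; ring.
have ln8 : (l ^ 2 * n = n %[mod 8])%N by rewrite -modnMml l8 mul1n.
have lN : ~~ (l %| n%:Z)%Z by rewrite dvdzE -prime_coprime // coprime_sym.
have lsq (N : nat) : (l ^ 2 * N)%N = l%:Z ^+ 2 * N%:Z :> int by rewrite PoszM -natz natrX natz.
(* [m ^ 2] is [1] modulo [8], so that [m * (l ^ 2 * n)] is [7] *)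
have t3 : (m %% 2 = 1)%N -> (theta ^+ 3) (m * (4 ^ j * (l ^ 2 * n)))%N = 0.
  move=> m1; rewrite mulnCA theta3_4X; apply: theta3_7mod8.
  rewrite -modnMmr ln8 n_mod8 modnMmr.
  by move: hm; rewrite !inE => /or4P[] /eqP ->.
have -> : (m * 4 ^ j * l ^ 2 * n = m * (4 ^ j * (l ^ 2 * n)))%N by ring.
move: hm; rewrite !inE => /or4P[] /eqP mE; subst m.
- apply: (OSOME_dvdz _ _ U_itheta3) => //; first exact: t3.
  have n5 : (n %% 8 = 5)%N by rewrite n_mod8.
  have hn' : legendre n l = eps by rewrite -hn; congr legendre; ring.
  have H := hecke_theta5 l_prime l_odd n_l n_gt0.
  have [c [d E]] := @theta5_4X (fun k => k %% 8 = 5)%N (fun k => B2 k) 56 4 j (fun k k5 => conj (theta5_B2_5mod8 k5) (thetaF_B2 k5)).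
  have [-> _] := E (l ^ 2 * n)%N (etrans ln8 n5).
  rewrite !theta5_B2_5mod8 ?ln8 // hn' in H.
  have -> : B2 (l ^ 2 * n)%N = (1 + l%:Z ^+ 3 - eps * l%:Z) * B2 n.
    by apply: (@mulfI _ (56 : int)) => //; rewrite (canRL (addrK _) H); ring.
  rewrite mulrCA dvdz_mulr //; move: hl'; rewrite /k_ /= expr1.
  by congr (_ %| _)%Z; ring.
- apply: (OSOME_dvdz _ _ U_itheta5) => //; first exact: t3.
  have n3 : (n %% 8 = 3)%N by rewrite n_mod8.
  have hn' : legendre (- n%:Z) l = eps by rewrite -hn; congr legendre; ring.
  rewrite theta3_4X theta3_R1 ?ln8 //.
  have nz3 : (n%:Z %% 8)%Z = 3 by rewrite modz_nat n3.
  have H := hecke_w1 nz3 l_prime l_odd lN.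
  have leg : legendre (4 * n%:Z) l * chi4 l = eps.
    rewrite -[4]/(2%N%:Z ^+ 2) legendre_mul_square ?coprime2n // mulrC -legendreN //.
  rewrite leg in H.
  have -> : R1 (4 * (l ^ 2 * n))%N = (l%:Z + 1 - eps) * R1 (4 * n%:Z).
    have -> : (4 * (l ^ 2 * n))%N = l%:Z ^+ 2 * (4 * n%:Z) :> int by rewrite PoszM lsq; ring.
    by rewrite -[LHS](addrK (eps * R1 (4 * n%:Z))) H; ring.
  rewrite mulrCA dvdz_mulr //; move: hl'; rewrite /k_ /= expr1 expr0.
  by congr (_ %| _)%Z; ring.
- apply: (OSOME_dvdz _ _ U_itheta7) => //; first exact: t3.
  have n1 : (n %% 8 = 1)%N by rewrite n_mod8.
  have hn' : legendre n l = eps by rewrite -hn; congr legendre; ring.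
  have H := hecke_theta5 l_prime l_odd n_l n_gt0.
  have [c [d E]] := @theta5_4X (fun k => k %% 8 = 1)%N (fun k => (theta * thetaF) k) 10 1 j
    (fun k k1 => conj (theta5_thetaF k1) (esym (mul1r _))).
  have [E1 E2] := E (l ^ 2 * n)%N (etrans ln8 n1).
  rewrite -mulrA fcoefD fcoefZn E1 E2.
  rewrite !theta5_thetaF ?ln8 // hn' in H.
  have -> : (theta * thetaF) (l ^ 2 * n)%N = (1 + l%:Z ^+ 3 - eps * l%:Z) * (theta * thetaF) n.
    by apply: (@mulfI _ (10 : int)) => //; rewrite (canRL (addrK _) H); ring.
  have dist (s t : int) : c * (s * t) + 3 * (d * (s * t)) = s * ((c + 3 * d) * t) by ring.
  rewrite dist dvdz_mulr //; move: hl'; rewrite /k_ /= expr1.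
  by congr (_ %| _)%Z; ring.
apply: (OSOME_dvdz _ _ U_itheta11) => //; first exact: t3.
have n5 : (n %% 8 = 5)%N by rewrite n_mod8.
have hn' : legendre n l = eps by rewrite -hn; congr legendre; ring.
have nsq := nonsquare_mod8 (or_intror n5).
have H := hecke_w4 l_prime l_odd lN nsq; rewrite hn' -lsq in H.
have [a [b [c E]]] := @theta9_4X (fun k => k %% 8 = 5)%N (fun k => B4 k) 2160 128 8 j
  (fun k k5 => And3 (theta9_B4 k5) (theta5F_B4 k5) (thetaF2_B4 k5)).
have [E1 E2 _] := E (l ^ 2 * n)%N (etrans ln8 n5).
rewrite fcoefD E1 E2.
have -> : B4 (l ^ 2 * n)%N = (1 + l%:Z ^+ 7 - eps * l%:Z ^+ 3) * B4 n.
  by rewrite -[LHS](addrK (eps * l%:Z ^+ 3 * B4 n)) H; ring.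
rewrite -mulrDl mulrCA dvdz_mulr //; move: hl'; rewrite /k_ /=.
by congr (_ %| _)%Z; ring.
Qed.
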